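(* For any $g,\gamma\in\mathcal{S}(\mathbb{R}^d)$ and any $N>0$ there exists a constant $C>0$ such that, for every $S\in \mathrm{Sp}(d,\mathbb{R})$ and every Euler decomposition $(U,V,\Sigma)$ of $S$, $$\left|\langle \mu(S)\pi(z)g,\pi(w)\gamma\rangle\right|\le C\,(\det\Sigma)^{-1/2}\,\bigl(1+|D'U(w-Sz)|\bigr)^{-N},\qquad z,w\in\mathbb{R}^{2d},$$ where $D'=\begin{bmatrix}\Sigma^{-1}&O\\O&I\end{bmatrix}\in\mathbb{R}^{2d\times 2d}$.
   Context: Time-frequency shifts: for $z=(x,\xi)\in\mathbb{R}^{2d}$, $\pi(z)g(y)=e^{2\pi i y\cdot\xi}g(y-x)$, $y\in\mathbb{R}^d$. The bracket $\langle f,g\rangle=\int_{\mathbb{R}^d}f(t)\overline{g(t)}\,dt$ is the $L^2(\mathbb{R}^d)$ inner product. Symplectic group: $\mathrm{Sp}(d,\mathbb{R})=\{S\in \mathrm{GL}(2d,\mathbb{R}): S^\top JS=J\}$, $J=\begin{bmatrix}O&I\\-I&O\end{bmatrix}$; $\mathrm{U}(2d,\mathbb{R})=\mathrm{Sp}(d,\mathbb{R})\cap \mathrm{O}(2d,\mathbb{R})$ is the group of symplectic rotations. Metaplectic operators: for $S\in \mathrm{Sp}(d,\mathbb{R})$, $\mu(S)$ is the metaplectic operator associated with $S$, a unitary operator on $L^2(\mathbb{R}^d)$ defined up to sign, with $\mu(AB)=\pm\mu(A)\mu(B)$; it intertwines $\pi(Sz)=\mu(S)\pi(z)\mu(S)^{-1}$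 for all $z\in\mathbb{R}^{2d}$ up to a unimodular constant depending on $S,z$, and this property determines $\mu(S)$ up to a unimodular constant (which is irrelevant here). E.g. $\mu(J)$ is the Fourier transform $\hat f(\xi)=\int e^{-2\pi i x\cdot\xi}f(x)\,dx$. Euler decomposition: the singular values of $S\in\mathrm{Sp}(d,\mathbb{R})$ come in pairs $(\sigma,\sigma^{-1})$; label the largest $d$ of them so that $\sigma_1\ge\dots\ge\sigma_d\ge1$ and put $\Sigma=\mathrm{diag}(\sigma_1,\dots,\sigma_d)$, $D=\mathrm{diag}(\Sigma,\Sigma^{-1})$. There exist (non-unique) $U,V\in\mathrm{U}(2d,\mathbb{R})$ with $S=U^\top DV$; any such triple $(U,V,\Sigma)$ is called an Euler decomposition of $S$. *)

(* Defs.v *)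
From HB Require Import structures.
From mathcomp Require Import all_boot all_order all_algebra.
From mathcomp Require Import complex.
From mathcomp Require Import all_classical all_reals all_analysis.

Set Implicit Arguments.
Unset Strict Implicit.
Unset Printing Implicit Defensive.

Import Order.TTheory GRing.Theory Num.Theory.
Import numFieldNormedType.Exports.

Local Open Scope classical_set_scope.
Local Open Scope complex_scope.
Local Open Scope ring_scope.

(* R^n is 'cV[R]_n, so that a matrix acts on it by *m.  MathComp-Analysis has
   neither a sigma-algebra nor Lebesgue measure there; the former is generated
   by the coordinates (i.e. it is the Borel sigma-algebra), the latter is the
   n-fold product of the one-dimensional one. *)
Section measurable_cV.
Context (R : realType) (n : nat).

Let coord (i : 'I_n) (v : 'cV[R]_n) : R := v i ord0.

Let cV_set0 : g_sigma_preimage coord set0.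
Proof. exact: sigma_algebra0. Qed.

Let cV_setC A : g_sigma_preimage coord A -> g_sigma_preimage coord (~` A).
Proof. exact: sigma_algebraC. Qed.

Let cV_bigcup (F : (set 'cV[R]_n)^nat) :
  (forall i, g_sigma_preimage coord (F i)) ->
  g_sigma_preimage coord (\bigcup_i (F i)).
Proof. exact: sigma_algebra_bigcup. Qed.

HB.instance Definition _ :=
  @isMeasurable.Build (measure_tuple_display default_measure_display)
    'cV[R]_n (g_sigma_preimage coord) cV_set0 cV_setC cV_bigcup.

End measurable_cV.

Lemma measurable_fun_cVP (d : measure_display) (T : measurableType d)
    (R : realType) (n : nat) (f : T -> 'cV[R]_n) :
  measurable_fun [set: T] f <->
  forall i, measurable_fun [set: T] (fun x => f x i ord0).
Proof.
apply: (@iff_trans _ (g_sigma_preimage (fun i x => f x i ord0) `<=` measurable)).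
  rewrite (g_sigma_preimage_comp (fun i (v : 'cV[R]_n) => v i ord0) f).
  split=> [mf A [/= C preC <-]|prefS]; first exact: mf.
  by move=> _ A mA; apply: prefS; exists A.
split=> [fS i|mf].
- move=> _ A mA; apply: fS; apply: sub_sigma_algebra.
  case: n i => [[] []//|n i] in f *.
  rewrite -bigcup_mkord_ord; exists i; first exact: ltn_ord.
  by exists A => //; rewrite inord_val.
- apply: smallest_sub; first exact: sigma_algebra_measurable.
  case: n => [|n] in f mf *; first by rewrite big_ord0.
  rewrite -bigcup_mkord_ord; apply: bigcup_sub => i Ii.
  by move=> A [B mB <-]; exact: mf.
Qed.

Lemma measurable_coord (R : realType) (n : nat) (i : 'I_n) :
  measurable_fun [set: 'cV[R]_n] (fun v => v i ord0).
Proof. exact: (measurable_fun_cVP id).1. Qed.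

Section lebesgue_cV.
Context (R : realType).

Definition cons_cV n (p : R * 'cV[R]_n) : 'cV[R]_n.+1 :=
  col_mx (p.1)%:M p.2 : 'cV_(1 + n).

Definition uncons_cV n (v : 'cV[R]_n.+1) : R * 'cV[R]_n :=
  (v ord0 ord0, dsubmx (v : 'cV_(1 + n))).

Lemma cons_cVK n : cancel (@cons_cV n) (@uncons_cV n).
Proof.
case=> x v; rewrite /uncons_cV /cons_cV col_mxKd; congr pair.
have E : (col_mx (x%:M : 'M[R]_1) v) (lshift n ord0) ord0 = x.
  by rewrite col_mxEu mxE eqxx.
by rewrite -[RHS]E /=; congr fun_of_matrix; exact/val_inj.
Qed.

Lemma cons_cV0 n (p : R * 'cV[R]_n) : cons_cV p ord0 ord0 = p.1.
Proof. exact: (congr1 fst (cons_cVK p)). Qed.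

Lemma cons_cVS n (p : R * 'cV[R]_n) i :
  cons_cV p (lift ord0 i) ord0 = p.2 i ord0.
Proof.
rewrite (_ : lift ord0 i = rshift 1 i); last exact/val_inj.
exact: (col_mxEd (p.1)%:M p.2 i ord0).
Qed.

Lemma measurable_cons_cV n : measurable_fun setT (@cons_cV n).
Proof.
apply/measurable_fun_cVP => i; case: (unliftP ord0 i) => [j|] ->.
  under eq_fun do rewrite cons_cVS.
  by apply: (measurableT_comp (@measurable_coord R n j)).
by under eq_fun do rewrite cons_cV0; exact: measurable_fst.
Qed.

Lemma measurable_uncons_cV n : measurable_fun setT (@uncons_cV n).
Proof.
apply/measurable_fun_pairP; split; first exact: measurable_coord.
apply/measurable_fun_cVP => i.
rewrite (_ : (fun x => _) = fun v : 'cV[R]_n.+1 => v (rshift 1 i) ord0).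
  exact: (@measurable_coord R n.+1).
by apply/funext => v /=; rewrite mxE.
Qed.

Section step.
Local Open Scope ereal_scope.
Context (n : nat) (mu : {sigma_finite_measure set 'cV[R]_n -> \bar R}).

Definition lebesgue_step : set 'cV[R]_n.+1 -> \bar R :=
  pushforward (lebesgue_measure \x mu) (@cons_cV n).

Let step0 : lebesgue_step set0 = 0.
Proof. by rewrite /lebesgue_step /pushforward preimage_set0 measure0. Qed.

Let step_ge0 A : 0 <= lebesgue_step A.
Proof. exact: (measure_ge0 (lebesgue_measure \x mu)). Qed.

Let step_sigma_additive : semi_sigma_additive lebesgue_step.
Proof.
have mpre B : measurable B -> measurable (@cons_cV n @^-1` B).
  by move=> mB; rewrite -[X in measurable X]setTI; exact: measurable_cons_cV.
move=> F mF /trivIsetP tF mUF; rewrite /lebesgue_step /pushforward.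
rewrite preimage_bigcup; apply: measure_semi_sigma_additive.
- by move=> k; exact: mpre.
- apply/trivIsetP => i j _ _ ij.
  by rewrite -preimage_setI tF// preimage_set0.
- by rewrite -preimage_bigcup; exact: mpre.
Qed.

HB.instance Definition _ := isMeasure.Build _ _ _ lebesgue_step
  step0 step_ge0 step_sigma_additive.

Let step_sigma_finite : sigma_finite setT lebesgue_step.
Proof.
have /sigma_finiteP[F [FT ndF Foo]] := sigma_finiteT (@lebesgue_measure R).
have /sigma_finiteP[G [GT ndG Goo]] := sigma_finiteT mu.
exists (fun i => @uncons_cV n @^-1` (F i `*` G i)).
  rewrite -preimage_bigcup (_ : \bigcup_i _ = setT) ?preimage_setT//.
  apply/seteqP; split=> // -[x v] _.
  have [i _ Fx] : (\bigcup_i F i) x by rewrite -FT.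
  have [j _ Gv] : (\bigcup_j G j) v by rewrite -GT.
  exists (maxn i j) => //; split.
  - by move: x Fx; exact/subsetPset/ndF/leq_maxl.
  - by move: v Gv; exact/subsetPset/ndG/leq_maxr.
move=> k; have [mF Fk] := Foo k; have [mG Gk] := Goo k; split.
  rewrite -[X in measurable X]setTI.
  by apply: measurable_uncons_cV => //; exact: measurableX.
rewrite /lebesgue_step /pushforward -comp_preimage.
rewrite (_ : _ \o _ = id) ?preimage_id; last first.
  by apply/funext => p /=; exact: cons_cVK.
by rewrite product_measure1E// lte_mul_pinfty// ge0_fin_numE.
Qed.

HB.instance Definition _ := @Measure_isSigmaFinite.Build _ _ _ lebesgue_step
  step_sigma_finite.

End step.

Fixpoint lebesgue_cV (n : nat) : {sigma_finite_measure set 'cV[R]_n -> \bar R} :=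
  if n is n'.+1 return {sigma_finite_measure set 'cV[R]_n -> \bar R}
  then lebesgue_step (lebesgue_cV n')
  else \d_(0 : 'cV[R]_0).

End lebesgue_cV.
Arguments lebesgue_cV : clear implicits.

Lemma lebesgue_cV_box (R : realType) (n : nat) (A : 'I_n -> set R) :
    (forall i, measurable (A i)) ->
  lebesgue_cV R n [set v | forall i, A i (v i ord0)] =
    (\prod_(i < n) lebesgue_measure (A i))%E.
Proof.
elim: n A => [|n IHn] A mA.
  by rewrite big_ord0 /= diracE mem_set//= => -[].
pose B := [set v : 'cV[R]_n | forall i, A (lift ord0 i) (v i ord0)].
have mB : measurable B.
  rewrite (_ : B = \bigcap_(i in [set: 'I_n])
      ((fun v : 'cV[R]_n => v i ord0) @^-1` A (lift ord0 i))); last first.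
    by apply/seteqP; split=> v /= vA i; [move=> _|]; exact: vA.
  apply: fin_bigcap_measurable; first exact: finite_finset.
  move=> i _; rewrite -[X in measurable X]setTI.
  by apply: measurable_coord => //; exact: mA.
rewrite big_ord_recl -(IHn (fun i => A (lift ord0 i)))//.
rewrite -(product_measure1E lebesgue_measure (lebesgue_cV R n) (mA ord0) mB).
rewrite /lebesgue_step /pushforward.
congr (product_measure1 _ _ _); apply/seteqP; split => p /=.
  move=> pA; split; first by rewrite -cons_cV0; exact: pA.
  by move=> i; rewrite -cons_cVS; exact: pA.
case=> pA0 pA i; case: (unliftP ord0 i) => [j|] ->; last by rewrite cons_cV0.
by rewrite cons_cVS; exact: pA.
Qed.

Section vectors.
Context (R : realType) (n : nat).
Implicit Types x y : 'cV[R]_n.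

Definition dot x y : R := \sum_i x i ord0 * y i ord0.

(* the norm `|x| of MathComp-Analysis on matrices is the sup norm *)
Definition enorm x : R := Num.sqrt (dot x x).

End vectors.

Section schwartz.
Context (R : realType) (n : nat).

Definition partials (s : seq 'I_n) (f : 'cV[R]_n -> R) : 'cV[R]_n -> R :=
  foldr (fun i h x => 'D_(delta_mx i ord0) h x) f s.

Definition schwartz_real (f : 'cV[R]_n -> R) : Prop :=
  forall s : seq 'I_n,
    (forall x, differentiable (partials s f) x) /\
    (forall k : nat, exists C : R,
       forall x, (1 + enorm x) ^+ k * `|partials s f x| <= C).

Definition schwartz (f : 'cV[R]_n -> R[i]) : Prop :=
  schwartz_real (fun x => complex.Re (f x)) /\
  schwartz_real (fun x => complex.Im (f x)).

End schwartz.

Section L2.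
Context (R : realType) (n : nat).
Local Notation leb := (lebesgue_cV R n).
Implicit Types f g : 'cV[R]_n -> R[i].

Definition L2 f : Prop :=
  [/\ measurable_fun setT (fun x => complex.Re (f x)),
      measurable_fun setT (fun x => complex.Im (f x)) &
      (\int[leb]_x (ComplexField.Normc.normc (f x) ^+ 2)%:E < +oo)%E].

Definition inner f g : R[i] :=
  (\int[leb]_x complex.Re (f x * ((g x)^*)%C)) +i*
  (\int[leb]_x complex.Im (f x * ((g x)^*)%C)).

(* L^2 is represented by square-integrable functions, so operators are
   required to be compatible with a.e. equality and their algebraic properties
   hold up to it. *)
Definition L2_unitary (M : ('cV[R]_n -> R[i]) -> 'cV[R]_n -> R[i]) : Prop :=
  [/\ forall f, L2 f -> L2 (M f),
      forall f g, L2 f -> L2 g -> f = g %[ae leb] -> M f = M g %[ae leb],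
      forall (a : R[i]) f g, L2 f -> L2 g ->
        M (fun x => a * f x + g x) = (fun x => a * M f x + M g x) %[ae leb],
      forall f g, L2 f -> L2 g -> inner (M f) (M g) = inner f g &
      forall g, L2 g -> exists2 f, L2 f & M f = g %[ae leb]].

End L2.

Section time_frequency.
Context (R : realType) (d : nat).
Implicit Types (z : 'cV[R]_(d + d)) (g : 'cV[R]_d -> R[i]).

Definition expi (t : R) : R[i] := cos t +i* sin t.

Definition tfshift z g : 'cV[R]_d -> R[i] := fun y =>
  expi (2 * pi * dot y (dsubmx z)) * g (y - usubmx z).

(* the Schroedinger normalization of tfshift: these operators satisfy
   rho(z) rho(z') = e^{pi i (x'.xi - x.xi')} rho(z + z'), a relation which
   depends only on the symplectic form *)
Definition sym_tfshift z g : 'cV[R]_d -> R[i] := fun y =>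
  expi (- (pi * dot (usubmx z) (dsubmx z))) * tfshift z g y.

Definition symplJ : 'M[R]_(d + d) := block_mx 0 1%:M (- 1%:M) 0.

Definition symplectic (S : 'M[R]_(d + d)) : Prop :=
  S \in unitmx /\ S^T *m symplJ *m S = symplJ.

Definition symplectic_rotation (S : 'M[R]_(d + d)) : Prop :=
  symplectic S /\ S^T *m S = 1%:M.

(* M is a metaplectic operator associated with S, up to a unimodular constant.
   In terms of pi(z) = tfshift z the intertwining relation reads
     M pi(z) M^-1 = e^{pi i (x.xi - x'.xi')} pi(Sz)
   for z = (x, xi) and Sz = (x', xi').  The phase has to be prescribed: with an
   arbitrary phase depending on z, pi(a) M would qualify for every a. *)
Definition metaplectic (S : 'M[R]_(d + d))
    (M : ('cV[R]_d -> R[i]) -> 'cV[R]_d -> R[i]) : Prop :=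
  L2_unitary M /\
  forall z f, L2 f ->
    M (sym_tfshift z f) = sym_tfshift (S *m z) (M f) %[ae lebesgue_cV R d].

(* sigma lists the diagonal of Sigma; the factorization forces the sigma_i and
   their inverses to be the singular values of S *)
Definition euler_decomposition (S U V : 'M[R]_(d + d)) (sigma : 'rV[R]_d) :
    Prop :=
  [/\ symplectic_rotation U, symplectic_rotation V,
      forall i j : 'I_d, (i <= j)%N -> sigma ord0 j <= sigma ord0 i,
      forall i, 1 <= sigma ord0 i &
      S = U^T *m block_mx (diag_mx sigma) 0 0 (invmx (diag_mx sigma)) *m V].

End time_frequency.

(* Main.v *)
(* The operator M = mu(S) is only known through its commutation with the
   phase-space shifts rho(z), and this is enough: by Moyal's identity, with F =
   rho(p) M g, G = rho(-p) M (P g) and P f (y) = f (- y), the product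
   <F, gamma> conj<G, P gamma> is, up to a positive constant, the integral over
   z of <F, rho(z) G> conj<gamma, rho(z) P gamma>.  Covariance gives
   |<F, rho(z) G>| = |<g, rho(S^-1 (z - 2p)) P g>|, so that both factors of the
   integrand decay rapidly, and |<G, P gamma>| = |<F, gamma>| since M and P M P
   have the same ambiguity functions.  It remains to integrate
   (1 + |S^-1 (z - 2p)|)^-k (1 + |z|)^-k: in the coordinates given by U the
   matrix S^-1 dilates half of the variables by Sigma, which yields
   1 / det Sigma, and |D' U v| is at most |S^-1 v| and |v|, which yields the decay
   in D' U p.  The square root of this bound is the estimate. *)

Require Import Defs.
From mathcomp Require Import all_boot all_order all_algebra.
From mathcomp Require Import complex.
From mathcomp Require Import ring lra.
From mathcomp Require Import all_classical all_reals all_analysis.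
From mathcomp Require Import measurable_realfun.
Import Order.TTheory GRing.Theory Num.Theory.
Import numFieldNormedType.Exports.
Set Implicit Arguments.
Unset Strict Implicit.
Unset Printing Implicit Defensive.
Local Open Scope classical_set_scope.
Local Open Scope complex_scope.
Local Open Scope ring_scope.

(** Nothing is known of [M g] beyond square integrability, so all the regularity in Fourier
    inversion, Parseval and Moyal's identity has to be carried by the Schwartz pair [gamma],
    [P gamma]. What covariance does give is the cross-ambiguity function of [M g] and [M (P g)]: it
    is that of [g] and [P g], evaluated after [S^-1]. The shifts [p] and [- p] are opposite because
    a common shift changes an ambiguity function only by a phase, and all information on [p] would
    be lost; opposite shifts translate it by [2p]. The reflection is what makes this affordable: it
    conjugates [rho(p)] into [rho(-p)], so the second inner product still has the modulus of the
    first, and the identity bounds a square. Bounding a square, decay of order [m] costs [2m] powers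
    of the weight; another [2d] powers are reserved for convergence of the phase-space integral. The
    constant in Moyal's identity is kept symbolic and divided out by positivity. *)

(** * Measurability of vector-valued operations *)

Section measurable_cV_operations.
Context d (T : measurableType d) (R : realType) (n : nat).
Implicit Types f g : T -> 'cV[R]_n.

Lemma measurable_cVD f g : measurable_fun setT f -> measurable_fun setT g ->
  measurable_fun setT (fun x => f x + g x).
Proof.
move=> /measurable_fun_cVP mf /measurable_fun_cVP mg.
apply/measurable_fun_cVP => i; under eq_fun do rewrite mxE.
exact: measurable_funD.
Qed.

Lemma measurable_cVN f : measurable_fun setT f ->
  measurable_fun setT (fun x => - f x).
Proof.
move=> /measurable_fun_cVP mf.
apply/measurable_fun_cVP => i; under eq_fun do rewrite mxE.
by apply: measurable_funN; exact: mf.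
Qed.

Lemma measurable_cVB f g : measurable_fun setT f -> measurable_fun setT g ->
  measurable_fun setT (fun x => f x - g x).
Proof. by move=> mf mg; apply: measurable_cVD => //; exact: measurable_cVN. Qed.

Lemma measurable_cVZ (h : T -> R) f :
  measurable_fun setT h -> measurable_fun setT f ->
  measurable_fun setT (fun x => h x *: f x).
Proof.
move=> mh /measurable_fun_cVP mf.
apply/measurable_fun_cVP => i; under eq_fun do rewrite mxE.
exact: measurable_funM.
Qed.

Lemma measurable_mulmx m (A : 'M[R]_(m, n)) f : measurable_fun setT f ->
  measurable_fun setT (fun x => A *m f x).
Proof.
move=> /measurable_fun_cVP mf.
apply/measurable_fun_cVP => i; under eq_fun do rewrite mxE.
by apply: measurable_sum => j; exact: measurable_funM.
Qed.

Lemma measurable_col_mx m f (g : T -> 'cV[R]_m) :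
  measurable_fun setT f -> measurable_fun setT g ->
  measurable_fun setT (fun x => col_mx (f x) (g x)).
Proof.
move=> /measurable_fun_cVP mf /measurable_fun_cVP mg.
apply/measurable_fun_cVP => i; case: (split_ordP i) => j ->.
  by under eq_fun do rewrite col_mxEu; exact: mf.
by under eq_fun do rewrite col_mxEd; exact: mg.
Qed.

Lemma measurable_dot f g : measurable_fun setT f -> measurable_fun setT g ->
  measurable_fun setT (fun x => dot (f x) (g x)).
Proof.
move=> /measurable_fun_cVP mf /measurable_fun_cVP mg.
by apply: measurable_sum => j; exact: measurable_funM.
Qed.

Lemma measurable_enorm f : measurable_fun setT f ->
  measurable_fun setT (fun x => enorm (f x)).
Proof.
move=> mf; apply: (@measurableT_comp _ _ _ _ _ _ (@Num.sqrt R)).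
  exact: measurable_funTS (continuous_measurable_fun (@sqrt_continuous R)).
exact: measurable_dot.
Qed.

End measurable_cV_operations.

(** * Iterated integrals and translation invariance *)

Section measurable_partial_integral.
Context d1 d2 (T1 : measurableType d1) (T2 : measurableType d2) (R : realType).
Context (mu : {sigma_finite_measure set T2 -> \bar R}).
Local Open Scope ereal_scope.

Lemma ge0_measurable_partial_integral (f : T1 -> T2 -> \bar R) :
  measurable_fun setT (fun p : T1 * T2 => f p.1 p.2) ->
  (forall x y, 0 <= f x y) -> measurable_fun setT (fun x => \int[mu]_y f x y).
Proof.
by move=> mf f0; apply: (measurable_fun_fubini_tonelli_F
  (fun p : T1 * T2 => f p.1 p.2)) => // -[].
Qed.

End measurable_partial_integral.

Section iterated_integrals.
Context (R : realType).

Local Open Scope ereal_scope.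
Local Notation leb := (lebesgue_cV R).

(** By construction the measure in dimension [n.+1] is the pushforward of a product under [cons_cV],
    so Tonelli applies. Inductions on the dimension go through this formula. *)
Lemma ge0_integral_cVS n (F : 'cV[R]_n.+1 -> \bar R) :
  measurable_fun setT F -> (forall v, 0 <= F v) ->
  \int[leb n.+1]_v F v =
  \int[lebesgue_measure]_x \int[leb n]_v F (cons_cV (x, v)).
Proof.
move=> mF F0.
transitivity (\int[pushforward (lebesgue_measure \x leb n) (@cons_cV R n)]_v F v).
  apply: (eq_measure_integral (pushforward _ _)) => //.
  exact: measurable_cons_cV.
rewrite ge0_integral_pushforward//; last exact: measurable_cons_cV.
rewrite fubini_tonelli1//=.
exact: (measurableT_comp mF (@measurable_cons_cV R n)).
Qed.

Lemma ge0_integral_cV0 (F : 'cV[R]_0 -> \bar R) :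
  measurable_fun setT F -> \int[leb 0]_v F v = F 0%R.
Proof. by move=> mF; rewrite /= integral_dirac// diracT mul1e. Qed.

Local Opaque lebesgue_cV.

(** By uniqueness: the translated measure gives every half-open interval its length. *)
Lemma lebesgue_measure_shift (a : R) (A : set R) : measurable A ->
  pushforward lebesgue_measure ((fun x => x + a)%R : _ -> measurableTypeR R) A =
  lebesgue_measure A.
Proof.
have ma : measurable_fun setT (fun x : R => x + a)%R by exact: measurable_funD.
move=> mA; apply/esym; apply: lebesgue_measure_unique => // _ [[b c]] _ <-.
rewrite /= /pushforward (_ : _ @^-1` _ = `](b - a)%R, (c - a)%R]%classic).
  rewrite !lebesgue_measure_itv/= !lte_fin ltrD2r.
  by rewrite -!EFinD opprD opprK addrACA addNr addr0.
by apply/seteqP; split=> x /=; rewrite !in_itv/= ltrBlDr lerBrDr.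
Qed.

Lemma ge0_integral_shift (f : R -> \bar R) (a : R) :
  measurable_fun setT f -> (forall x, 0 <= f x) ->
  \int[lebesgue_measure]_x f (x + a)%R = \int[lebesgue_measure]_x f x.
Proof.
move=> mf f0; have ma : measurable_fun setT (fun x : R => x + a)%R.
  exact: measurable_funD.
transitivity (\int[pushforward lebesgue_measure
    ((fun x => x + a)%R : _ -> measurableTypeR R)]_x f x).
  by rewrite ge0_integral_pushforward// preimage_setT.
by apply: eq_measure_integral => // A mA _; exact: lebesgue_measure_shift.
Qed.

Lemma ge0_integral_cV_shift n (F : 'cV[R]_n -> \bar R) (a : 'cV[R]_n) :
  measurable_fun setT F -> (forall v, 0 <= F v) ->
  \int[leb n]_v F (v + a)%R = \int[leb n]_v F v.
Proof.
elim: n => [|n IHn] in F a * => mF F0.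
  rewrite !ge0_integral_cV0//; first by congr F; apply/matrixP => -[].
  by apply: measurableT_comp => //; exact: measurable_cVD.
have mFa : measurable_fun setT (fun v : 'cV[R]_n.+1 => F (v + a)%R).
  by apply: measurableT_comp => //; exact: measurable_cVD.
have mFc : measurable_fun setT (F \o @cons_cV R n).
  exact: measurableT_comp (@measurable_cons_cV R n).
rewrite (ge0_integral_cVS mFa (fun v => F0 _)) (ge0_integral_cVS mF F0).
rewrite -[RHS](ge0_integral_shift (a ord0 ord0)); last 2 first.
- exact: (@ge0_measurable_partial_integral _ _ (measurableTypeR R) _ _ (leb n)
    (fun x v => F (cons_cV (x, v)))).
- by move=> x; exact: integral_ge0.
apply: eq_integral => x _; rewrite -[RHS](IHn _ (uncons_cV a).2
  (measurableT_comp mFc (pair1_measurable (x + a ord0 ord0)%R)) (fun v => F0 _)).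
apply: eq_integral => v _; congr F; apply/matrixP => i j; rewrite ord1.
case: (unliftP ord0 i) => [k|] ->; rewrite mxE ?cons_cVS ?cons_cV0//= !mxE.
by congr (_ + a _ _)%R; exact/val_inj.
Qed.

(** Phase space is ['cV[R]_(d + d)], whereas Moyal's identity integrates over position and then over
    frequency; this passes from one form to the other. *)
Lemma ge0_integral_col_mx n m (F : 'cV[R]_(n + m) -> \bar R) :
  measurable_fun setT F -> (forall v, 0 <= F v) ->
  \int[leb (n + m)]_z F z = \int[leb n]_x \int[leb m]_y F (col_mx x y).
Proof.
elim: n => [|n IHn] in F * => mF F0.
  rewrite ge0_integral_cV0.
    apply: eq_integral => y _; congr F; apply/matrixP => i j.
    by rewrite [i in RHS](_ : i = rshift 0 i) ?col_mxEd//; exact/val_inj.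
  apply: ge0_measurable_partial_integral => //.
  by apply: measurableT_comp => //; exact: measurable_col_mx.
have mFc : measurable_fun setT (F \o @cons_cV R (n + m)).
  exact: measurableT_comp (@measurable_cons_cV R (n + m)).
rewrite (@ge0_integral_cVS (n + m) F mF F0) ge0_integral_cVS; last 2 first.
- apply: ge0_measurable_partial_integral => //.
  by apply: measurableT_comp => //; exact: measurable_col_mx.
- by move=> x; exact: integral_ge0.
apply: eq_integral => t _.
rewrite (IHn _ (measurableT_comp mFc (pair1_measurable t)) (fun v => F0 _)).
apply: eq_integral => x _; apply: eq_integral => y _.
congr F; apply/matrixP => i j; rewrite ord1; case: (split_ordP i) => k ->.
  rewrite col_mxEu; case: (unliftP ord0 k) => [l|] ->.
    rewrite [lshift m _](_ : _ = lift ord0 (lshift m (l : 'I_n)) :> 'I_(n + m).+1);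
      last exact/val_inj.
    by rewrite !cons_cVS col_mxEu.
  by rewrite [lshift m _](_ : _ = ord0 :> 'I_(n + m).+1) ?cons_cV0//; exact/val_inj.
rewrite col_mxEd [rshift n.+1 _](_ : _ = lift ord0 (rshift n k) :> 'I_(n + m).+1);
  last exact/val_inj.
by rewrite cons_cVS col_mxEd.
Qed.

End iterated_integrals.

(** * Linear changes of variables in Lebesgue integrals *)

Section linear_substitution.
Context (R : realType).
Local Notation leb := (lebesgue_cV R).
Local Opaque lebesgue_cV.

Lemma dotE n (x : 'cV[R]_n) : dot x x = \sum_i x i ord0 ^+ 2.
Proof. by apply: eq_bigr => i _; rewrite expr2. Qed.

Lemma dot_mulmx_orthogonal n (U : 'M[R]_n) (x : 'cV[R]_n) : U^T *m U = 1%:M ->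
  dot (U *m x) (U *m x) = dot x x.
Proof.
have dotM (y : 'cV[R]_n) : dot y y = (y^T *m y) ord0 ord0.
  by rewrite mxE; apply: eq_bigr => i _; rewrite mxE.
by move=> UU; rewrite !dotM trmx_mul mulmxA -(mulmxA _ U^T) UU mulmx1.
Qed.

Lemma dotN n (x : 'cV[R]_n) : dot (- x) (- x) = dot x x.
Proof. by apply: eq_bigr => i _; rewrite mxE mulrNN. Qed.

Section ereal.
Local Open Scope ereal_scope.

(* The uniqueness argument for Haar measure, which only uses translation
   invariance and Tonelli's theorem. *)
Lemma ge0_integral_mulmx_mul n (A B : 'M[R]_n) (f g : 'cV[R]_n -> \bar R) :
  (A *m B = 1%:M)%R ->
  measurable_fun setT f -> measurable_fun setT g ->
  (forall v, 0 <= f v) -> (forall v, 0 <= g v) ->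
  (\int[leb n]_v f v) * (\int[leb n]_v g (A *m v)%R) =
  (\int[leb n]_v g v) * (\int[leb n]_v f (- (A *m v))%R).
Proof.
move=> AB mf mg f0 g0.
(* Since [A *m B = 1], adding [x] after [A] amounts to adding [B *m x] before it, and translation
   invariance absorbs the latter. *)
have shift (h : 'cV[R]_n -> \bar R) (x : 'cV[R]_n) : measurable_fun setT h ->
    (forall v, 0 <= h v) ->
    \int[leb n]_v h (A *m v + x)%R = \int[leb n]_v h (A *m v)%R.
  move=> mh h0; pose hA (v : 'cV[R]_n) := h (A *m v)%R.
  have mhA : measurable_fun setT hA.
    by apply: measurableT_comp => //; exact: measurable_mulmx.
  rewrite -(ge0_integral_cV_shift (B *m x)%R mhA (fun v => h0 _)).
  by apply: eq_integral => v _; rewrite /hA mulmxDr mulmxA AB mul1mx.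
have mA : measurable_fun setT (fun v : 'cV[R]_n => A *m v)%R.
  exact: measurable_mulmx.
have mN : measurable_fun setT (fun v : 'cV[R]_n => f (- v)%R).
  by apply: measurableT_comp => //; exact: measurable_cVN.
have mfst : measurable_fun setT (fun p : 'cV[R]_n * 'cV[R]_n => p.1).
  exact: measurable_fst.
have msnd : measurable_fun setT (fun p : 'cV[R]_n * 'cV[R]_n => p.2).
  exact: measurable_snd.
have mA2 : measurable_fun setT (fun p : 'cV[R]_n * 'cV[R]_n => A *m p.2)%R.
  exact: measurable_mulmx.
rewrite -ge0_integralZr//; last exact: integral_ge0.
(* The inner integral does not see the translation by [x]. Once the integrals are exchanged,
   translating [x] by [A *m y] moves the dependence on [y] from [g] to [f]. *)
transitivity (\int[leb n]_x \int[leb n]_y (f x * g (A *m y + x)%R)).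
  apply: eq_integral => x _; rewrite ge0_integralZl// ?shift//.
  by apply: (measurableT_comp mg); exact: measurable_cVD.
rewrite (fubini_tonelli (fun p : 'cV[R]_n * 'cV[R]_n =>
    f p.1 * g (A *m p.2 + p.1)%R))//=; last 2 first.
- apply: emeasurable_funM; first exact: measurableT_comp.
  by apply: (measurableT_comp mg); exact: measurable_cVD.
- by move=> p; exact: mule_ge0.
transitivity (\int[leb n]_y \int[leb n]_x (f (x - A *m y)%R * g x)).
  apply: eq_integral => y _.
  rewrite -[RHS](ge0_integral_cV_shift (A *m y)%R); last 2 first.
  - by apply: emeasurable_funM => //; apply: (measurableT_comp mf);
      exact: measurable_cVB.
  - by move=> x; exact: mule_ge0.
  by apply: eq_integral => x _; rewrite addrK (addrC x).
rewrite (fubini_tonelli (fun p : 'cV[R]_n * 'cV[R]_n =>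
    f (p.2 - A *m p.1)%R * g p.2))//=; last 2 first.
- apply: emeasurable_funM; last exact: measurableT_comp.
  apply: (measurableT_comp mf); apply: measurable_cVB => //.
  exact: measurable_mulmx.
- by move=> p; exact: mule_ge0.
rewrite -ge0_integralZr//; last by apply: integral_ge0.
apply: eq_integral => x _; rewrite ge0_integralZr//; last first.
  by apply: (measurableT_comp mf); exact: measurable_cVB.
rewrite muleC -(shift (fun v => f (- v)%R) (- x)%R)//.
by congr (_ * _); apply: eq_integral => y _; rewrite opprD opprK addrC.
Qed.

Lemma ge0_integral_prod n (h : 'I_n -> R -> R) (c : 'I_n -> R) :
  (forall i, measurable_fun setT (h i)) -> (forall i x, (0 <= h i x)%R) ->
  (forall i, \int[lebesgue_measure]_x (h i x)%:E = (c i)%:E) ->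
  \int[leb n]_v (\prod_i h i (v i ord0))%:E = (\prod_i c i)%:E.
Proof.
have mp k (h' : 'I_k -> R -> R) : (forall i, measurable_fun setT (h' i)) ->
    measurable_fun setT (fun v : 'cV[R]_k => (\prod_i h' i (v i ord0))%:E).
  move=> mh'; apply/measurable_EFinP; apply: measurable_prod => i _.
  by apply: measurableT_comp => //; exact: measurable_coord.
elim: n => [|n IHn] in h c * => mh h0 hc.
  rewrite big_ord0 ge0_integral_cV0; first by rewrite big_ord0.
  exact: mp.
rewrite ge0_integral_cVS; last 2 first.
- exact: mp.
- by move=> v; rewrite lee_fin; apply: prodr_ge0.
rewrite big_ord_recl EFinM -hc -(IHn (fun i => h (lift ord0 i)))//.
rewrite -ge0_integralZr//; last 3 first.
- by apply/measurable_EFinP; exact: (mh ord0).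
- by move=> x _; rewrite lee_fin.
- by apply: integral_ge0 => v _; rewrite lee_fin; exact: prodr_ge0.
apply: eq_integral => x _; rewrite -ge0_integralZl//; last 3 first.
- by apply: (mp n (fun i => h (lift ord0 i))) => i; exact: mh.
- by move=> v _; rewrite lee_fin; exact: prodr_ge0.
- by rewrite lee_fin.
apply: eq_integral => v _; rewrite -EFinM big_ord_recl cons_cV0.
by congr ((_ * _)%R%:E); apply: eq_bigr => i _; rewrite cons_cVS.
Qed.

Lemma ge0_integral_gauss n :
  \int[leb n]_v (expR (- dot v v))%:E = (Num.sqrt pi ^+ n)%:E.
Proof.
rewrite -[n in RHS]card_ord -prodr_const.
rewrite -(@ge0_integral_prod _ (fun=> gauss_fun)).
- by apply: eq_integral => v _; rewrite dotE -sumrN expR_sum.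
- by move=> _; exact: measurable_gauss_fun.
- by move=> _; exact: gauss_fun_ge0.
- by move=> _; exact: integralT_gauss.
Qed.

(** Take the Gaussian for [f] in [ge0_integral_mulmx_mul]: it is invariant under [U] and under the
    sign, and its integral is finite and nonzero, hence cancels. *)
Lemma ge0_integral_mulmx_orthogonal n (U : 'M[R]_n) (g : 'cV[R]_n -> \bar R) :
  (U^T *m U = 1%:M)%R -> measurable_fun setT g -> (forall v, 0 <= g v) ->
  \int[leb n]_v g (U *m v)%R = \int[leb n]_v g v.
Proof.
move=> UU mg g0.
have mgauss : measurable_fun setT (fun v : 'cV[R]_n => (expR (- dot v v))%:E).
  apply/measurable_EFinP; apply: measurableT_comp => //.
  by apply: measurable_funN; exact: measurable_dot.
have := ge0_integral_mulmx_mul (mulmx1C UU) mgauss mg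
  (fun v => expR_ge0 _) g0.
rewrite [X in _ = _ * X -> _](_ : _ = (Num.sqrt pi ^+ n)%:E); last first.
  rewrite -ge0_integral_gauss; apply: eq_integral => v _.
  by rewrite dotN dot_mulmx_orthogonal.
rewrite ge0_integral_gauss muleC => /(congr1 (fun x => x * ((Num.sqrt pi ^+ n)^-1)%:E)).
rewrite -!muleA -EFinM mulfV ?mule1//.
by rewrite expf_neq0// sqrtr_eq0 -ltNge pi_gt0.
Qed.

Lemma ge0_integral_cV_opp n (g : 'cV[R]_n -> \bar R) :
  measurable_fun setT g -> (forall v, 0 <= g v) ->
  \int[leb n]_v g (- v)%R = \int[leb n]_v g v.
Proof.
move=> mg g0; rewrite -(@ge0_integral_mulmx_orthogonal _ (- 1%:M) g)//.
  by apply: eq_integral => v _; rewrite mulNmx mul1mx.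
by rewrite mulmxN mulmx1 linearN /= opprK trmx1.
Qed.

(** The same comparison, now with the indicator of the symmetric cube [[-1, 1]^n]: its preimage
    under [diag_mx s] is a box with half-sides [(s ord0 i)^-1], whose volume is known. *)
Lemma ge0_integral_diag_mx n (s : 'rV[R]_n) (g : 'cV[R]_n -> \bar R) :
  (forall i, (0 < s ord0 i)%R) ->
  measurable_fun setT g -> (forall v, 0 <= g v) ->
  \int[leb n]_v g (diag_mx s *m v)%R = ((\prod_i s ord0 i)^-1)%:E * \int[leb n]_v g v.
Proof.
move=> s0 mg g0.
pose box (r : 'I_n -> R) := [set v : 'cV[R]_n | forall i, `[(- r i)%R, r i]%classic (v i ord0)].
have mbox r : measurable (box r).
  rewrite (_ : box r = \bigcap_(i in [set: 'I_n])
      ((fun v : 'cV[R]_n => v i ord0) @^-1` `[(- r i)%R, r i]%classic)); last first.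
    by apply/seteqP; split=> v /= vr i; [move=> _|]; exact: vr.
  apply: fin_bigcap_measurable; first exact: finite_finset.
  by move=> i _; rewrite -[X in measurable X]setTI; apply: measurable_coord.
have intbox r : (forall i, (0 < r i)%R) ->
    \int[leb n]_v (\1_(box r) v)%:E = (\prod_i (2 * r i))%:E.
  move=> r0; rewrite integral_indic// setIT.
  rewrite [LHS](lebesgue_cV_box (A := fun i => `[(- r i)%R, r i]%classic))//.
  rewrite -prodEFin; apply: eq_bigr => i _.
  rewrite lebesgue_measure_itv/= lte_fin gtrN// opprK.
  by rewrite -EFinD mulr_natl mulr2n.
have sV : (diag_mx s *m diag_mx (\row_i (s ord0 i)^-1) = 1%:M)%R.
  apply/matrixP => i j; rewrite mul_diag_mx !mxE.
  by case: eqP => _; rewrite ?mulr0n ?mulr0// mulr1n mulfV// gt_eqF.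
have mind : measurable_fun setT (fun v : 'cV[R]_n => (\1_(box (fun=> 1%R)) v : R)%:E).
  exact/measurable_EFinP/measurable_indic.
have ind0 (v : 'cV[R]_n) : 0 <= (\1_(box (fun=> 1%R)) v : R)%:E by rewrite lee_fin.
have := ge0_integral_mulmx_mul sV mind mg ind0 g0.
rewrite intbox// [X in _ = _ * X -> _](_ : _ = (\prod_i (2 * (s ord0 i)^-1))%:E); last first.
  rewrite -intbox; last by move=> i; rewrite invr_gt0.
  apply: eq_integral => v _; congr (_%:E); rewrite !indicE; congr ((_ : bool)%:R).
  have absE i : (`|(- (diag_mx s *m v)) i ord0| <= 1)%R = (`|v i ord0| <= (s ord0 i)^-1)%R.
    by rewrite mxE normrN mul_diag_mx mxE normrM gtr0_norm// -ler_pdivlMl// mulr1.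
  apply/idP/idP; rewrite !inE => + i => /(_ i) /=.
    by rewrite !in_itv/= -!ler_norml absE.
  by rewrite !in_itv/= -!ler_norml absE.
rewrite !big_split/= muleC => /esym; rewrite muleC prodfV EFinM => E.
have c0 : (\prod_(i < n) (2 : R) != 0)%R by rewrite prodr_const expf_neq0.
have := congr1 (fun x => ((\prod_(i < n) (2 : R))^-1)%:E * x) E.
rewrite big1_eq mulr1 [in X in _ = X -> _]muleC -muleA !(muleA (_^-1)%:E) -EFinM.
by rewrite mulVf// mul1e -muleA -EFinM mulfV// mule1 => <-.
Qed.

End ereal.
End linear_substitution.

(** * The Euclidean inner product and norm *)

Section euclidean_norm.
Context (R : realType) (n : nat).
Implicit Types x y : 'cV[R]_n.

Lemma dotC x y : dot x y = dot y x.
Proof. by apply: eq_bigr => i _; rewrite mulrC. Qed.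

Lemma dotDr x y z : dot x (y + z) = dot x y + dot x z.
Proof. by rewrite -big_split; apply: eq_bigr => i _; rewrite mxE mulrDr. Qed.

Lemma dotZr a x y : dot x (a *: y) = a * dot x y.
Proof. by rewrite mulr_sumr; apply: eq_bigr => i _; rewrite mxE mulrCA. Qed.

Lemma dotDl x y z : dot (x + y) z = dot x z + dot y z.
Proof. by rewrite dotC dotDr !(dotC z). Qed.

Lemma dotZl a x y : dot (a *: x) y = a * dot x y.
Proof. by rewrite dotC dotZr dotC. Qed.

Lemma dotNl x y : dot (- x) y = - dot x y.
Proof. by rewrite -scaleN1r dotZl mulN1r. Qed.

Lemma dotNr x y : dot x (- y) = - dot x y.
Proof. by rewrite dotC dotNl dotC. Qed.

Lemma dot_ge0 x : 0 <= dot x x.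
Proof. by rewrite dotE sumr_ge0// => i _; exact: sqr_ge0. Qed.

Lemma enorm_ge0 x : 0 <= enorm x.
Proof. exact: sqrtr_ge0. Qed.

Lemma sqr_enorm x : enorm x ^+ 2 = dot x x.
Proof. by rewrite sqr_sqrtr// dot_ge0. Qed.

Lemma enormN x : enorm (- x) = enorm x.
Proof. by rewrite /enorm dotN. Qed.

Lemma enorm_orthogonal (U : 'M[R]_n) x : U^T *m U = 1%:M ->
  enorm (U *m x) = enorm x.
Proof. by move=> UU; rewrite /enorm dot_mulmx_orthogonal. Qed.

Lemma ler_enorm m (y : 'cV[R]_m) x : dot x x <= dot y y -> enorm x <= enorm y.
Proof. exact: ler_wsqrtr. Qed.

(** Cauchy-Schwarz, by expanding the square of [enorm y *: x - enorm x *: y] and dividing by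
    [2 * (enorm x * enorm y)]; vanishing norms are treated apart because of this division. *)
Lemma dot_le_enorm x y : dot x y <= enorm x * enorm y.
Proof.
have [x0|] := ltP 0 (enorm x); last first.
  rewrite le_eqVlt ltNge enorm_ge0 orbF => /eqP x0; rewrite x0 mul0r.
  have /eqP : dot x x = 0 by rewrite -sqr_enorm x0 expr0n.
  rewrite dotE psumr_eq0 => [/allP xi0|i _]; last exact: sqr_ge0.
  by rewrite [dot _ _]big1// => i _; move: (xi0 i (mem_index_enum _));
    rewrite sqrf_eq0 => /eqP ->; rewrite mul0r.
have := dot_ge0 (enorm y *: x - enorm x *: y).
have [y0|] := ltP 0 (enorm y); last first.
  rewrite le_eqVlt ltNge enorm_ge0 orbF => /eqP y0; rewrite y0 mulr0.
  have /eqP : dot y y = 0 by rewrite -sqr_enorm y0 expr0n.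
  rewrite dotE psumr_eq0 => [/allP yi0|i _]; last exact: sqr_ge0.
  by rewrite [dot x y]big1// => i _; move: (yi0 i (mem_index_enum _));
    rewrite sqrf_eq0 => /eqP ->; rewrite mulr0.
rewrite -scaleNr !(dotDl, dotDr, dotZl, dotZr) -!sqr_enorm (dotC y x) => h.
have : 0 <= 2 * (enorm x * enorm y) * (enorm x * enorm y - dot x y) by lra.
by rewrite pmulr_rge0 ?subr_ge0// !mulr_gt0.
Qed.

Lemma ler_enormD x y : enorm (x + y) <= enorm x + enorm y.
Proof.
rewrite -(ler_pXn2r (ltn0Sn 1)) ?nnegrE ?addr_ge0 ?enorm_ge0//.
rewrite sqr_enorm !(dotDl, dotDr) (dotC y x) -!sqr_enorm sqrrD.
have := dot_le_enorm x y; lra.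
Qed.

Lemma ler_norm_coord x i : `|x i ord0| <= enorm x.
Proof.
rewrite -(ler_pXn2r (ltn0Sn 1)) ?nnegrE ?enorm_ge0//.
rewrite sqr_enorm real_normK ?num_real// dotE (bigD1 i)//= lerDl sumr_ge0// => j _.
exact: sqr_ge0.
Qed.

Lemma ler_enorm_sum x : enorm x <= \sum_i `|x i ord0|.
Proof.
rewrite -(ler_pXn2r (ltn0Sn 1)) ?nnegrE ?enorm_ge0 ?sumr_ge0//.
rewrite sqr_enorm dotE [leRHS]expr2 mulr_suml ler_sum// => i _.
rewrite -real_normK ?num_real// expr2 ler_wpM2l// (bigD1 i)//= lerDl.
by rewrite sumr_ge0.
Qed.

End euclidean_norm.

Lemma enorm_col_mx (R : realType) n m (x : 'cV[R]_n) (y : 'cV[R]_m) :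
  enorm (col_mx x y) = Num.sqrt (dot x x + dot y y).
Proof.
rewrite /enorm /dot big_split_ord; congr (Num.sqrt (_ + _)).
  by apply: eq_bigr => i _; rewrite col_mxEu.
by apply: eq_bigr => i _; rewrite col_mxEd.
Qed.

(** * Polynomial weights *)

Section weights.
Context (R : realType).
Local Notation leb := (lebesgue_cV R).

Definition weight n (x : 'cV[R]_n) : R := 1 + enorm x.

Lemma weight_ge1 n (x : 'cV[R]_n) : 1 <= weight x.
Proof. by rewrite lerDl enorm_ge0. Qed.

Lemma weight_gt0 n (x : 'cV[R]_n) : 0 < weight x.
Proof. exact: lt_le_trans (weight_ge1 x). Qed.

Lemma weight_ge0 n (x : 'cV[R]_n) : 0 <= weight x.
Proof. exact/ltW/weight_gt0. Qed.

Lemma weightN n (x : 'cV[R]_n) : weight (- x) = weight x.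
Proof. by rewrite /weight enormN. Qed.

(** Submultiplicativity plays the role of Peetre's inequality: it converts decay in two vectors into
    decay in their sum. *)
Lemma weightD n (x y : 'cV[R]_n) : weight (x + y) <= weight x * weight y.
Proof.
rewrite /weight; have := ler_enormD x y.
by have := mulr_ge0 (enorm_ge0 x) (enorm_ge0 y); lra.
Qed.

Lemma measurable_weightV d (T : measurableType d) n (f : T -> 'cV[R]_n) k :
  measurable_fun setT f -> measurable_fun setT (fun x => weight (f x) ^- k).
Proof.
move=> mf; under eq_fun do rewrite -exprVn -powR_inv1 ?weight_ge0//.
have mw : measurable_fun setT (fun x => weight (f x)).
  by apply: measurable_funD => //; exact: measurable_enorm.
exact: (measurable_funX k (measurableT_comp (measurable_powR (-1)) mw)).
Qed.

Lemma weightVS n (x : 'cV[R]_n) k l : (k <= l)%N -> weight x ^- l <= weight x ^- k.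
Proof.
move=> kl; rewrite lef_pV2 ?posrE ?exprn_gt0 ?weight_gt0//.
exact: ler_weXn2l (weight_ge1 x) _ _ kl.
Qed.

(** Two powers of the weight per coordinate make the function at most the product of the
    [1 / (1 + x_i ^ 2)], each of which has integral [pi]. *)
Lemma integrable_weightV n k : (2 * n <= k)%N ->
  (leb n).-integrable setT (fun x => (weight x ^- k)%:E).
Proof.
move=> nk; apply/integrableP; split.
  by apply/measurable_EFinP; exact: measurable_weightV.
have mV : measurable_fun setT (fun t : R => (oneDsqr t)^-1).
  exact: continuous_measurable_fun (@continuous_oneDsqrV R).
apply: (@le_lt_trans _ _ (\int[leb n]_x (\prod_i (oneDsqr (x i ord0))^-1)%:E)%E); last first.
  rewrite (@ge0_integral_prod _ _ (fun _ t => (oneDsqr t)^-1) (fun=> pi)) ?ltry//.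
  move=> _; rewrite ge0_symfun_integralT//.
  - rewrite (_ : [set x | _] = `[0%R, +oo[%classic).
      by rewrite integral0y_oneDsqr -EFinM mulrC divfK.
    by apply/seteqP; split=> t /=; rewrite in_itv/= andbT.
    - exact: continuous_oneDsqrV.
  - by move=> t; rewrite /= /oneDsqr sqrrN.
apply: ge0_le_integral => //.
- by apply: measurableT_comp => //; apply/measurable_EFinP; exact: measurable_weightV.
- apply/measurable_EFinP; apply: measurable_prod => i _.
  exact: (measurableT_comp mV (measurable_coord i)).
move=> x _; rewrite abse_EFin lee_fin ger0_norm ?invr_ge0 ?exprn_ge0 ?weight_ge0//.
apply: le_trans (weightVS x nk) _; rewrite exprM.
have -> : (weight x ^+ 2) ^+ n = \prod_(i < n) weight x ^+ 2.
  by rewrite prodr_const card_ord.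
rewrite -prodfV; apply: ler_prod => i _.
rewrite invr_ge0 exprn_ge0 ?weight_ge0//= lef_pV2 ?posrE ?exprn_gt0 ?weight_gt0//.
rewrite /oneDsqr -real_normK ?num_real// /weight sqrrD expr1n mul1r.
have := enorm_ge0 x.
have : `|x i ord0| ^+ 2 <= enorm x ^+ 2.
  by rewrite ler_pXn2r ?nnegrE ?enorm_ge0 ?ler_norm_coord.
lra.
Qed.

End weights.

(** * Measurability of continuous functions of several variables *)

Section continuous_measurable.
Context (R : realType) (n : nat).

Let grid (k : nat) (z : 'cV[int]_n) : 'cV[R]_n :=
  \col_i ((z i ord0)%:~R / k.+1%:R).

Let coords (k : nat) (v : 'cV[R]_n) : 'cV[int]_n :=
  \col_i Num.floor (v i ord0 * k.+1%:R).

Let grid_coords_cvg (v : 'cV[R]_n) : grid k (coords k v) @[k --> \oo] --> v.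
Proof.
apply/cvg_ballP => e e0; near=> k.
have ke : k.+1%:R^-1 < e by near: k; exact: near_infty_natSinv_lt (PosNum e0).
rewrite mx_norm_ball; apply: le_lt_trans ke.
rewrite /Num.norm/= mx_normrE; apply: bigmax_le => [|[i j] _ /=].
  by rewrite invr_ge0.
have k0 : 0 < k.+1%:R :> R by [].
rewrite !mxE ord1 ler_distlC; move: (floor_itv (v i ord0 * k.+1%:R)).
rewrite intrD => /andP[h1 /ltW h2]; apply/andP; split.
  by rewrite lerBlDr -[X in _ + X]mul1r -mulrDl ler_pdivlMr.
by rewrite ler_pdivrMr// mulrDl mulVf ?gt_eqF// (le_trans h1)// lerDl.
Unshelve. all: by end_near. Qed.

(* Borel measurability for the sigma-algebra generated by the coordinates, by
   rounding the argument to finer and finer grids. *)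
Lemma continuous_measurable_cV (f : 'cV[R]_n -> R) :
  continuous f -> measurable_fun setT f.
Proof.
move=> cf; apply: (@measurable_fun_cvg _ _ _ _ (fun k v => f (grid k (coords k v)))).
  move=> k _ A mA; rewrite setTI.
  (* The rounded function factors through the countable set ['cV[int]_n], so the preimage is a
     countable union of cells, each a product of half-open intervals. *)
  rewrite (_ : _ @^-1` A = \bigcup_(z in [set: 'cV[int]_n])
      (if f (grid k z) \in A then [set v | coords k v = z] else set0)); last first.
    apply/seteqP; split=> v /=.
      by move=> fA; exists (coords k v) => //; rewrite mem_set.
    by move=> [z _]; case: ifPn => // /[!inE] ? /= ->.
  apply: countable_bigcupT_measurable; first exact: countableP.
  move=> z; case: ifPn => // _.
  rewrite (_ : [set v | _] = \bigcap_(i in [set: 'I_n])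
    ((fun v : 'cV[R]_n => v i ord0) @^-1`
       `[(z i ord0)%:~R / k.+1%:R, (z i ord0 + 1)%:~R / k.+1%:R[%classic)).
    apply: fin_bigcap_measurable; first exact: finite_finset.
    by move=> i _; rewrite -[X in measurable X]setTI; apply: measurable_coord.
  apply/seteqP; split=> v /=.
    move=> <- i _ /=; rewrite in_itv/= !mxE ler_pdivrMr// ltr_pdivlMr//.
    exact: floor_itv.
  move=> vz; apply/matrixP => i j; rewrite ord1 mxE; apply: floor_def.
  by have := vz i I; rewrite /= in_itv/= ler_pdivrMr// ltr_pdivlMr.
by move=> v _; apply: continuous_cvg; [exact: cf|exact: grid_coords_cvg].
Qed.

End continuous_measurable.

(** * Substitution for real-valued integrands *)

Section substitution.
Context d (T : measurableType d) (R : realType).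
Context (mu : {measure set T -> \bar R}) (phi : T -> T) (c : R).
Hypothesis c0 : 0 < c.
Hypothesis mphi : measurable_fun setT phi.
Hypothesis ge0_subst : forall f : T -> \bar R,
  measurable_fun setT f -> (forall x, (0 <= f x)%E) ->
  (\int[mu]_x f (phi x) = c%:E * \int[mu]_x f x)%E.

(** Apply the hypothesis to the positive and negative parts. Infinite integrals are covered by the
    convention that [fine] sends them to [0], whence the case analysis. *)
Lemma Rintegral_subst (f : T -> R) : measurable_fun setT f ->
  \int[mu]_x f (phi x) = c * \int[mu]_x f x.
Proof.
move=> mf; have mEf : measurable_fun setT (EFin \o f) by exact/measurable_EFinP.
have E : (\int[mu]_x (f (phi x))%:E =
    c%:E * \int[mu]_x (EFin \o f)^\+ x - c%:E * \int[mu]_x (EFin \o f)^\- x)%E.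
  rewrite [LHS]integralE; congr (_ - _)%E.
    rewrite -(ge0_subst (measurable_funepos mEf) (funepos_ge0 _)).
    by rewrite (funepos_comp (EFin \o f) phi).
  rewrite -(ge0_subst (measurable_funeneg mEf) (funeneg_ge0 _)).
  by rewrite (funeneg_comp (EFin \o f) phi).
rewrite /Rintegral E [in RHS]integralE.
have := integral_ge0 mu (D := setT) (fun x _ => funepos_ge0 (EFin \o f) x).
have := integral_ge0 mu (D := setT) (fun x _ => funeneg_ge0 (EFin \o f) x).
move: (\int[mu]_x _)%E (\int[mu]_x _)%E => [a| |] [b| |]//= a0 b0;
  rewrite ?gt0_muley ?lte_fin// ?mulr0//=; lra.
Qed.

Lemma integrable_subst (f : T -> R) : mu.-integrable setT (EFin \o f) ->
  mu.-integrable setT (EFin \o (f \o phi)).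
Proof.
move=> /integrableP[/measurable_EFinP mf foo]; apply/integrableP; split.
  by apply/measurable_EFinP; exact: measurableT_comp.
rewrite (ge0_subst (f := fun x => `|(f x)%:E|)%E)//.
  by rewrite lte_mul_pinfty// lee_fin ltW.
by apply: measurableT_comp => //; exact/measurable_EFinP.
Qed.

End substitution.

(** * Directional derivatives and the vanishing of their integrals *)

Section directional_derivatives.
Context (R : realType) (n : nat).
Local Notation leb := (lebesgue_cV R n).
Implicit Types (F : 'cV[R]_n -> R) (x y v : 'cV[R]_n).

(** The two difference quotients are the same function of [h]. With the converse
    [is_derive_of_line], directional derivatives are computed by one-variable calculus along a
    line. *)
Lemma is_derive_line F x v (t df : R) : is_derive (x + t *: v) v F df ->
  is_derive t 1 (fun s : R => F (x + s *: v)) df.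
Proof.
move=> [dF <-]; have E : (fun h : R => h^-1 *: (((fun s => F (x + s *: v)) \o shift t) (h *: 1) -
    F (x + t *: v))) = (fun h => h^-1 *: ((F \o shift (x + t *: v)) (h *: v) - F (x + t *: v))).
  apply/funext => h /=; congr (_ *: (F _ - _)).
  by rewrite scalerDl -scalerA scale1r addrCA.
by split; [rewrite /derivable E|rewrite /derive E].
Qed.

Lemma is_derive_of_line F x v (df : R) :
  is_derive (0 : R) 1 (fun s : R => F (x + s *: v)) df -> is_derive x v F df.
Proof.
move=> [dF <-]; have E : (fun h : R => h^-1 *: (((fun s => F (x + s *: v)) \o shift 0) (h *: 1) -
    F (x + 0 *: v))) = (fun h => h^-1 *: ((F \o shift x) (h *: v) - F x)).
  apply/funext => h /=; rewrite scale0r addr0 addr0 -[h *: 1 :> R]/(h * 1) mulr1.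
  by rewrite (addrC x).
by split; [rewrite /derivable -E|rewrite /derive E].
Qed.

Lemma weightV_shift k x y : weight (x + y) ^- k <= weight y ^+ k * weight x ^- k.
Proof.
have w := @weight_gt0 R n.
rewrite -ler_pdivrMl ?exprn_gt0// -invfM lef_pV2 ?posrE ?mulr_gt0 ?exprn_gt0//.
rewrite -exprMn lerXn2r ?nnegrE ?mulr_ge0 ?weight_ge0//.
by rewrite -(weightN y) mulrC -{1}(addrK y x) weightD.
Qed.

Lemma integrable_weight_bound F (C : R) k : (2 * n <= k)%N ->
  measurable_fun setT F -> (forall x, `|F x| <= C * weight x ^- k) ->
  leb.-integrable setT (EFin \o F).
Proof.
move=> nk mF Fw; have := integrableZl measurableT C (integrable_weightV R nk).
apply: le_integrable => //; first exact/measurable_EFinP.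
by move=> x _; rewrite /= lee_fin (le_trans (Fw x))// ler_norm.
Qed.

Lemma measurable_cV_shift x : measurable_fun setT (fun y : 'cV[R]_n => y + x).
Proof. exact: measurable_cVD. Qed.

Lemma Rintegral_cV_shift F x : measurable_fun setT F ->
  \int[leb]_y F (y + x) = \int[leb]_y F y.
Proof.
move=> mF; rewrite -[RHS]mul1r.
rewrite (@Rintegral_subst _ _ _ leb (fun y => y + x) 1)//.
by move=> f mf f0; rewrite mul1e ge0_integral_cV_shift.
Qed.

Lemma Rintegral_cV_opp F : measurable_fun setT F ->
  \int[leb]_y F (- y) = \int[leb]_y F y.
Proof.
move=> mF; rewrite -[RHS]mul1r.
rewrite (@Rintegral_subst _ _ _ leb -%R 1)//.
by move=> f mf f0; rewrite mul1e ge0_integral_cV_opp.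
Qed.

(* [s |-> \int F (y + s v) dy] is constant, and its derivative at [0] can be
   computed under the integral sign. *)
Lemma Rintegral_derive_eq0 F (dF : 'cV[R]_n -> R) v (C : R) k : (2 * n <= k)%N ->
  measurable_fun setT F -> (forall x, is_derive x v F (dF x)) ->
  (forall x, `|F x| <= C * weight x ^- k) ->
  (forall x, `|dF x| <= C * weight x ^- k) ->
  \int[leb]_y dF y = 0.
Proof.
move=> nk mF derF Fw dFw; pose f (s : R) (y : 'cV[R]_n) := F (y + s *: v).
have derf (s : R) y : is_derive s 1 (f ^~ y) (dF (y + s *: v)) by exact: is_derive_line.
have C0 : 0 <= C.
  have := le_trans (normr_ge0 _) (Fw 0).
  by rewrite pmulr_lge0// invr_gt0 exprn_gt0// weight_gt0.
(* For [|s| <= 1] a translation by [s *: v] costs at most the factor [weight v ^+ k], so this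
   majorant is independent of [s]. *)
pose G y := C * weight v ^+ k * weight y ^- k.
have bnd (s : R) y : `|s| <= 1 -> C * weight (y + s *: v) ^- k <= G y.
  move=> s1; rewrite /G -mulrA ler_wpM2l// (le_trans (weightV_shift _ _ _))//.
  rewrite ler_wpM2r ?invr_ge0 ?exprn_ge0 ?weight_ge0// lerXn2r ?nnegrE ?weight_ge0//.
  rewrite /weight lerD2l ler_enorm// dotZl dotZr mulrA -expr2.
  by rewrite -[leRHS]mul1r ler_wpM2r ?dot_ge0// -real_normK ?num_real// expr_le1.
have I1 (s : R) : `]-1, 1[%classic s -> `|s| <= 1.
  by rewrite /= in_itv/= => /andP[/ltW ? /ltW ?]; rewrite ler_norml; apply/andP.
have d1f s y : partial1of2 f s y = dF (y + s *: v).
  by rewrite partial1of2E; exact: derive_val.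
have intG : leb.-integrable setT (EFin \o G).
  by have := integrableZl measurableT (C * weight v ^+ k) (integrable_weightV R nk).
have I0 : `]-1, 1[%classic (0 : R) by rewrite /= in_itv/= ltrN10 ltr01.
have intf (s : R) : `]-1, 1[%classic s -> leb.-integrable setT (EFin \o f s).
  move=> /I1 s1; apply: (@integrable_weight_bound _ (C * weight v ^+ k) k) => //.
    exact: (measurableT_comp mF (measurable_cV_shift _)).
  by move=> y; exact: le_trans (Fw _) (bnd _ _ s1).
have G0 y : 0 <= G y by rewrite /G !mulr_ge0// ?invr_ge0 ?exprn_ge0 ?weight_ge0.
have d1G (s : R) y : `]-1, 1[%classic s -> setT y -> `|partial1of2 f s y| <= G y.
  by move=> /I1 s1 _; rewrite d1f; exact: le_trans (dFw _) (bnd _ _ s1).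
have dfs (s : R) y : `]-1, 1[%classic s -> setT y -> derivable (f ^~ y) s 1.
  by move=> _ _; have [] := derf s y.
have := differentiation_under_integral measurableT I0 intf dfs G0 intG d1G.
under [in RHS]eq_Rintegral do rewrite d1f scale0r addr0.
move=> <-; rewrite (_ : (fun s : R => _) = cst (\int[leb]_y F y)) ?derive1_cst//.
by apply/funext => s; rewrite Rintegral_cV_shift.
Qed.

End directional_derivatives.

(** * Real Schwartz functions and decay of their oscillatory integrals *)

Section schwartz_real_theory.
Context (R : realType) (n : nat).
Local Notation leb := (lebesgue_cV R n).
Implicit Types (f g : 'cV[R]_n -> R) (x y xi : 'cV[R]_n).

Definition partial (i : 'I_n) f : 'cV[R]_n -> R :=
  fun x => 'D_(delta_mx i ord0) f x.

(** The last index of the list is the innermost derivative, so differentiating [f] first means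
    appending an index. *)
Lemma schwartz_real_partial i f : schwartz_real f -> schwartz_real (partial i f).
Proof.
by move=> sf s; have := sf (rcons s i); rewrite /partials foldr_rcons.
Qed.

Lemma schwartz_real_is_derive f : schwartz_real f ->
  forall i x, is_derive x (delta_mx i ord0) f (partial i f x).
Proof.
move=> sf i x; apply: DeriveDef => //; apply: diff_derivable.
by have [] := sf [::].
Qed.

Lemma schwartz_real_continuous f : schwartz_real f -> continuous f.
Proof.
by move=> sf x; apply: differentiable_continuous; have [] := sf [::].
Qed.

Lemma schwartz_real_measurable f : schwartz_real f -> measurable_fun setT f.
Proof. by move=> /schwartz_real_continuous/continuous_measurable_cV. Qed.

Lemma schwartz_real_bound f : schwartz_real f -> forall k,
  exists2 C : R, 0 <= C & forall x, `|f x| <= C * weight x ^- k.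
Proof.
move=> sf k; have [_ /(_ k)[C Cf]] := sf [::]; exists C.
  by apply: le_trans (Cf 0); rewrite mulr_ge0// exprn_ge0// weight_ge0.
by move=> x; rewrite ler_pdivlMr ?exprn_gt0 ?weight_gt0// mulrC; exact: Cf.
Qed.

Lemma schwartz_real_opp f : schwartz_real f -> schwartz_real (fun x => f (- x)).
Proof.
move=> sf; have E s : partials s (fun x => f (- x)) =
    (fun x => (-1) ^+ size s * partials s f (- x)).
  elim: s => [|i s IHs] /=; first by apply/funext => x; rewrite mul1r.
  rewrite IHs; apply/funext => x.
  have dp : is_derive (- x) (delta_mx i ord0) (partials s f) (partial i (partials s f) (- x)).
    by apply: DeriveDef => //; apply: diff_derivable; exact: (sf s).1.
  apply: derive_val; apply: is_derive_of_line.
  have dN : is_derive (0 : R) 1 (fun t => partials s f (- x - t *: delta_mx i ord0))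
      (- partial i (partials s f) (- x)).
    have -> : (fun t : R => partials s f (- x - t *: delta_mx i ord0)) =
        (fun t => partials s f (- x + t *: delta_mx i ord0)) \o -%R.
      by apply/funext => t /=; rewrite scaleNr.
    rewrite -mulrN1; apply: is_derive1_comp; rewrite oppr0.
    by apply: is_derive_line; rewrite scale0r addr0.
  under eq_fun do rewrite opprD.
  rewrite exprS mulN1r mulNr -mulrN.
  exact: (is_deriveZ _ dN).
move=> s; rewrite E; split.
  move=> x; apply: differentiableM => //; apply: differentiable_comp => //.
  exact: (sf s).1.
move=> k; have [C Cf] := (sf s).2 k; exists C => x.
by rewrite normrM normrX normrN1 expr1n mul1r -enormN.
Qed.

(** The real building block of the short-time Fourier transform. The free phase [theta] closes the
    family under integration by parts, sines being cosines with phase shifted by [- pi / 2]; a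
    single induction then serves real and imaginary parts. *)
Definition cosint f g x xi (theta : R) : R :=
  \int[leb]_y (f y * g (y - x) * cos (2 * pi * dot y xi + theta)).

Lemma measurable_cosint f g x xi theta :
  schwartz_real f -> schwartz_real g -> measurable_fun setT
    (fun y => f y * g (y - x) * cos (2 * pi * dot y xi + theta)).
Proof.
move=> /schwartz_real_measurable mf /schwartz_real_measurable mg.
apply: measurable_funM; first apply: measurable_funM => //.
  by apply: measurableT_comp => //; exact: measurable_cV_shift.
apply: (measurableT_comp (continuous_measurable_fun (@continuous_cos R))).
apply: measurable_funD => //; apply: measurable_funM => //.
exact: measurable_dot.
Qed.

(** Of the [k + 2 * n] powers of decay of [f], [k] combine with those of [g (y - x)] into decay in
    [x], because [x = y - (y - x)]; the other [2 * n] are kept for integrability in [y]. *)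
Lemma norm_cosint_integrand f g : schwartz_real f -> schwartz_real g ->
  forall k, exists2 C : R, 0 <= C & forall x xi theta y,
  `|f y * g (y - x) * cos (2 * pi * dot y xi + theta)| <=
    C * weight x ^- k * weight y ^- (2 * n).
Proof.
move=> sf sg k; have [A A0 Af] := schwartz_real_bound sf (k + 2 * n).
have [B B0 Bg] := schwartz_real_bound sg k.
exists (A * B); first exact: mulr_ge0.
move=> x xi theta y; rewrite !normrM.
apply: (@le_trans _ _ (`|f y| * `|g (y - x)|)).
  by rewrite ler_piMr ?mulr_ge0// ler_norml cos_geN1 cos_le1.
apply: (le_trans (ler_pM _ _ (Af y) (Bg (y - x)))) => //.
rewrite exprD invfM [leLHS](_ : _ = A * B * weight y ^- (2 * n) *
  (weight y * weight (y - x)) ^- k); last by rewrite exprMn invfM; ring.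
rewrite [leRHS]mulrAC ler_wpM2l ?mulr_ge0 ?invr_ge0 ?exprn_ge0 ?weight_ge0//.
rewrite lef_pV2 ?posrE ?exprn_gt0 ?mulr_gt0 ?weight_gt0//.
rewrite lerXn2r ?nnegrE ?mulr_ge0 ?weight_ge0// -(weightN (y - x)) opprB.
by rewrite -{1}(subrKC y x) weightD.
Qed.

Lemma integrable_cosint f g x xi theta : schwartz_real f -> schwartz_real g ->
  leb.-integrable setT
    (EFin \o (fun y => f y * g (y - x) * cos (2 * pi * dot y xi + theta))).
Proof.
move=> sf sg; have [C C0 Cfg] := norm_cosint_integrand sf sg 0.
apply: (@integrable_weight_bound _ _ _ C (2 * n)) => //.
  exact: measurable_cosint.
by move=> y; have := Cfg x xi theta y; rewrite invr1 mulr1.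
Qed.

Lemma norm_cosint f g : schwartz_real f -> schwartz_real g ->
  forall k, exists2 C : R, 0 <= C & forall x xi theta,
  `|cosint f g x xi theta| <= C * weight x ^- k.
Proof.
move=> sf sg k; have [C C0 Cfg] := norm_cosint_integrand sf sg k.
have iw := integrable_weightV R (leqnn (2 * n)).
exists (C * \int[leb]_y weight y ^- (2 * n)).
  by rewrite mulr_ge0// Rintegral_ge0// => y _; rewrite invr_ge0 exprn_ge0 ?weight_ge0.
move=> x xi theta; apply: (le_trans (le_normr_Rintegral _ _)) => //.
  exact: integrable_cosint.
rewrite mulrAC -RintegralZl//; apply: le_Rintegral => //.
- apply: integrable_norm; exact: integrable_cosint.
- by have := integrableZl measurableT (C * weight x ^- k) iw.
Qed.

(** The integrand with phase [theta - pi / 2] has a partial derivative of integral zero, and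
    differentiating its cosine gives [2 * pi * xi i ord0] times the cosine with phase [theta]. *)
Lemma cosint_partial f g i x xi theta : schwartz_real f -> schwartz_real g ->
  2 * pi * xi i ord0 * cosint f g x xi theta =
  - (cosint (partial i f) g x xi (theta - pi / 2) +
     cosint f (partial i g) x xi (theta - pi / 2)).
Proof.
move=> sf sg; have spf := schwartz_real_partial i sf.
have spg := schwartz_real_partial i sg.
have scaleE (a b : R) : a *: b = a * b by [].
pose F y := f y * g (y - x) * cos (2 * pi * dot y xi + (theta - pi / 2)).
pose dF y := partial i f y * g (y - x) * cos (2 * pi * dot y xi + (theta - pi / 2)) +
  f y * partial i g (y - x) * cos (2 * pi * dot y xi + (theta - pi / 2)) +
  2 * pi * xi i ord0 * (f y * g (y - x) * cos (2 * pi * dot y xi + theta)).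
have derF y : is_derive y (delta_mx i ord0) F (dF y).
  apply: is_derive_of_line.
  have d1 : is_derive (0 : R) 1 (fun t => f (y + t *: delta_mx i ord0)) (partial i f y).
    by apply: is_derive_line; rewrite scale0r addr0; exact: schwartz_real_is_derive.
  have d2 : is_derive (0 : R) 1 (fun t => g (y + t *: delta_mx i ord0 - x)) (partial i g (y - x)).
    under eq_fun do rewrite addrAC.
    by apply: is_derive_line; rewrite scale0r addr0; exact: schwartz_real_is_derive.
  have dotd t : dot (y + t *: delta_mx i ord0) xi = dot y xi + t * xi i ord0.
    rewrite dotDl dotZl; congr (_ + _ * _); rewrite /dot (bigD1 i)//= mxE !eqxx mul1r.
    by rewrite big1 ?addr0// => j ji; rewrite mxE (negbTE ji) mul0r.
  have d3 : is_derive (0 : R) 1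
      (fun t => cos (2 * pi * dot (y + t *: delta_mx i ord0) xi + (theta - pi / 2)))
      (2 * pi * xi i ord0 * cos (2 * pi * dot y xi + theta)).
    under eq_fun do rewrite dotd.
    have dl : is_derive (0 : R) 1
        (fun t => 2 * pi * (dot y xi + t * xi i ord0) + (theta - pi / 2)) (2 * pi * xi i ord0).
      apply: is_derive_eq; rewrite /= !scaler0 !addr0 !add0r.
      by rewrite mul1r !scaleE mulr1.
    have := is_derive1_comp (is_derive_cos _) dl.
    rewrite (_ : - sin _ * _ = 2 * pi * xi i ord0 * cos (2 * pi * dot y xi + theta))//.
    by rewrite mul0r addr0 addrA sinBpihalf opprK mulrC.
  have := is_deriveM (is_deriveM d1 d2) d3.
  rewrite !fctE !scale0r !addr0 => dP; apply: is_derive_eq.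
  rewrite /dF !scaleE; ring.
have [A A0 Ab] := norm_cosint_integrand spf sg 0.
have [B B0 Bb] := norm_cosint_integrand sf spg 0.
have [C C0 Cb] := norm_cosint_integrand sf sg 0.
have M0 : 0 <= `|2 * pi * xi i ord0| by [].
(* One constant has to bound both [F] and [dF]: the [1 +] in front of [C] accounts for [F], the
   other terms for the three summands of [dF]. *)
have := @Rintegral_derive_eq0 R n F dF (delta_mx i ord0)
  (A + B + (1 + `|2 * pi * xi i ord0|) * C) (2 * n) (leqnn _)
  (measurable_cosint _ _ _ sf sg) derF.
have I1 := integrable_cosint x xi (theta - pi / 2) spf sg.
have I2 := integrable_cosint x xi (theta - pi / 2) sf spg.
have I3 := integrable_cosint x xi theta sf sg.
rewrite /dF RintegralD//; last 2 first.
- by have := integrableD measurableT I1 I2.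
- by have := integrableZl measurableT (2 * pi * xi i ord0) I3.
rewrite RintegralD// RintegralZl// -!/(cosint _ _ _ _ _) => dF0.
apply/eqP; rewrite -addr_eq0 addrC; apply/eqP; apply: dF0 => y.
  have := Cb x xi (theta - pi / 2) y; rewrite expr0 invr1 mulr1 => /le_trans; apply.
  rewrite ler_wpM2r ?invr_ge0 ?exprn_ge0 ?weight_ge0//.
  by rewrite mulrDl mul1r addrCA lerDl addr_ge0 ?addr_ge0 ?mulr_ge0.
apply: le_trans (ler_normD _ _) _; rewrite [X in _ + X]normrM.
have := Ab x xi (theta - pi / 2) y; have := Bb x xi (theta - pi / 2) y.
have := Cb x xi theta y; rewrite expr0 invr1 !mulr1 => hC hB hA.
have := ler_normD (partial i f y * g (y - x) * cos (2 * pi * dot y xi + (theta - pi / 2)))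
  (f y * partial i g (y - x) * cos (2 * pi * dot y xi + (theta - pi / 2))).
have := ler_wpM2l M0 hC; have := normr_ge0 (f y * g (y - x) * cos (2 * pi * dot y xi + theta)).
move: hA hB hC; move: (weight y ^- (2 * n)) `|2 * pi * xi i ord0|.
move: `|f y * _ * _| `|partial i f y * _ * _| `|f y * partial i g _ * _|.
by move: `|_ + _| => a b c e w M; nra.
Qed.

(* Integration by parts trades a factor [2 pi xi_i] for a derivative of [f] or
   of [g]. *)
Lemma cosint_decay f g : schwartz_real f -> schwartz_real g ->
  forall k l, exists2 C : R, 0 <= C & forall x xi theta,
  `|cosint f g x xi theta| * (1 + \sum_i `|xi i ord0|) ^+ l <= C * weight x ^- k.
Proof.
move=> sf sg k l; elim: l f g sf sg => [|l IHl] f g sf sg.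
  by have [C C0 Cb] := norm_cosint sf sg k; exists C => // x xi theta; rewrite mulr1.
have [A A0 Ab] := IHl _ _ sf sg.
have /choice[B /all_and2[B0 Bb]] i : exists B : R, 0 <= B /\ forall x xi theta,
    `|cosint (partial i f) g x xi theta| * (1 + \sum_i `|xi i ord0|) ^+ l <= B * weight x ^- k.
  by have [B ? ?] := IHl _ _ (schwartz_real_partial i sf) sg; exists B.
have /choice[C /all_and2[C0 Cb]] i : exists B : R, 0 <= B /\ forall x xi theta,
    `|cosint f (partial i g) x xi theta| * (1 + \sum_i `|xi i ord0|) ^+ l <= B * weight x ^- k.
  by have [D ? ?] := IHl _ _ sf (schwartz_real_partial i sg); exists D.
exists (A + \sum_i (B i + C i)).
  by rewrite addr_ge0// sumr_ge0// => i _; rewrite addr_ge0.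
move=> x xi theta; pose S := (1 + \sum_i `|xi i ord0|) ^+ l.
have S0 : 0 <= S by rewrite exprn_ge0// addr_ge0// sumr_ge0.
(* The additional factor is distributed: its summand [1] is bounded by the induction hypothesis for
   [f] and [g], and each summand [|xi_i|] is traded for a derivative. *)
rewrite exprSr mulrA -/S mulrDr mulr1 [leRHS]mulrDl lerD//.
rewrite mulr_sumr mulr_suml ler_sum// => i _.
have p2 : 1 <= 2 * pi :> R by have := pi_ge2 R; lra.
have : `|xi i ord0| * `|cosint f g x xi theta| <= `|cosint (partial i f) g x xi (theta - pi / 2)| +
     `|cosint f (partial i g) x xi (theta - pi / 2)|.
  apply: le_trans (ler_normD _ _); rewrite -[leRHS]normrN -cosint_partial// !normrM.
  rewrite -!mulrA mulrA ler_peMl ?mulr_ge0//; last by rewrite -normrM ger0_norm// (le_trans ler01).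
move=> /(ler_wpM2r S0); rewrite mulrDl.
have := Bb i x xi (theta - pi / 2); have := Cb i x xi (theta - pi / 2); rewrite -/S.
by rewrite (mulrC (_ * S)) mulrA mulrDl; lra.
Qed.

End schwartz_real_theory.

(** * Complex numbers, their modulus and the unimodular exponentials *)

Local Notation normc := ComplexField.Normc.normc.

Section complex_numbers.
Context (R : realType).
Implicit Types (x y z : R[i]) (t u : R).

Lemma ReM x y : complex.Re (x * y) =
  complex.Re x * complex.Re y - complex.Im x * complex.Im y.
Proof. by case: x y => [a b] [c e]. Qed.

Lemma ImM x y : complex.Im (x * y) =
  complex.Re x * complex.Im y + complex.Im x * complex.Re y.
Proof. by case: x y => [a b] [c e]. Qed.

Lemma Re_conj x : complex.Re (x^*)%C = complex.Re x.
Proof. by case: x. Qed.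

Lemma Im_conj x : complex.Im (x^*)%C = - complex.Im x.
Proof. by case: x. Qed.

Lemma eqC x y : complex.Re x = complex.Re y -> complex.Im x = complex.Im y -> x = y.
Proof. by case: x y => [a b] [c e] /= -> ->. Qed.

Lemma normc_ge0 x : 0 <= normc x.
Proof. by case: x => a b; exact: sqrtr_ge0. Qed.

Lemma sqr_normcE x : normc x ^+ 2 = complex.Re x ^+ 2 + complex.Im x ^+ 2.
Proof. by case: x => a b; rewrite sqr_sqrtr// addr_ge0// sqr_ge0. Qed.

Lemma norm_Re_normc x : `|complex.Re x| <= normc x.
Proof.
rewrite -(ler_pXn2r (ltn0Sn 1)) ?nnegrE ?normc_ge0// sqr_normcE.
by rewrite real_normK ?num_real// lerDl sqr_ge0.
Qed.

Lemma norm_Im_normc x : `|complex.Im x| <= normc x.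
Proof.
rewrite -(ler_pXn2r (ltn0Sn 1)) ?nnegrE ?normc_ge0// sqr_normcE.
by rewrite real_normK ?num_real// lerDr sqr_ge0.
Qed.

Lemma normc_le x : normc x <= `|complex.Re x| + `|complex.Im x|.
Proof.
rewrite -(ler_pXn2r (ltn0Sn 1)) ?nnegrE ?normc_ge0 ?addr_ge0// sqr_normcE.
by rewrite sqrrD !real_normK ?num_real// addrAC lerDl mulrn_wge0// mulr_ge0.
Qed.

Lemma normc_conj x : normc (x^*)%C = normc x.
Proof. by case: x => a b; rewrite /= sqrrN. Qed.

Lemma normc_real t : normc t%:C = `|t|.
Proof. by rewrite /= expr0n addr0 sqrtr_sqr. Qed.

Lemma expiD t u : expi (t + u) = expi t * expi u.
Proof. by apply: eqC; rewrite ?ReM ?ImM/= ?cosD// sinD addrC. Qed.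

Lemma expi0 : expi 0 = 1 :> R[i].
Proof. by apply: eqC; rewrite /= ?cos0 ?sin0. Qed.

Lemma expiN t : expi (- t) = ((expi t)^*)%C.
Proof. by apply: eqC; rewrite /= ?cosN ?sinN. Qed.

Lemma normc_expi t : normc (expi t) = 1.
Proof. by rewrite /= cos2Dsin2 sqrtr1. Qed.

End complex_numbers.

(** * Fubini, dominated convergence and integrals of complex-valued functions *)

Lemma ae_eq_integrable d (T : measurableType d) (R : realType)
    (mu : {measure set T -> \bar R}) (f g : T -> \bar R) :
  measurable_fun setT g -> ae_eq mu setT f g ->
  mu.-integrable setT f -> mu.-integrable setT g.
Proof.
move=> mg fg /integrableP[mf foo]; apply/integrableP; split=> //.
rewrite -(ae_eq_integral (abse \o g) (abse \o f))//; first exact: measurableT_comp.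
  exact: measurableT_comp.
exact: ae_eq_abse.
Qed.

Lemma measurable_Rintegral d1 d2 (T1 : measurableType d1) (T2 : measurableType d2)
    (R : realType) (mu : {sigma_finite_measure set T2 -> \bar R}) (f : T1 -> T2 -> R) :
  measurable_fun setT (fun p : T1 * T2 => f p.1 p.2) ->
  measurable_fun setT (fun x => \int[mu]_y f x y).
Proof.
move=> /measurable_EFinP; set F := EFin \o _ => mF.
apply: (measurableT_comp (fine_measurable measurableT)).
have E x : (\int[mu]_y (f x y)%:E = \int[mu]_y F^\+ (x, y) - \int[mu]_y F^\- (x, y))%E.
  rewrite -[LHS]/(\int[mu]_y (F \o pair x) y)%E integralE.
  by rewrite (funepos_comp F (pair x)) (funeneg_comp F (pair x)).
under eq_fun do rewrite E; apply: emeasurable_funB.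
  apply: (measurable_fun_fubini_tonelli_F (F^\+)%E) => //.
  exact: measurable_funepos.
apply: (measurable_fun_fubini_tonelli_F (F^\-)%E) => //.
exact: measurable_funeneg.
Qed.

Section parametric_integrals.
Context d1 d2 (T1 : measurableType d1) (T2 : measurableType d2) (R : realType).
Context (m1 : {sigma_finite_measure set T1 -> \bar R}).
Context (m2 : {sigma_finite_measure set T2 -> \bar R}).
Implicit Type f : T1 -> T2 -> R.

(** The inner integral is known to be finite for almost every [x] only, and [fine] assigns it a real
    value everywhere; hence the comparison almost everywhere with the extended real [fubini_F]. *)
Lemma Rintegral_fubini1 f :
  (m1 \x m2)%E.-integrable setT (fun p => (f p.1 p.2)%:E) ->
  m1.-integrable setT (fun x => (\int[m2]_y f x y)%:E) /\
  \int[m1]_x \int[m2]_y f x y = fine (\int[m1 \x m2]_p (f p.1 p.2)%:E)%E.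
Proof.
move=> fi; have iF := integrable_fubini_F fi.
have mF : measurable_fun setT (fun x => (\int[m2]_y f x y)%:E).
  apply/measurable_EFinP; apply: measurable_Rintegral.
  by apply/measurable_EFinP; exact: measurable_int fi.
have ae : ae_eq m1 setT (fun x => (\int[m2]_y f x y)%:E) (fubini_F m2 (fun p => (f p.1 p.2)%:E)).
  move: (ae_integrable1 fi); apply: filterS => x /= ix _.
  by rewrite fineK//; exact: integrable_fin_num.
have mFF := measurable_fubini_F fi; split.
  exact: ae_eq_integrable mF (ae_eq_sym ae) iF.
rewrite -(integral12_prod_meas1 fi); congr fine.
exact: ae_eq_integral.
Qed.

Lemma Rintegral_fubini2 f :
  (m1 \x m2)%E.-integrable setT (fun p => (f p.1 p.2)%:E) ->
  \int[m2]_y \int[m1]_x f x y = fine (\int[m1 \x m2]_p (f p.1 p.2)%:E)%E.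
Proof.
move=> fi; rewrite -(integral21_prod_meas1 fi); congr fine.
have mf : measurable_fun setT (fun p => f p.1 p.2).
  by apply/measurable_EFinP; exact: measurable_int fi.
apply: ae_eq_integral => //.
- apply/measurable_EFinP; apply: (@measurable_Rintegral _ _ T2 T1 _ m1 (fun y x => f x y)).
  exact: (measurableT_comp mf (@measurable_swap _ _ T2 T1)).
- exact: measurable_fubini_G fi.
move: (ae_integrable2 fi); apply: filterS => x /= ix _.
by rewrite fineK//; exact: integrable_fin_num.
Qed.

Lemma integrable_tensor (a : T1 -> R) (b : T2 -> R) :
  m1.-integrable setT (EFin \o a) -> m2.-integrable setT (EFin \o b) ->
  (m1 \x m2)%E.-integrable setT (fun p => (a p.1 * b p.2)%:E).
Proof.
move=> ia ib; have /integrableP[/measurable_EFinP ma aoo] := ia.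
have /integrableP[/measurable_EFinP mb boo] := ib.
apply/integrable12ltyP.
  apply/measurable_EFinP; apply: measurable_funM.
    exact: (measurableT_comp ma measurable_fst).
  exact: (measurableT_comp mb measurable_snd).
have E x : (\int[m2]_y `|(a x * b y)%:E| = `|(a x)%:E| * \int[m2]_y `|(b y)%:E|)%E.
  rewrite -ge0_integralZl//.
    by apply: eq_integral => y _; rewrite EFinM abseM.
  by apply: measurableT_comp => //; exact/measurable_EFinP.
under eq_integral do rewrite /= E.
rewrite ge0_integralZr//; last 2 first.
- by apply: measurableT_comp => //; exact/measurable_EFinP.
- exact: integral_ge0.
by apply: lte_mul_pinfty => //; [exact: integral_ge0|rewrite ge0_fin_numE//; exact: integral_ge0].
Qed.

End parametric_integrals.

Lemma Rintegral_dominated_cvg d (T : measurableType d) (R : realType)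
    (mu : {measure set T -> \bar R}) (f_ : nat -> T -> R) (f g : T -> R) :
  (forall k, measurable_fun setT (f_ k)) ->
  (forall x, f_ k x @[k --> \oo] --> f x) ->
  mu.-integrable setT (EFin \o g) -> (forall k x, `|f_ k x| <= g x) ->
  \int[mu]_x f_ k x @[k --> \oo] --> \int[mu]_x f x.
Proof.
move=> mf_ f_f ig f_g.
have mf : measurable_fun setT f by apply: measurable_fun_cvg => // x _; exact: f_f.
have [] := @dominated_convergence _ _ _ mu setT measurableT
  (fun k x => (f_ k x)%:E) (EFin \o f) (EFin \o g).
- by move=> k; exact/measurable_EFinP.
- exact/measurable_EFinP.
- by apply: aeW => x _; apply: cvg_EFin; [exact: nearW|exact: f_f].
- exact: ig.
- by apply: aeW => x k _; rewrite lee_fin; exact: f_g.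
move=> fi _ cv; apply: fine_cvg; rewrite fineK//.
exact: integrable_fin_num.
Qed.

Section complex_integral.
Context d (T : measurableType d) (R : realType) (mu : {measure set T -> \bar R}).
Implicit Types (f g : T -> R[i]) (h : T -> R).

Definition cmeasurable f :=
  measurable_fun setT (fun x => complex.Re (f x)) /\
  measurable_fun setT (fun x => complex.Im (f x)).

Definition cintegrable f :=
  mu.-integrable setT (fun x => (complex.Re (f x))%:E) /\
  mu.-integrable setT (fun x => (complex.Im (f x))%:E).

(** [inner f g] unfolds to this integral of [f] times the conjugate of [g], so the lemmas on [cint]
    apply to inner products directly. *)
Definition cint f : R[i] :=
  (\int[mu]_x complex.Re (f x)) +i* (\int[mu]_x complex.Im (f x)).

Lemma cmeasurableM f g : cmeasurable f -> cmeasurable g ->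
  cmeasurable (fun x => f x * g x).
Proof.
move=> [f1 f2] [g1 g2]; split.
  by under eq_fun do rewrite ReM; apply: measurable_funB; exact: measurable_funM.
by under eq_fun do rewrite ImM; apply: measurable_funD; exact: measurable_funM.
Qed.

Lemma cmeasurable_conj f : cmeasurable f -> cmeasurable (fun x => (f x)^*)%C.
Proof.
move=> [f1 f2]; split; first by under eq_fun do rewrite Re_conj.
by under eq_fun do rewrite Im_conj; exact: measurable_funN.
Qed.

Lemma cmeasurable_cst (a : R[i]) : cmeasurable (fun=> a).
Proof. by []. Qed.

Lemma cmeasurable_real h : measurable_fun setT h -> cmeasurable (fun x => (h x)%:C).
Proof. by []. Qed.

Lemma cmeasurable_expi h : measurable_fun setT h -> cmeasurable (fun x => expi (h x)).
Proof.
move=> mh; split.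
  exact: (measurableT_comp (continuous_measurable_fun (@continuous_cos R))).
exact: (measurableT_comp (continuous_measurable_fun (@continuous_sin R))).
Qed.

Lemma measurable_normc f : cmeasurable f -> measurable_fun setT (fun x => normc (f x)).
Proof.
move=> [f1 f2].
rewrite (_ : (fun x => _) = (fun x => Num.sqrt (complex.Re (f x) ^+ 2 + complex.Im (f x) ^+ 2))); last first.
  by apply/funext => x; case: (f x).
apply: (measurableT_comp (continuous_measurable_fun (@sqrt_continuous R))).
by apply: measurable_funD; exact: measurable_funX.
Qed.

Lemma cintegrable_measurable f : cintegrable f -> cmeasurable f.
Proof. by move=> [/measurable_int/measurable_EFinP ? /measurable_int/measurable_EFinP ?]. Qed.

Lemma cintegrable_le f h : cmeasurable f -> mu.-integrable setT (EFin \o h) ->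
  (forall x, normc (f x) <= h x) -> cintegrable f.
Proof.
move=> [f1 f2] ih fh; split; apply: le_integrable ih => //.
- exact/measurable_EFinP.
- move=> x _; rewrite lee_fin (le_trans (norm_Re_normc _))// (le_trans (fh x))//.
  exact: ler_norm.
- exact/measurable_EFinP.
- move=> x _; rewrite lee_fin (le_trans (norm_Im_normc _))// (le_trans (fh x))//.
  exact: ler_norm.
Qed.

Lemma integrable_normc f : cintegrable f ->
  mu.-integrable setT (fun x => (normc (f x))%:E).
Proof.
move=> fi; have [f1 f2] := fi.
have := integrableD measurableT (integrable_norm f1) (integrable_norm f2).
apply: le_integrable => //.
  by apply/measurable_EFinP; apply: measurable_normc; exact: cintegrable_measurable.
move=> x _; rewrite /= lee_fin ger0_norm ?normc_ge0// (le_trans (normc_le _))//.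
exact: ler_norm.
Qed.

Lemma eq_cint f g : f =1 g -> cint f = cint g.
Proof. by move=> /funext ->. Qed.

Lemma cintZl (a : R[i]) f : cintegrable f -> cint (fun x => a * f x) = a * cint f.
Proof.
move=> [f1 f2].
have Z (c : R) h : mu.-integrable setT (fun x => (h x)%:E) ->
    mu.-integrable setT (EFin \o (fun x => c * h x)).
  by move=> hi; have := integrableZl measurableT c hi.
apply: eqC; rewrite ?ReM ?ImM /=.
  under eq_Rintegral do rewrite ReM.
  by rewrite RintegralB ?RintegralZl//; exact: Z.
under eq_Rintegral do rewrite ImM.
by rewrite RintegralD ?RintegralZl//; exact: Z.
Qed.

Lemma cintZr (a : R[i]) f : cintegrable f -> cint (fun x => f x * a) = cint f * a.
Proof.
by move=> fi; rewrite mulrC -cintZl//; apply: eq_cint => x; rewrite mulrC.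
Qed.

Lemma cint_conj f : cintegrable f -> cint (fun x => (f x)^*)%C = ((cint f)^*)%C.
Proof.
move=> [f1 f2]; apply: eqC; rewrite ?Re_conj ?Im_conj /=.
  by under eq_Rintegral do rewrite Re_conj.
under eq_Rintegral do rewrite Im_conj -mulN1r.
by rewrite RintegralZl// mulN1r.
Qed.

Lemma ae_eq_cint f g : cmeasurable f -> cmeasurable g ->
  (f = g %[ae mu]) -> cint f = cint g.
Proof.
move=> [f1 f2] [g1 g2] fg; apply: eqC; congr fine; apply: ae_eq_integral => //.
- exact/measurable_EFinP.
- exact/measurable_EFinP.
- by move: fg; apply: filterS => x /= h /h ->.
- exact/measurable_EFinP.
- exact/measurable_EFinP.
- by move: fg; apply: filterS => x /= h /h ->.
Qed.

End complex_integral.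

Section complex_fubini.
Context d1 d2 (T1 : measurableType d1) (T2 : measurableType d2) (R : realType).
Context (m1 : {sigma_finite_measure set T1 -> \bar R}).
Context (m2 : {sigma_finite_measure set T2 -> \bar R}).
Implicit Type f : T1 -> T2 -> R[i].

Lemma cmeasurable_cint f : cmeasurable (fun p : T1 * T2 => f p.1 p.2) ->
  cmeasurable (fun x => cint m2 (f x)).
Proof.
move=> [f1 f2]; split; apply: measurable_Rintegral.
  exact: (f1 : measurable_fun setT (fun p => (fun x y => complex.Re (f x y)) p.1 p.2)).
exact: (f2 : measurable_fun setT (fun p => (fun x y => complex.Im (f x y)) p.1 p.2)).
Qed.

Lemma cintegrable_fubini f : cintegrable (m1 \x m2)%E (fun p => f p.1 p.2) ->
  cintegrable m1 (fun x => cint m2 (f x)).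
Proof.
move=> [f1 f2].
have [i1 _] := @Rintegral_fubini1 _ _ _ _ _ m1 m2 (fun x y => complex.Re (f x y)) f1.
by have [i2 _] := @Rintegral_fubini1 _ _ _ _ _ m1 m2 (fun x y => complex.Im (f x y)) f2.
Qed.

Lemma cint_fubini f : cintegrable (m1 \x m2)%E (fun p => f p.1 p.2) ->
  cint m1 (fun x => cint m2 (f x)) = cint m2 (fun y => cint m1 (f ^~ y)).
Proof.
move=> [f1 f2]; apply: eqC => /=.
  rewrite (@Rintegral_fubini1 _ _ _ _ _ m1 m2 (fun x y => complex.Re (f x y)) f1).2.
  by rewrite (@Rintegral_fubini2 _ _ _ _ _ m1 m2 (fun x y => complex.Re (f x y)) f1).
rewrite (@Rintegral_fubini1 _ _ _ _ _ m1 m2 (fun x y => complex.Im (f x y)) f2).2.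
by rewrite (@Rintegral_fubini2 _ _ _ _ _ m1 m2 (fun x y => complex.Im (f x y)) f2).
Qed.

End complex_fubini.

(** * The Fourier transform of the Gaussian *)

Section gaussian.
Context (R : realType) (n : nat).
Local Notation leb := (lebesgue_cV R n).
Implicit Types (x t : 'cV[R]_n).

(** The factor [pi ^+ 2] is chosen so that the Fourier transform is a multiple of
    [expR (- dot t t)], whose integral is already computed. *)
Definition gaussian x : R := expR (- (pi ^+ 2 * dot x x)).

Lemma gaussian_ge0 x : 0 <= gaussian x.
Proof. exact: expR_ge0. Qed.

(** For [u = 1 + dot x x], the square of the weight is at most [2 * u], and the exponential series
    bounds [u ^+ k.+1] by the factorial of [k.+1] times [expR u]. The factor [expR 1] of the
    constant is the ratio of [expR u] to [expR (dot x x)]. *)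
Lemma expR_sqr_weight k : exists2 C : R, 0 <= C &
  forall x, expR (- dot x x) <= C * weight x ^- k.
Proof.
exists (2 ^+ k.+1 * (k.+1)`!%:R * expR 1); first by rewrite !mulr_ge0// expR_ge0.
move=> x; rewrite ler_pdivlMr ?exprn_gt0 ?weight_gt0// expRN.
rewrite ler_pdivrMl ?expR_gt0// mulrC -[_ * expR 1 * _]mulrA -expRD.
apply: (@le_trans _ _ (weight x ^+ (2 * k.+1))).
  by rewrite ler_weXn2l ?weight_ge1// mulnS leqW// leqW// leq_pmull.
rewrite exprM; apply: (@le_trans _ _ ((2 * (1 + dot x x)) ^+ k.+1)).
  rewrite lerXn2r ?nnegrE ?mulr_ge0 ?exprn_ge0 ?weight_ge0 ?addr_ge0 ?dot_ge0//.
  rewrite -sqr_enorm /weight; have := sqr_ge0 (1 - enorm x); nra.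
rewrite exprMn -mulrA ler_wpM2l// -ler_pdivrMl ?ltr0n ?fact_gt0// mulrC.
have u0 : 0 <= 1 + dot x x by rewrite addr_ge0// dot_ge0.
by apply: le_trans (expR_ge1Dxn k u0); rewrite lerDr.
Qed.

Lemma gaussian_le_weight k : exists2 C : R, 0 <= C &
  forall x, gaussian x <= C * weight x ^- k.
Proof.
have [C C0 Ck] := expR_sqr_weight k; exists C => // x; apply: le_trans (Ck x).
rewrite ler_expR lerN2 ler_peMl ?dot_ge0// expr_ge1 ?pi_ge0//.
have := pi_ge2 R; lra.
Qed.

Lemma measurable_gaussian : measurable_fun setT gaussian.
Proof.
apply: measurableT_comp => //; apply: measurable_funN.
by apply: measurable_funM => //; exact: measurable_dot.
Qed.

Lemma integrable_gaussian : leb.-integrable setT (EFin \o gaussian).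
Proof.
have [C C0 Ck] := gaussian_le_weight (2 * n).
apply: (@integrable_weight_bound _ _ _ C (2 * n)) => //.
  exact: measurable_gaussian.
by move=> x; rewrite ger0_norm ?gaussian_ge0.
Qed.

Lemma measurable_cos_dot (s c : R) t :
  measurable_fun setT (fun x => cos (c * (s * dot x t))).
Proof.
apply: (measurableT_comp (continuous_measurable_fun (@continuous_cos R))).
by do 2 apply: measurable_funM => //; exact: measurable_dot.
Qed.

Lemma measurable_sin_dot (s c : R) t :
  measurable_fun setT (fun x => sin (c * (s * dot x t))).
Proof.
apply: (measurableT_comp (continuous_measurable_fun (@continuous_sin R))).
by do 2 apply: measurable_funM => //; exact: measurable_dot.
Qed.

(** The cosine transform of the Gaussian along the ray [s *: t]; it will be found to solve a
    first-order linear differential equation in [s]. *)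
Let H t (s : R) := \int[leb]_x (gaussian x * cos (2 * pi * (s * dot x t))).

Let dot_gaussian_bound t : exists2 C : R, 0 <= C &
  forall x, `|dot x t| * gaussian x <= C * weight x ^- (2 * n).
Proof.
have [C C0 Ck] := gaussian_le_weight (2 * n).+1.
exists (enorm t * C); first by rewrite mulr_ge0// enorm_ge0.
move=> x; have dx : `|dot x t| <= weight x * enorm t.
  rewrite ler_norml lerNl -dotNl; apply/andP; split.
    apply: (le_trans (dot_le_enorm _ _)); rewrite enormN.
    by rewrite ler_wpM2r ?enorm_ge0// lerDr.
  by apply: (le_trans (dot_le_enorm _ _)); rewrite ler_wpM2r ?enorm_ge0// lerDr.
apply: (le_trans (ler_pM _ (gaussian_ge0 x) dx (Ck x))) => //.
rewrite exprS invfM le_eqVlt; apply/orP; left; apply/eqP.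
have : weight x != 0 by rewrite gt_eqF ?weight_gt0.
by move=> w0; field; rewrite w0 expf_neq0.
Qed.

Let scaleE (a b : R) : a *: b = a * b. Proof. by []. Qed.

Let integrable_dot_sin t (s : R) : leb.-integrable setT
  (EFin \o (fun x => dot x t * gaussian x * sin (2 * pi * (s * dot x t)))).
Proof.
have [A A0 Ak] := dot_gaussian_bound t.
have mdot : measurable_fun setT (fun x => dot x t) by exact: measurable_dot.
  apply: (@integrable_weight_bound _ _ _ A (2 * n)) => //.
    apply: measurable_funM; last exact: measurable_sin_dot.
    by apply: measurable_funM => //; exact: measurable_gaussian.
  move=> x; apply: le_trans (Ak x); rewrite !normrM (ger0_norm (gaussian_ge0 x)).
  by rewrite ler_piMr ?mulr_ge0 ?gaussian_ge0// ler_norml sin_geN1 sin_le1.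
Qed.

(** Integration by parts in the direction [t]: the derivative of [gaussian x * sin (2 * pi * (s *
    dot x t))] has integral zero. *)
Let integral_dot_sin t (s : R) :
  \int[leb]_x (2 * pi * (dot x t * gaussian x * sin (2 * pi * (s * dot x t)))) =
  2 * s * dot t t * H t s.
Proof.
have [A A0 Ak] := dot_gaussian_bound t.
have [B B0 Bk] := gaussian_le_weight (2 * n).
have i1 := integrable_dot_sin t s.
have i2 : leb.-integrable setT
    (EFin \o (fun x => gaussian x * cos (2 * pi * (s * dot x t)))).
  apply: (@integrable_weight_bound _ _ _ B (2 * n)) => //.
    by apply: measurable_funM; [exact: measurable_gaussian|exact: measurable_cos_dot].
  move=> x; apply: le_trans (Bk x); rewrite !normrM (ger0_norm (gaussian_ge0 x)).
  by rewrite ler_piMr ?gaussian_ge0// ler_norml cos_geN1 cos_le1.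
pose F x := gaussian x * sin (2 * pi * (s * dot x t)).
pose dF x := - (2 * pi ^+ 2) * (dot x t * gaussian x * sin (2 * pi * (s * dot x t))) +
  2 * pi * s * dot t t * (gaussian x * cos (2 * pi * (s * dot x t))).
have derF x : is_derive x t F (dF x).
  apply: is_derive_of_line.
  have d0 : is_derive (0 : R) 1 (fun u : R => - (pi ^+ 2 * (dot x x + u * (2 * dot x t) +
      u ^+ 2 * dot t t))) (- (2 * pi ^+ 2 * dot x t)).
    by apply: is_derive_eq; rewrite /= !scaleE; ring.
  have d1 := is_derive1_comp (is_derive_expR _) d0.
  have d2 : is_derive (0 : R) 1 (fun u : R => 2 * pi * (s * (dot x t + u * dot t t)))
      (2 * pi * s * dot t t).
    by apply: is_derive_eq; rewrite /= !scaleE; ring.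
  have d3 := is_derive1_comp (is_derive_sin _) d2.
  have FE : (fun u : R => F (x + u *: t)) = (expR \o (fun u : R => - (pi ^+ 2 *
      (dot x x + u * (2 * dot x t) + u ^+ 2 * dot t t)))) *
      (sin \o (fun u : R => 2 * pi * (s * (dot x t + u * dot t t)))).
    apply/funext => u; rewrite /F /gaussian fctE /= !(dotDl, dotDr, dotZl, dotZr) (dotC t x).
    by congr (expR _ * _); ring.
  rewrite FE; apply: is_derive_eq (is_deriveM d1 d3) _.
  rewrite !scaleE /= !mul0r expr0n !mul0r !addr0 -/(gaussian x) /dF; ring.
have M0 : 0 <= `|2 * pi * s * dot t t| by [].
have := @Rintegral_derive_eq0 R n F dF t
  (2 * pi ^+ 2 * A + (1 + `|2 * pi * s * dot t t|) * B) (2 * n) (leqnn _) _ derF.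
have mF : measurable_fun setT F.
  by apply: measurable_funM; [exact: measurable_gaussian|exact: measurable_sin_dot].
have p0 : 0 <= 2 * pi ^+ 2 :> R by rewrite mulr_ge0// exprn_ge0// pi_ge0.
have Ab x : `|dot x t * gaussian x * sin (2 * pi * (s * dot x t))| <= A * weight x ^- (2 * n).
  apply: le_trans (Ak x); rewrite !normrM (ger0_norm (gaussian_ge0 x)).
  by rewrite ler_piMr ?mulr_ge0 ?gaussian_ge0// ler_norml sin_geN1 sin_le1.
have Bb x : `|gaussian x * cos (2 * pi * (s * dot x t))| <= B * weight x ^- (2 * n).
  apply: le_trans (Bk x); rewrite !normrM (ger0_norm (gaussian_ge0 x)).
  by rewrite ler_piMr ?gaussian_ge0// ler_norml cos_geN1 cos_le1.
have Fb x : `|F x| <= B * weight x ^- (2 * n).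
  apply: le_trans (Bk x); rewrite !normrM (ger0_norm (gaussian_ge0 x)).
  by rewrite ler_piMr ?gaussian_ge0// ler_norml sin_geN1 sin_le1.
have w0 x : 0 <= weight x ^- (2 * n) by rewrite invr_ge0 exprn_ge0// weight_ge0.
move=> /(_ mF) h; have {h} : \int[leb]_y dF y = 0.
  apply: h => x.
    apply: (le_trans (Fb x)); rewrite ler_wpM2r//.
    have := mulr_ge0 p0 A0; have := mulr_ge0 M0 B0; lra.
  apply: (le_trans (ler_normD _ _)); rewrite !normrM normrN (ger0_norm p0) -!normrM.
  have := ler_wpM2l p0 (Ab x); have := ler_wpM2l M0 (Bb x).
  have := mulr_ge0 B0 (w0 x); rewrite !normrM; lra.
rewrite /dF RintegralD//; last 2 first.
- by have := integrableZl measurableT (- (2 * pi ^+ 2)) i1.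
- by have := integrableZl measurableT (2 * pi * s * dot t t) i2.
rewrite !RintegralZl// -/(H t s) => E.
apply: (mulfI (lt0r_neq0 (pi_gt0 R))); move: E; set I := \int[leb]_y _ => E; lra.
Qed.

(** Differentiating under the integral sign brings down [- 2 * pi * dot x t] and a sine;
    [integral_dot_sin] turns the result back into a multiple of [H t s]. *)
Let derive_H t (s : R) : is_derive s 1 (H t) (- (2 * s * dot t t * H t s)).
Proof.
pose f (u : R) x := gaussian x * cos (2 * pi * (u * dot x t)).
have [A A0 Ak] := dot_gaussian_bound t.
have derf (u : R) x : is_derive u 1 (f ^~ x)
    (- (2 * pi * (dot x t * gaussian x * sin (2 * pi * (u * dot x t))))).
  have d1 : is_derive u 1 (fun v : R => 2 * pi * (v * dot x t)) (2 * pi * dot x t).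
    by apply: is_derive_eq; rewrite /= !scaleE; ring.
  have := is_deriveZ (gaussian x) (is_derive1_comp (is_derive_cos _) d1).
  by move=> h; apply: is_derive_eq h _; rewrite scaleE; ring.
have d1f (u : R) x : partial1of2 f u x =
    - (2 * pi * (dot x t * gaussian x * sin (2 * pi * (u * dot x t)))).
  by rewrite partial1of2E; exact: derive_val.
pose G x := 2 * pi * A * weight x ^- (2 * n).
have G0 x : 0 <= G x.
  by rewrite /G !mulr_ge0 ?pi_ge0// invr_ge0 exprn_ge0// weight_ge0.
have iG : leb.-integrable setT (EFin \o G).
  by have := integrableZl measurableT (2 * pi * A) (integrable_weightV R (leqnn (2 * n))).
have Is : `](s - 1), (s + 1)[%classic s by rewrite /= in_itv/= ltrBlDr ltrDl ltr01.
have intf (u : R) : `](s - 1), (s + 1)[%classic u -> leb.-integrable setT (EFin \o f u).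
  move=> _; have [B B0 Bk] := gaussian_le_weight (2 * n).
  apply: (@integrable_weight_bound _ _ _ B (2 * n)) => //.
    by apply: measurable_funM; [exact: measurable_gaussian|exact: measurable_cos_dot].
  move=> x; apply: le_trans (Bk x); rewrite !normrM (ger0_norm (gaussian_ge0 x)).
  by rewrite ler_piMr ?gaussian_ge0// ler_norml cos_geN1 cos_le1.
have dfs (u : R) x : `](s - 1), (s + 1)[%classic u -> setT x -> derivable (f ^~ x) u 1.
  by move=> _ _; have [] := derf u x.
have d1G (u : R) x : `](s - 1), (s + 1)[%classic u -> setT x -> `|partial1of2 f u x| <= G x.
  move=> _ _; rewrite d1f normrN normrM ger0_norm ?mulr_ge0 ?pi_ge0// /G -[leRHS]mulrA.
  rewrite ler_wpM2l ?mulr_ge0 ?pi_ge0//; apply: le_trans (Ak x).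
  rewrite !normrM (ger0_norm (gaussian_ge0 x)).
  by rewrite ler_piMr ?mulr_ge0 ?gaussian_ge0// ler_norml sin_geN1 sin_le1.
apply: DeriveDef; first exact: (derivable_under_integral measurableT Is intf dfs G0 iG d1G).
rewrite -derive1E.
rewrite [LHS](differentiation_under_integral measurableT Is intf dfs G0 iG d1G).
under eq_Rintegral do rewrite d1f -mulN1r.
rewrite RintegralZl//; first by rewrite integral_dot_sin mulN1r.
by have := integrableZl measurableT (2 * pi) (integrable_dot_sin t s).
Qed.

(** By the equation for [H], the product [H t s * expR (s ^+ 2 * dot t t)] is constant in [s];
    compare [s = 1] with [s = 0]. *)
Lemma cos_gaussian t : \int[leb]_x (gaussian x * cos (2 * pi * dot x t)) =
  expR (- dot t t) * \int[leb]_x gaussian x.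
Proof.
have K0 : forall s : R, is_derive s 1 (fun u => H t u * expR (u ^+ 2 * dot t t)) 0.
  move=> s; have d1 : is_derive s 1 (fun u : R => u ^+ 2 * dot t t) (2 * s * dot t t).
    by apply: is_derive_eq; rewrite /= !scaleE; ring.
  have := is_deriveM (derive_H t s) (is_derive1_comp (is_derive_expR _) d1).
  by move=> dP; apply: is_derive_eq; rewrite !scaleE /=; ring.
have := is_derive_0_is_cst 1 0 K0; rewrite expr1n expr0n mul1r mul0r expR0 mulr1 => H10.
apply: (mulIf (lt0r_neq0 (expR_gt0 (dot t t)))).
rewrite mulrAC -expRD addNr expR0 mul1r.
transitivity (H t 1 * expR (dot t t)).
  by congr (_ * _); apply: eq_Rintegral => x _; rewrite mul1r.
by rewrite H10; apply: eq_Rintegral => x _; rewrite mul0r mulr0 cos0 mulr1.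
Qed.

End gaussian.

(** * Stability of complex integrability *)

Section complex_integrability.
Context (R : realType).

Lemma cmeasurable_comp d1 d2 (T1 : measurableType d1) (T2 : measurableType d2)
    (f : T2 -> R[i]) (phi : T1 -> T2) : measurable_fun setT phi ->
  cmeasurable f -> cmeasurable (f \o phi).
Proof. by move=> mphi [f1 f2]; split; [exact: (measurableT_comp f1)|exact: (measurableT_comp f2)]. Qed.

Lemma cintegrable_expi d (T : measurableType d) (mu : {measure set T -> \bar R})
    (f : T -> R[i]) (h : T -> R) :
  cintegrable mu f -> measurable_fun setT h ->
  cintegrable mu (fun x => f x * expi (h x)).
Proof.
move=> fi mh; apply: (cintegrable_le _ (integrable_normc fi)).
  by apply: cmeasurableM; [exact: cintegrable_measurable fi|exact: cmeasurable_expi].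
by move=> x; rewrite ComplexField.Normc.normcM normc_expi mulr1.
Qed.

Lemma cintegrable_conj d (T : measurableType d) (mu : {measure set T -> \bar R})
    (f : T -> R[i]) : cintegrable mu f -> cintegrable mu (fun x => (f x)^*)%C.
Proof.
move=> fi; apply: (cintegrable_le _ (integrable_normc fi)).
  by apply: cmeasurable_conj; exact: cintegrable_measurable fi.
by move=> x; rewrite normc_conj.
Qed.

End complex_integrability.

(** * Fourier inversion and Parseval's identity *)

Section fourier.
Context (R : realType) (n : nat).
Local Notation leb := (lebesgue_cV R n).
Implicit Types (a b q : 'cV[R]_n -> R[i]) (x y z xi : 'cV[R]_n).
Local Opaque lebesgue_cV.

Definition ft a xi : R[i] := cint leb (fun y => a y * expi (- (2 * pi * dot y xi))).

Lemma measurable_phase d (T : measurableType d) (f g : T -> 'cV[R]_n) :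
  measurable_fun setT f -> measurable_fun setT g ->
  measurable_fun setT (fun p => 2 * pi * dot (f p) (g p)).
Proof. by move=> mf mg; apply: measurable_funM => //; exact: measurable_dot. Qed.

Lemma cmeasurable_ft a : cmeasurable a -> cmeasurable (ft a).
Proof.
move=> ma; apply: (@cmeasurable_cint _ _ _ _ _ leb
  (fun xi y => a y * expi (- (2 * pi * dot y xi)))).
apply: cmeasurableM; first exact: (cmeasurable_comp measurable_snd).
by apply: cmeasurable_expi; apply: measurable_funN; exact: measurable_phase.
Qed.

(** The multiplication formula: Fubini, the kernel being symmetric in [y] and [xi]. *)
Lemma ft_mult a q : cintegrable leb a -> cintegrable leb q ->
  cint leb (fun xi => ft a xi * q xi) = cint leb (fun y => a y * ft q y).
Proof.
move=> ai qi.
have mphase xi : measurable_fun setT (fun y => - (2 * pi * dot y xi)).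
  by apply: measurable_funN; exact: measurable_phase.
transitivity (cint leb (fun xi => cint leb
    (fun y => a y * expi (- (2 * pi * dot y xi)) * q xi))).
  by apply: eq_cint => xi; rewrite cintZr//; exact: cintegrable_expi.
rewrite cint_fubini.
  apply: eq_cint => y; rewrite -cintZl; last first.
    exact: cintegrable_expi.
  by apply: eq_cint => xi; rewrite dotC mulrA mulrAC.
have ia := integrable_normc ai; have iq := integrable_normc qi.
apply: (cintegrable_le _ (integrable_tensor iq ia)).
  apply: cmeasurableM; last first.
    exact: (cmeasurable_comp measurable_fst (cintegrable_measurable qi)).
  apply: cmeasurableM.
    exact: (cmeasurable_comp measurable_snd (cintegrable_measurable ai)).
  by apply: cmeasurable_expi; apply: measurable_funN; exact: measurable_phase.
by move=> p; rewrite !ComplexField.Normc.normcM normc_expi mulr1 mulrC.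
Qed.

Lemma ge0_integral_scale (s : R) (f : 'cV[R]_n -> \bar R) : 0 < s ->
  measurable_fun setT f -> (forall x, (0 <= f x)%E) ->
  (\int[leb]_x f (s *: x) = (s ^- n)%:E * \int[leb]_x f x)%E.
Proof.
move=> s0 mf f0; have := @ge0_integral_diag_mx R n (const_mx s) f.
under eq_bigr do rewrite mxE; rewrite prodr_const card_ord => <-//; last by move=> i; rewrite mxE.
by apply: eq_integral => x _; congr f; apply/matrixP => i j; rewrite mul_diag_mx !mxE.
Qed.

Lemma Rintegral_scale (s : R) (f : 'cV[R]_n -> R) : 0 < s -> measurable_fun setT f ->
  \int[leb]_x f (s *: x) = s ^- n * \int[leb]_x f x.
Proof.
move=> s0 mf; apply: (@Rintegral_subst _ _ _ leb (fun x => s *: x)) => //.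
  by rewrite invr_gt0 exprn_gt0.
by move=> g mg g0; exact: ge0_integral_scale.
Qed.

Lemma cint_scale (s : R) a : 0 < s -> cmeasurable a ->
  cint leb (fun x => a (s *: x)) = (s ^- n)%:C * cint leb a.
Proof.
move=> s0 [m1 m2]; apply: eqC; rewrite ?ReM ?ImM /=.
  by rewrite (Rintegral_scale s0 m1) mul0r subr0.
by rewrite (Rintegral_scale s0 m2) mul0r addr0.
Qed.

Lemma cint_shift y a : cmeasurable a -> cint leb (fun x => a (x + y)) = cint leb a.
Proof.
by move=> [m1 m2]; apply: eqC; [exact: (Rintegral_cV_shift _ m1)|exact: (Rintegral_cV_shift _ m2)].
Qed.

Lemma cint_opp a : cmeasurable a -> cint leb (fun x => a (- x)) = cint leb a.
Proof.
by move=> [m1 m2]; apply: eqC; [exact: (Rintegral_cV_opp m1)|exact: (Rintegral_cV_opp m2)].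
Qed.

Definition gauss_mass : R := \int[leb]_x gaussian x.

Lemma gauss_mass_gt0 : 0 < gauss_mass.
Proof.
have E : gauss_mass = \int[leb]_x expR (- dot (pi *: x) (pi *: x)).
  by apply: eq_Rintegral => x _; rewrite dotZl dotZr mulrA -expr2.
rewrite E (@Rintegral_scale pi (fun x => expR (- dot x x))) ?pi_gt0//.
  rewrite mulr_gt0 ?invr_gt0 ?exprn_gt0 ?pi_gt0//.
  by rewrite /Rintegral ge0_integral_gauss exprn_gt0// sqrtr_gt0 pi_gt0.
by apply: measurableT_comp => //; apply: measurable_funN; exact: measurable_dot.
Qed.

Lemma ft_gaussian z : ft (fun x => (gaussian x)%:C) z = (expR (- dot z z) * gauss_mass)%:C.
Proof.
apply: eqC => /=.
  under eq_Rintegral do rewrite mul0r subr0 cosN.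
  exact: cos_gaussian.
under eq_Rintegral do rewrite mul0r addr0 sinN.
(* The sine makes the integrand odd, so the integral equals its own opposite. *)
set I := \int[leb]_x _; have : I = - I; last by move=> h; lra.
have mF : measurable_fun setT (fun x => gaussian x * - sin (2 * pi * dot x z)).
  apply: measurable_funM; first exact: measurable_gaussian.
  apply: measurable_funN; apply: (measurableT_comp (continuous_measurable_fun (@continuous_sin R))).
  exact: measurable_phase.
rewrite /I -{1}(Rintegral_cV_opp mF) -mulN1r -RintegralZl//.
  by apply: eq_Rintegral => x _; rewrite /gaussian dotN dotNl (mulrN (2 * pi)) sinN; ring.
apply: le_integrable (integrable_gaussian R n) => //; first exact/measurable_EFinP.
move=> x _; rewrite lee_fin !normrM ler_piMr// normrN ler_norml sin_geN1 sin_le1//.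
Qed.

(** The constant that Gaussian summability leaves in the inversion formula: the second factor is the
    integral of [expR (- dot u u)]. It is carried symbolically, positivity sufficing to divide by
    it. *)
Definition ft_const : R := gauss_mass * Num.sqrt pi ^+ n.

Lemma ft_const_gt0 : 0 < ft_const.
Proof. by rewrite mulr_gt0 ?gauss_mass_gt0// exprn_gt0// sqrtr_gt0 pi_gt0. Qed.

Lemma continuous_cvg_cV (f : 'cV[R]_n -> R) y u : continuous f ->
  f (y + harmonic k *: u) @[k --> \oo] --> f y.
Proof.
move=> cf; apply: continuous_cvg; first exact: cf.
rewrite -[X in _ --> X]addr0 -(scale0r u).
by apply: cvgD; [exact: cvg_cst|apply: cvgZr_tmp; exact: cvg_harmonic].
Qed.

Lemma cvg_gaussian_scale xi : gaussian (harmonic k *: xi) @[k --> \oo] --> (1 : R).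
Proof.
have c : {for (0 : R), continuous (fun r : R => expR (- (pi ^+ 2 * (r ^+ 2 * dot xi xi))))}.
  apply: differentiable_continuous; apply/derivable1_diffP.
  exact: ex_derive.
rewrite -[X in _ --> X](_ : expR (- (pi ^+ 2 * (0 ^+ 2 * dot xi xi))) = 1); last first.
  by rewrite expr0n mul0r mulr0 oppr0 expR0.
rewrite (_ : (fun k => _) =
    (fun k => expR (- (pi ^+ 2 * (harmonic k ^+ 2 * dot xi xi))))); last first.
  by apply/funext => k; rewrite /gaussian dotZl dotZr; congr expR; ring.
exact: (continuous_cvg _ c cvg_harmonic).
Qed.

Lemma gaussian_le1 x : gaussian x <= 1.
Proof. by rewrite -expR0 ler_expR oppr_le0 mulr_ge0 ?exprn_ge0 ?pi_ge0 ?dot_ge0. Qed.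

Lemma measurable_expR_dot : measurable_fun setT (fun u : 'cV[R]_n => expR (- dot u u)).
Proof.
by apply: measurableT_comp => //; apply: measurable_funN; exact: measurable_dot.
Qed.

Lemma integrable_expR_dot (B : R) :
  leb.-integrable setT (EFin \o (fun u => B * (expR (- dot u u) * gauss_mass))).
Proof.
have [C C0 Ck] := expR_sqr_weight R n (2 * n).
apply: (@integrable_weight_bound _ _ _ (`|B| * (C * `|gauss_mass|)) (2 * n)) => //.
  do 2 apply: measurable_funM => //; exact: measurable_expR_dot.
move=> x; rewrite !normrM (ger0_norm (expR_ge0 _)) -mulrA ler_wpM2l//.
by rewrite mulrAC ler_wpM2r.
Qed.

Lemma cintegrable_approx b (B : R) y (e : R) : cmeasurable b -> (forall z, normc (b z) <= B) ->
  cintegrable leb (fun u => b (y + e *: u) * (expR (- dot u u) * gauss_mass)%:C).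
Proof.
move=> mb Bb; apply: (cintegrable_le _ (integrable_expR_dot B)).
  apply: cmeasurableM; last first.
    by apply: cmeasurable_real; apply: measurable_funM => //; exact: measurable_expR_dot.
  by apply: (cmeasurable_comp _ mb); apply: measurable_cVD => //; exact: measurable_cVZ.
move=> u; rewrite ComplexField.Normc.normcM normc_real.
have m0 : 0 <= expR (- dot u u) * gauss_mass by rewrite mulr_ge0 ?expR_ge0// ltW// gauss_mass_gt0.
by rewrite ger0_norm// ler_wpM2r.
Qed.

(** The multiplication formula for the dilated and modulated Gaussian [q]: its transform is a
    Gaussian of width [e] centred at [y], and the substitution [z = y + e *: u] absorbs the factor
    [e ^- n]. *)
Lemma ft_approx b (B : R) y (e : R) : 0 < e ->
  cintegrable leb b -> (forall z, normc (b z) <= B) ->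
  cint leb (fun xi => ft b xi * expi (2 * pi * dot y xi) * (gaussian (e *: xi))%:C) =
  cint leb (fun u => b (y + e *: u) * (expR (- dot u u) * gauss_mass)%:C).
Proof.
move=> e0 bi Bb; pose q xi := (gaussian (e *: xi))%:C * expi (2 * pi * dot y xi).
have mb := cintegrable_measurable bi.
have me : measurable_fun setT (fun xi : 'cV[R]_n => e *: xi) by exact: measurable_cVZ.
have mg : cmeasurable (fun xi => (gaussian xi)%:C).
  by apply: cmeasurable_real; exact: measurable_gaussian.
have en0 : (e ^- n)%:C != 0 :> R[i].
  by rewrite -(rmorph0 (real_complex R)) (inj_eq (@complexI _)) invr_eq0 expf_neq0// gt_eqF.
have qi : cintegrable leb q.
  apply: cintegrable_expi; last exact: measurable_phase.
  split=> /=; last exact: integrable0.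
  apply: (integrable_subst (c := e ^- n)) (integrable_gaussian R n) => //.
    by rewrite invr_gt0 exprn_gt0.
  by move=> f mf f0; exact: ge0_integral_scale.
have ftq z : ft q z = (e ^- n)%:C * (expR (- dot (e^-1 *: (z - y)) (e^-1 *: (z - y))) * gauss_mass)%:C.
  rewrite -ft_gaussian -cint_scale//; last first.
    apply: cmeasurableM => //; apply: cmeasurable_expi; apply: measurable_funN.
    exact: measurable_phase.
  apply: eq_cint => xi; rewrite /q -mulrA -expiD; congr (_ * expi _).
  by rewrite dotZl dotZr (mulrA e) mulfV ?gt_eqF// mul1r dotDr dotNr (dotC y); ring.
have mft : cmeasurable (fun z => b z * ft q z).
  by apply: cmeasurableM => //; apply: cmeasurable_ft; exact: cintegrable_measurable qi.
transitivity (cint leb (fun xi => ft b xi * q xi)).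
  by apply: eq_cint => xi; rewrite -mulrA; congr (_ * _); rewrite mulrC.
rewrite ft_mult// -(cint_shift y mft); apply: (mulfI en0).
have mfty : cmeasurable (fun z => b (z + y) * ft q (z + y)).
  by apply: (cmeasurable_comp (phi := fun x => x + y)) mft; exact: measurable_cV_shift.
rewrite -(cint_scale e0 mfty) -cintZl; last exact: cintegrable_approx Bb.
apply: eq_cint => u; rewrite ftq addrK scalerA mulVf ?gt_eqF// scale1r.
by rewrite (addrC y) mulrCA.
Qed.

Lemma Rintegral_expR_dot (a : R) :
  \int[leb]_u (a * (expR (- dot u u) * gauss_mass)) = ft_const * a.
Proof.
rewrite (_ : (fun u => _) = (fun u : 'cV[R]_n => (a * gauss_mass) * expR (- dot u u))); last first.
  by apply/funext => u; ring.
rewrite RintegralZl//.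
  by rewrite /Rintegral ge0_integral_gauss /ft_const /=; ring.
have [C C0 Ck] := expR_sqr_weight R n (2 * n).
apply: (@integrable_weight_bound _ _ _ C (2 * n)) => //; first exact: measurable_expR_dot.
by move=> x; rewrite ger0_norm ?expR_ge0.
Qed.

(* Fourier inversion by Gaussian summability. *)
Lemma ft_inversion b (B : R) y : cintegrable leb b ->
  continuous (fun z => complex.Re (b z)) -> continuous (fun z => complex.Im (b z)) ->
  (forall z, normc (b z) <= B) -> cintegrable leb (ft b) ->
  cint leb (fun xi => ft b xi * expi (2 * pi * dot y xi)) = ft_const%:C * b y.
Proof.
move=> bi cb1 cb2 Bb fi; have mb := cintegrable_measurable bi.
pose A xi := ft b xi * expi (2 * pi * dot y xi).
have Ai : cintegrable leb A by apply: cintegrable_expi => //; exact: measurable_phase.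
have mA := cintegrable_measurable Ai.
have mgs (e : R) : measurable_fun setT (fun xi : 'cV[R]_n => gaussian (e *: xi)).
  by apply: (measurableT_comp (@measurable_gaussian R n)); exact: measurable_cVZ.
have e0 k : 0 < harmonic k :> R by rewrite /harmonic invr_gt0.
(* [P] stands for the real or the imaginary part. Dominated convergence applies to both sides of
   [ft_approx] with [e = harmonic k]: on the left the Gaussian tends to [1], on the right
   [b (y + e *: u)] tends to [b y]. *)
have L (P : R[i] -> R) : (forall (w : R[i]) (r : R), P (w * r%:C) = P w * r) ->
    (forall w, `|P w| <= normc w) -> continuous (P \o b) ->
    measurable_fun setT (P \o A) -> measurable_fun setT (P \o b) ->
    (forall f, P (cint leb f) = \int[leb]_x P (f x)) ->
    P (cint leb A) = ft_const * P (b y).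
  move=> PZ Pn cPb mPA mPb Pint.
  have c1 : (\int[leb]_xi (P (A xi) * gaussian (harmonic k *: xi))) @[k --> \oo] -->
      \int[leb]_xi P (A xi).
    apply: (@Rintegral_dominated_cvg _ _ _ leb _ _ (fun xi => normc (A xi))).
    - by move=> k; apply: measurable_funM.
    - move=> xi; rewrite -[X in _ --> X]mulr1; apply: cvgM.
        exact: cvg_cst.
      exact: cvg_gaussian_scale.
    - exact: integrable_normc.
    - move=> k xi; rewrite normrM (ger0_norm (gaussian_ge0 _)).
      by apply: le_trans (Pn _); rewrite ler_piMr// gaussian_le1.
  have c2 : (\int[leb]_u (P (b (y + harmonic k *: u)) * (expR (- dot u u) * gauss_mass))) @[k --> \oo] -->
      \int[leb]_u (P (b y) * (expR (- dot u u) * gauss_mass)).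
    apply: (@Rintegral_dominated_cvg _ _ _ leb _ _ (fun u => B * (expR (- dot u u) * gauss_mass))).
    - move=> k; apply: measurable_funM.
        apply: (measurableT_comp mPb); apply: measurable_cVD => //.
        exact: measurable_cVZ.
      by apply: measurable_funM => //; exact: measurable_expR_dot.
    - move=> u; apply: cvgM; last exact: cvg_cst.
      exact: (continuous_cvg_cV (f := P \o b)).
    - exact: integrable_expR_dot.
    - move=> k u; have m0 : 0 <= expR (- dot u u) * gauss_mass.
        by rewrite mulr_ge0 ?expR_ge0// ltW// gauss_mass_gt0.
      by rewrite normrM (ger0_norm m0) ler_wpM2r// (le_trans (Pn _)).
  rewrite -Rintegral_expR_dot Pint; apply: cvg_unique c1 _ => //.
  rewrite (_ : (fun k => _) = (fun k => \int[leb]_u (P (b (y + harmonic k *: u)) *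
      (expR (- dot u u) * gauss_mass))))//.
  apply/funext => k; have := congr1 P (ft_approx y (e0 k) bi Bb).
  rewrite !Pint; under eq_Rintegral do rewrite PZ.
  by under [X in _ = X -> _]eq_Rintegral do rewrite PZ.
have [mA1 mA2] := mA; have [mb1 mb2] := mb.
apply: eqC.
  rewrite ReM /= mul0r subr0; apply: (L (@complex.Re R)) => //.
    by move=> z r; rewrite ReM /= mulr0 subr0.
  exact: norm_Re_normc.
rewrite ImM /= mul0r addr0; apply: (L (@complex.Im R)) => //.
  by move=> z r; rewrite ImM /= mulr0 add0r.
exact: norm_Im_normc.
Qed.

(** The multiplication formula with the conjugate of [ft b] in the role of [q]; the transform of the
    latter is the conjugate of the inversion integral for [b]. The roles are asymmetric because [a]
    is going to contain [M g]. *)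
Lemma parseval a b (B : R) : cintegrable leb a -> cintegrable leb b ->
  continuous (fun z => complex.Re (b z)) -> continuous (fun z => complex.Im (b z)) ->
  (forall z, normc (b z) <= B) -> cintegrable leb (ft b) ->
  cint leb (fun xi => ft a xi * ((ft b xi)^*)%C) =
  ft_const%:C * cint leb (fun y => a y * ((b y)^*)%C).
Proof.
move=> ai bi cb1 cb2 Bb fi.
have abi : cintegrable leb (fun y => a y * ((b y)^*)%C).
  apply: (@cintegrable_le _ _ _ leb _ (fun y => B * normc (a y))).
  - apply: cmeasurableM; first exact: cintegrable_measurable ai.
    by apply: cmeasurable_conj; exact: cintegrable_measurable bi.
  - by have := integrableZl measurableT B (integrable_normc ai).
  by move=> y; rewrite ComplexField.Normc.normcM normc_conj mulrC ler_wpM2r ?normc_ge0.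
rewrite ft_mult//; last exact: cintegrable_conj.
rewrite -cintZl//; apply: eq_cint => y.
have -> : ft (fun xi => ((ft b xi)^*)%C) y = ((ft_const%:C * b y)^*)%C.
  rewrite -(ft_inversion y bi cb1 cb2 Bb fi) -cint_conj; last first.
    by apply: cintegrable_expi => //; exact: measurable_phase.
  by apply: eq_cint => xi; rewrite expiN dotC -rmorphM.
by rewrite rmorphM mulrCA; congr (_ * _); exact: conjc_real.
Qed.

End fourier.

(** * Square-integrable functions and Moyal's identity *)

Section square_integrable.
Context (R : realType) (n : nat).
Local Notation leb := (lebesgue_cV R n).
Implicit Types (f g h : 'cV[R]_n -> R[i]) (x y z xi : 'cV[R]_n).
Local Opaque lebesgue_cV.

Lemma L2_cmeasurable f : L2 f -> cmeasurable f.
Proof. by case. Qed.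

Lemma L2P f : cmeasurable f ->
  L2 f <-> leb.-integrable setT (fun x => (normc (f x) ^+ 2)%:E).
Proof.
move=> mf; have [mf1 mf2] := mf; split=> [[_ _ foo]|/integrableP[_ foo]].
  apply/integrableP; split.
    by apply/measurable_EFinP; apply: measurable_funX; exact: measurable_normc.
  by under eq_integral do rewrite gee0_abs ?lee_fin ?sqr_ge0//.
split=> //; move: foo.
by under eq_integral do rewrite gee0_abs ?lee_fin ?sqr_ge0//.
Qed.

Lemma L2_comp (phi : 'cV[R]_n -> 'cV[R]_n) f : measurable_fun setT phi ->
  (forall F : 'cV[R]_n -> \bar R, measurable_fun setT F -> (forall x, (0 <= F x)%E) ->
    (\int[leb]_x F (phi x) = \int[leb]_x F x)%E) ->
  L2 f -> L2 (f \o phi).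
Proof.
move=> mphi subst fL2; have mf := L2_cmeasurable fL2.
have [m1 m2] := cmeasurable_comp mphi mf.
split=> //; rewrite (subst (fun x => (normc (f x) ^+ 2)%:E)).
- by have [] := fL2.
- by apply/measurable_EFinP; apply: measurable_funX; exact: measurable_normc.
- by move=> x; rewrite lee_fin sqr_ge0.
Qed.

Lemma L2_shift x f : L2 f -> L2 (fun y => f (y - x)).
Proof.
apply: (L2_comp (phi := fun y => y - x)); first exact: measurable_cV_shift.
by move=> F mF F0; exact: ge0_integral_cV_shift.
Qed.

Lemma L2_opp f : L2 f -> L2 (fun y => f (- y)).
Proof.
apply: (L2_comp (phi := -%R)); first exact: measurable_cVN.
by move=> F mF F0; exact: ge0_integral_cV_opp.
Qed.

Lemma cintegrable_L2M f g : L2 f -> L2 g -> cintegrable leb (fun y => f y * ((g y)^*)%C).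
Proof.
move=> fL2 gL2; have mf := L2_cmeasurable fL2; have mg := L2_cmeasurable gL2.
apply: (@cintegrable_le _ _ _ leb _ (fun y => normc (f y) ^+ 2 + normc (g y) ^+ 2)).
- by apply: cmeasurableM => //; exact: cmeasurable_conj.
- by have := integrableD measurableT ((L2P mf).1 fL2) ((L2P mg).1 gL2).
move=> y; rewrite ComplexField.Normc.normcM normc_conj.
have := sqr_ge0 (normc (f y) - normc (g y)).
have := sqr_ge0 (normc (f y)); have := sqr_ge0 (normc (g y)); lra.
Qed.

(** The short-time Fourier transform of [f] with window [h]; up to a phase it is the inner product
    of [f] with a time-frequency shift of [h]. *)
Definition stft f h x xi : R[i] := ft (fun y => f y * ((h (y - x))^*)%C) xi.

Lemma cmeasurable_stft f h : cmeasurable f -> cmeasurable h ->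
  cmeasurable (fun p : 'cV[R]_n * 'cV[R]_n => stft f h p.1 p.2).
Proof.
move=> mf mh; apply: (@cmeasurable_cint _ _ _ _ _ leb
  (fun (p : 'cV[R]_n * 'cV[R]_n) y => f y * ((h (y - p.1))^*)%C * expi (- (2 * pi * dot y p.2)))).
have m1 : measurable_fun setT (fun q : ('cV[R]_n * 'cV[R]_n) * 'cV[R]_n => q.1.1).
  by apply: measurableT_comp; [exact: measurable_fst|exact: measurable_fst].
have m2 : measurable_fun setT (fun q : ('cV[R]_n * 'cV[R]_n) * 'cV[R]_n => q.1.2).
  by apply: measurableT_comp; [exact: measurable_snd|exact: measurable_fst].
have m3 : measurable_fun setT (fun q : ('cV[R]_n * 'cV[R]_n) * 'cV[R]_n => q.2).
  exact: measurable_snd.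
apply: cmeasurableM; last first.
  by apply: cmeasurable_expi; apply: measurable_funN; exact: measurable_phase.
apply: cmeasurableM; first exact: (cmeasurable_comp m3 mf).
apply: cmeasurable_conj; apply: (cmeasurable_comp _ mh).
exact: measurable_cVB.
Qed.

(** Parseval in the frequency for each fixed [x], then Fubini and the substitution of [y - x] for
    [x], which separates the two inner products. The regularity sits in the second pair, so the
    first may consist of images under [M]. *)
Lemma moyal f1 g1 f2 g2 (B : R) : L2 f1 -> L2 g1 -> L2 f2 -> L2 g2 ->
  continuous (fun z => complex.Re (f2 z)) -> continuous (fun z => complex.Im (f2 z)) ->
  continuous (fun z => complex.Re (g2 z)) -> continuous (fun z => complex.Im (g2 z)) ->
  (forall z, normc (f2 z) <= B) -> (forall z, normc (g2 z) <= B) ->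
  (forall x, cintegrable leb (stft f2 g2 x)) ->
  cint leb (fun x => cint leb (fun xi => stft f1 g1 x xi * ((stft f2 g2 x xi)^*)%C)) =
  (ft_const R n)%:C * (inner f1 f2 * ((inner g1 g2)^*)%C).
Proof.
move=> f1L g1L f2L g2L cf1 cf2 cg1 cg2 Bf Bg si.
pose a x y := f1 y * ((g1 (y - x))^*)%C; pose b x y := f2 y * ((g2 (y - x))^*)%C.
have ai x : cintegrable leb (a x) by apply: cintegrable_L2M => //; exact: L2_shift.
have bi x : cintegrable leb (b x) by apply: cintegrable_L2M => //; exact: L2_shift.
have cs (u : 'cV[R]_n -> R) x : continuous u -> continuous (fun y => u (y - x)).
  move=> cu y; apply: (@continuous_comp _ _ _ (fun y => y - x) u); last exact: cu.
  by apply: (@continuousD _ _ _ id (cst (- x))); [exact: cvg_id|exact: cst_continuous].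
have cM (u v : 'cV[R]_n -> R) : continuous u -> continuous v -> continuous (fun y => u y * v y).
  by move=> cu cv y; apply: (@continuousM _ _ u v); [exact: cu|exact: cv].
have cD (u v : 'cV[R]_n -> R) : continuous u -> continuous v -> continuous (fun y => u y + v y).
  by move=> cu cv y; apply: (@continuousD _ _ _ u v); [exact: cu|exact: cv].
have cN (u : 'cV[R]_n -> R) : continuous u -> continuous (fun y => - u y).
  by move=> cu y; apply: (@continuousN _ _ _ u); exact: cu.
transitivity (cint leb (fun x => (ft_const R n)%:C * cint leb (fun y => a x y * ((b x y)^*)%C))).
  apply: eq_cint => x; apply: (parseval (B := B * B) (ai x) (bi x) _ _ _ (si x)).
  - under eq_fun do rewrite /b ReM Re_conj Im_conj mulrN opprK.
    exact: (cD _ _ (cM _ _ cf1 (cs _ x cg1)) (cM _ _ cf2 (cs _ x cg2))).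
  - under eq_fun do rewrite /b ImM Re_conj Im_conj mulrN.
    exact: (cD _ _ (cN _ (cM _ _ cf1 (cs _ x cg2))) (cM _ _ cf2 (cs _ x cg1))).
  - move=> z; rewrite /b ComplexField.Normc.normcM normc_conj.
    by rewrite ler_pM ?normc_ge0.
have f12 := cintegrable_L2M f1L f2L; have g12 := cintegrable_L2M g1L g2L.
have g21 := cintegrable_conj g12.
have subst (x : 'cV[R]_n) (F : 'cV[R]_n -> \bar R) : measurable_fun setT F -> (forall y, (0 <= F y)%E) ->
    (\int[leb]_y F (x - y)%R = \int[leb]_y F y)%E.
  move=> mF F0; rewrite -(ge0_integral_cV_opp mF F0).
  rewrite -(ge0_integral_cV_shift (- x) (F := fun y => F (- y)%R))//.
    by apply: eq_integral => y _; rewrite opprB.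
  by apply: measurableT_comp => //; exact: measurable_cVN.
have abE x y : a x y * ((b x y)^*)%C =
    f1 y * ((f2 y)^*)%C * ((g1 (y - x) * ((g2 (y - x))^*)%C)^*)%C.
  by rewrite /a /b !rmorphM /= !conjcK; ring.
have mab : cmeasurable (fun p : 'cV[R]_n * 'cV[R]_n => a p.1 p.2 * ((b p.1 p.2)^*)%C).
  have mdiff : measurable_fun setT (fun p : 'cV[R]_n * 'cV[R]_n => p.2 - p.1).
    by apply: measurable_cVB; [exact: measurable_snd|exact: measurable_fst].
  have m u v : L2 u -> L2 v -> cmeasurable (fun p : 'cV[R]_n * 'cV[R]_n =>
      u p.2 * ((v (p.2 - p.1))^*)%C).
    move=> /L2_cmeasurable mu /L2_cmeasurable mv; apply: cmeasurableM.
      exact: (cmeasurable_comp measurable_snd mu).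
    by apply: cmeasurable_conj; exact: (cmeasurable_comp mdiff mv).
  by apply: cmeasurableM; [exact: m|apply: cmeasurable_conj; exact: m].
have abi : cintegrable (leb \x leb)%E (fun p : 'cV[R]_n * 'cV[R]_n => a p.1 p.2 * ((b p.1 p.2)^*)%C).
  apply: (@cintegrable_le _ _ _ (leb \x leb)%E _ (fun p => normc (a p.1 p.2 * ((b p.1 p.2)^*)%C))) => //.
  have mn : measurable_fun setT (fun p : 'cV[R]_n * 'cV[R]_n =>
      (normc (a p.1 p.2 * ((b p.1 p.2)^*)%C))%:E).
    by apply/measurable_EFinP; exact: measurable_normc mab.
  apply/integrable21ltyP => //=.
  (* With [x] integrated first, the substitution turns the double integral of the modulus into a
     product of two finite ones. *)
  have E y : (\int[leb]_x `|(normc (a x y * ((b x y)^*)%C))%:E| =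
      (normc (f1 y * ((f2 y)^*)%C))%:E * \int[leb]_x (normc (g1 x * ((g2 x)^*)%C))%:E)%E.
    rewrite -(subst y (fun x => (normc (g1 x * ((g2 x)^*)%C))%:E)); last 2 first.
    - by apply/measurable_EFinP; apply: measurable_normc; exact: cintegrable_measurable g12.
    - by move=> x; rewrite lee_fin normc_ge0.
    rewrite -ge0_integralZl//; last 3 first.
    - apply/measurable_EFinP; apply: measurable_normc.
      apply: (cmeasurable_comp (phi := fun x => y - x) _ (cintegrable_measurable g12)).
      exact: measurable_cVB.
    - by move=> x _; rewrite lee_fin normc_ge0.
    - by rewrite lee_fin normc_ge0.
    apply: eq_integral => x _; rewrite gee0_abs ?lee_fin ?normc_ge0// abE -EFinM.
    by rewrite ComplexField.Normc.normcM normc_conj.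
  under eq_integral do rewrite E.
  have /integrableP[_] := integrable_normc f12; have /integrableP[mg] := integrable_normc g12.
  under eq_integral do rewrite gee0_abs ?lee_fin ?normc_ge0//.
  move=> goo; under eq_integral do rewrite gee0_abs ?lee_fin ?normc_ge0//.
  move=> foo; rewrite ge0_integralZr//; last 3 first.
  - by apply/measurable_EFinP; apply: measurable_normc; exact: cintegrable_measurable f12.
  - by move=> y _; rewrite lee_fin normc_ge0.
  - by apply: integral_ge0 => y _; rewrite lee_fin normc_ge0.
  have i0 (F : 'cV[R]_n -> R[i]) : (0 <= \int[leb]_x (normc (F x))%:E)%E.
    by apply: integral_ge0 => y _; rewrite lee_fin normc_ge0.
  by apply: lte_mul_pinfty => //; rewrite ge0_fin_numE.
rewrite cintZl; last exact: cintegrable_fubini abi.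
congr (_ * _); rewrite (cint_fubini abi).
transitivity (cint leb (fun y => f1 y * ((f2 y)^*)%C * ((inner g1 g2)^*)%C)); last first.
  by rewrite cintZr.
apply: eq_cint => y.
have mg21 := cintegrable_measurable g21.
have myg (h : 'cV[R]_n -> R[i]) : cmeasurable h -> cint leb (fun x => h (y - x)) = cint leb h.
  move=> mh; rewrite -(cint_opp mh) -(@cint_shift _ _ (- y) (fun x => h (- x))).
    by apply: eq_cint => x; rewrite opprB.
  by apply: (cmeasurable_comp _ mh); exact: measurable_cVN.
have -> : (inner g1 g2)^*%C = cint leb (fun x => (g1 x * ((g2 x)^*)%C)^*%C).
  by rewrite cint_conj.
rewrite -(myg _ mg21) -cintZl.
  by apply: eq_cint => x; rewrite abE.
have L2r h : L2 h -> L2 (fun x => h (y - x)).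
  by move=> hL; under eq_fun do rewrite -opprB; exact: (L2_shift y (L2_opp hL)).
by apply: cintegrable_conj; exact: (cintegrable_L2M (L2r _ g1L) (L2r _ g2L)).
Qed.

End square_integrable.

(** * Time-frequency shifts and metaplectic covariance *)

Section time_frequency_shifts.
Context (R : realType) (d : nat).
Local Notation leb := (lebesgue_cV R d).
Local Notation rho := (@sym_tfshift R d).
Implicit Types (f g h : 'cV[R]_d -> R[i]) (y : 'cV[R]_d) (z p w : 'cV[R]_(d + d)).
Local Opaque lebesgue_cV.

Lemma conj_expiM (t : R) (a : R[i]) : ((expi t * a)^*)%C = expi (- t) * (a^*)%C.
Proof. by rewrite expiN -rmorphM. Qed.

Definition sympl_form z w : R :=
  dot (usubmx w) (dsubmx z) - dot (usubmx z) (dsubmx w).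

Lemma sym_tfshiftE z h y : rho z h y =
  expi (2 * pi * dot y (dsubmx z) - pi * dot (usubmx z) (dsubmx z)) * h (y - usubmx z).
Proof. by rewrite /sym_tfshift /tfshift mulrA -expiD addrC. Qed.

Lemma sym_tfshiftM z w h :
  rho z (rho w h) = fun y => expi (pi * sympl_form z w) * rho (z + w) h y.
Proof.
have uD : usubmx (z + w) = usubmx z + usubmx w by apply/matrixP => i j; rewrite !mxE.
have dD : dsubmx (z + w) = dsubmx z + dsubmx w by apply/matrixP => i j; rewrite !mxE.
apply/funext => y; rewrite !sym_tfshiftE uD dD !mulrA -!expiD.
congr (expi _ * h _); last by rewrite opprD addrA.
by rewrite /sympl_form !(dotDl, dotDr, dotNl); ring.
Qed.

Lemma sym_tfshift_opp z h y : rho z h (- y) = rho (- z) (fun x => h (- x)) y.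
Proof.
have uN : usubmx (- z) = - usubmx z by apply/matrixP => i j; rewrite !mxE.
have dN : dsubmx (- z) = - dsubmx z by apply/matrixP => i j; rewrite !mxE.
rewrite !sym_tfshiftE uN dN opprK; congr (expi _ * h _); last by rewrite opprD.
by rewrite !(dotNl, dotNr) opprK.
Qed.

Lemma tfshiftE z h : tfshift z h =
  fun y => expi (pi * dot (usubmx z) (dsubmx z)) * rho z h y.
Proof.
by apply/funext => y; rewrite /sym_tfshift mulrA -expiD subrr expi0 mul1r.
Qed.

Lemma L2Z (t : R) h : L2 h -> L2 (fun y => expi t * h y).
Proof.
move=> hL; have mh := L2_cmeasurable hL.
have [m1 m2] : cmeasurable (fun y => expi t * h y).
  by apply: cmeasurableM => //; exact: cmeasurable_cst.
split=> //; under eq_integral do rewrite ComplexField.Normc.normcM normc_expi mul1r.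
by have [] := hL.
Qed.

Lemma L2_sym_tfshift z h : L2 h -> L2 (rho z h).
Proof.
move=> hL; have hsL := L2_shift (usubmx z) hL.
have [m1 m2] : cmeasurable (rho z h).
  rewrite (funext (sym_tfshiftE z h)); apply: cmeasurableM; last exact: L2_cmeasurable.
  by apply: cmeasurable_expi; apply: measurable_funB => //; exact: measurable_phase.
split=> //.
under eq_integral do rewrite sym_tfshiftE ComplexField.Normc.normcM normc_expi mul1r.
by have [] := hsL.
Qed.

Lemma inner_stft z f h : L2 f -> L2 h -> inner f (rho z h) =
  expi (pi * dot (usubmx z) (dsubmx z)) * stft f h (usubmx z) (dsubmx z).
Proof.
move=> fL hL; rewrite -cintZl; last first.
  apply: cintegrable_expi; first by apply: cintegrable_L2M => //; exact: L2_shift.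
  by apply: measurable_funN; exact: measurable_phase.
apply: eq_cint => y; rewrite sym_tfshiftE conj_expiM opprB expiD; ring.
Qed.

Lemma innerZr (t : R) f h : L2 f -> L2 h ->
  inner f (fun y => expi t * h y) = expi (- t) * inner f h.
Proof.
move=> fL hL; rewrite -[RHS]cintZl; last exact: cintegrable_L2M.
by apply: eq_cint => y; rewrite conj_expiM mulrCA.
Qed.

Lemma innerZl (t : R) f h : L2 f -> L2 h ->
  inner (fun y => expi t * f y) h = expi t * inner f h.
Proof.
move=> fL hL; rewrite -[RHS]cintZl; last exact: cintegrable_L2M.
by apply: eq_cint => y; rewrite mulrA.
Qed.

Lemma inner_sym_tfshift z f h : L2 f -> L2 h -> inner (rho z f) (rho z h) = inner f h.
Proof.
move=> fL hL; have mfh := cintegrable_measurable (cintegrable_L2M fL hL).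
rewrite -[RHS](cint_shift (- usubmx z) mfh); apply: eq_cint => y.
by rewrite !sym_tfshiftE conj_expiM mulrACA -expiD subrr expi0 mul1r.
Qed.

Lemma ae_eq_innerr f h h' : L2 f -> L2 h -> L2 h' -> h = h' %[ae leb] ->
  inner f h = inner f h'.
Proof.
move=> fL hL hL' hh'; apply: ae_eq_cint.
- exact: cintegrable_measurable (cintegrable_L2M fL hL).
- exact: cintegrable_measurable (cintegrable_L2M fL hL').
- by move: hh'; apply: filterS => y /= hy hT; rewrite hy.
Qed.

Lemma ae_eq_innerl f f' h : L2 f -> L2 f' -> L2 h -> f = f' %[ae leb] ->
  inner f h = inner f' h.
Proof.
move=> fL fL' hL ff'; apply: ae_eq_cint.
- exact: cintegrable_measurable (cintegrable_L2M fL hL).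
- exact: cintegrable_measurable (cintegrable_L2M fL' hL).
- by move: ff'; apply: filterS => y /= hy hT; rewrite hy.
Qed.

(** Moving the left shift to the other side gives [rho (- p)], [rho z] and [rho (- p)] in
    succession, which is [rho (z - p - p)] up to a phase. This displacement is the source of the
    decay in [p]. *)
Lemma normc_inner_crosscov z p f h : L2 f -> L2 h ->
  normc (inner (rho p f) (rho z (rho (- p) h))) = normc (inner f (rho (z - p - p) h)).
Proof.
move=> fL hL; have pfL := L2_sym_tfshift p fL.
have e : rho p (rho (z - p - p) h) =
    fun y => expi (pi * sympl_form p (z - p - p)) * rho (z - p) h y.
  by rewrite sym_tfshiftM subrKC.
rewrite -(inner_sym_tfshift p fL (L2_sym_tfshift _ hL)) e sym_tfshiftM.
have zpL := L2_sym_tfshift (z - p) hL.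
rewrite !(innerZr _ pfL zpL).
by rewrite !ComplexField.Normc.normcM !normc_expi.
Qed.

(** Conjugating [rho z] by [rho p] produces a phase that does not depend on [f] or [h]; functions
    with equal ambiguity functions therefore keep them equal when both are shifted by [p]. *)
Lemma inner_autocov z p f h : L2 f -> L2 h ->
  inner (rho p f) (rho z (rho p h)) =
  expi (pi * (sympl_form p z - sympl_form z p)) * inner f (rho z h).
Proof.
move=> fL hL; have pfL := L2_sym_tfshift p fL.
have zpL := L2_sym_tfshift (z + p) hL.
rewrite -(inner_sym_tfshift p fL (L2_sym_tfshift z hL)) !sym_tfshiftM (addrC p z).
rewrite !(innerZr _ pfL zpL) mulrA -expiD; congr (expi _ * _); ring.
Qed.

Section metaplectic.
Context (S : 'M[R]_(d + d)) (M : ('cV[R]_d -> R[i]) -> 'cV[R]_d -> R[i]).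
Hypotheses (uS : S \in unitmx) (MS : metaplectic S M).

Lemma metaplectic_L2 f : L2 f -> L2 (M f).
Proof. by case: MS => -[h _ _ _ _] _; exact: h. Qed.

Lemma metaplectic_inner f h : L2 f -> L2 h -> inner (M f) (M h) = inner f h.
Proof. by case: MS => -[_ _ _ k _] _; exact: k. Qed.

(** Covariance at [invmx S *m z] puts the shift inside [M], and unitarity then removes [M]. *)
Lemma inner_metaplectic z f h : L2 f -> L2 h ->
  inner (M f) (rho z (M h)) = inner f (rho (invmx S *m z) h).
Proof.
move=> fL hL; have zhL := L2_sym_tfshift (invmx S *m z) hL.
rewrite -(metaplectic_inner fL zhL).
apply: (ae_eq_innerr (metaplectic_L2 fL) (L2_sym_tfshift z (metaplectic_L2 hL)) (metaplectic_L2 zhL)).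
case: MS => _ /(_ (invmx S *m z) h hL).
by rewrite mulmxA mulmxV// mul1mx; apply: filterS => y /= hy hT; rewrite hy.
Qed.

Lemma metaplecticZ (t : R) f : L2 f ->
  M (fun y => expi t * f y) = (fun y => expi t * M f y) %[ae leb].
Proof.
move=> fL; case: MS => -[_ _ lin _ _] _.
(* Linearity is given for [a * f + g] as a whole, so homogeneity needs [M 0 = 0]; this is the case
   [a = 1], [f = g = 0], which reads [M 0 = M 0 + M 0]. *)
pose o : 'cV[R]_d -> R[i] := fun=> 0.
have oL : L2 o.
  split=> //; rewrite integral0_eq// => x _.
  by rewrite ComplexField.Normc.normc0 expr0n.
have := lin 1 o o oL oL; have := lin (expi t) f o fL oL.
rewrite (_ : (fun x => 1 * o x + o x) = o); last by apply/funext => x; rewrite /o mulr0 addr0.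
rewrite (_ : (fun x => _ * f x + o x) = (fun y => expi t * f y)); last first.
  by apply/funext => x; rewrite addr0.
apply: filterS2 => y /= h1 h2 hT; rewrite h1//.
have /eqP := h2 hT; rewrite mul1r -subr_eq subrr eq_sym => /eqP ->.
by rewrite addr0.
Qed.

(** Covariance carries the shift by [z] through [M], and unitarity of [rho w] brings the other shift
    to the left. The phases have modulus one, so a single displacement remains to be estimated. *)
Lemma normc_inner_metaplectic z w g h : L2 g -> L2 h ->
  normc (inner (M (tfshift z g)) (tfshift w h)) =
  normc (inner (rho (S *m z - w) (M g)) h).
Proof.
move=> gL hL; have MgL := metaplectic_L2 gL.
have zgL := L2_sym_tfshift z gL; have whL := L2_sym_tfshift w hL.
have SL := L2_sym_tfshift (S *m z) MgL.
rewrite !tfshiftE; set a := pi * _; set b := pi * _.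
have aeq : M (fun y => expi a * rho z g y) = (fun y => expi a * rho (S *m z) (M g) y) %[ae leb].
  have := metaplecticZ a zgL; case: MS => _ /(_ z g gL).
  by apply: filterS2 => y /= h1 h2 hT; rewrite h2// h1.
rewrite (ae_eq_innerl (metaplectic_L2 (L2Z a zgL)) (L2Z a SL) (L2Z b whL) aeq).
have e : rho w (rho (S *m z - w) (M g)) =
    fun y => expi (pi * sympl_form w (S *m z - w)) * rho (S *m z) (M g) y.
  by rewrite sym_tfshiftM subrKC.
rewrite -(inner_sym_tfshift w (L2_sym_tfshift _ MgL) hL) e.
rewrite (innerZl _ SL (L2Z b whL)) (innerZr _ SL whL) (innerZl _ SL whL).
by rewrite !ComplexField.Normc.normcM !normc_expi !mul1r.
Qed.

End metaplectic.
End time_frequency_shifts.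

(** * Decay of the short-time Fourier transform of Schwartz functions *)

Section schwartz_theory.
Context (R : realType) (n : nat).
Local Notation leb := (lebesgue_cV R n).
Implicit Types (f g : 'cV[R]_n -> R[i]) (x y xi : 'cV[R]_n).
Local Opaque lebesgue_cV.

Lemma schwartz_opp f : schwartz f -> schwartz (fun x => f (- x)).
Proof.
by move=> [f1 f2]; split; [exact: (schwartz_real_opp f1)|exact: (schwartz_real_opp f2)].
Qed.

Lemma schwartz_bound f k : schwartz f ->
  exists2 C : R, 0 <= C & forall x, normc (f x) <= C * weight x ^- k.
Proof.
move=> [f1 f2]; have [A A0 Ak] := schwartz_real_bound f1 k.
have [B B0 Bk] := schwartz_real_bound f2 k.
exists (A + B); first exact: addr_ge0.
by move=> x; rewrite mulrDl (le_trans (normc_le _))// lerD.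
Qed.

Lemma schwartz_bounded f : schwartz f -> exists B : R, forall x, normc (f x) <= B.
Proof.
move=> /(schwartz_bound 0)[C _ Ck]; exists C => x.
by have := Ck x; rewrite invr1 mulr1.
Qed.

Lemma schwartz_L2 f : schwartz f -> L2 f.
Proof.
move=> sf; have [sf1 sf2] := sf.
have mf : cmeasurable f by split; exact: schwartz_real_measurable.
have [C C0 Ck] := schwartz_bound n sf.
apply/(L2P mf); apply: (@integrable_weight_bound _ _ _ (C ^+ 2) (2 * n)) => //.
  by apply: measurable_funX; exact: measurable_normc.
move=> x; rewrite ger0_norm ?sqr_ge0// mulnC exprM -exprVn -exprMn.
by rewrite lerXn2r ?nnegrE ?normc_ge0 ?mulr_ge0 ?invr_ge0 ?exprn_ge0 ?weight_ge0.
Qed.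

(** Expand the complex product and write every sine as a cosine with phase [- (pi / 2)]; the real
    estimates for [cosint] then apply to each term. *)
Lemma stft_cosint f g x xi : schwartz f -> schwartz g ->
  let f1 y := complex.Re (f y) in let f2 y := complex.Im (f y) in
  let g1 y := complex.Re (g y) in let g2 y := complex.Im (g y) in
  stft f g x xi =
    (cosint f1 g1 x xi 0 + cosint f2 g2 x xi 0 +
     (cosint f2 g1 x xi (- (pi / 2)) - cosint f1 g2 x xi (- (pi / 2)))) +i*
    (cosint f2 g1 x xi 0 - cosint f1 g2 x xi 0 -
     (cosint f1 g1 x xi (- (pi / 2)) + cosint f2 g2 x xi (- (pi / 2)))).
Proof.
move=> [sf1 sf2] [sg1 sg2] f1 f2 g1 g2.
pose K (u v : 'cV[R]_n -> R) t y := u y * v (y - x) * cos (2 * pi * dot y xi + t).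
have KE u v t : cosint u v x xi t = \int[leb]_y K u v t y by [].
have Ki u v t : schwartz_real u -> schwartz_real v -> leb.-integrable setT (EFin \o K u v t).
  by move=> su sv; exact: integrable_cosint.
have sinE y : sin (2 * pi * dot y xi) = cos (2 * pi * dot y xi + - (pi / 2)).
  by rewrite cosBpihalf.
have ID u v : leb.-integrable setT (EFin \o u) -> leb.-integrable setT (EFin \o v) ->
    leb.-integrable setT (EFin \o (fun y => u y + v y)).
  by move=> iu iv; have := integrableD measurableT iu iv.
have IB u v : leb.-integrable setT (EFin \o u) -> leb.-integrable setT (EFin \o v) ->
    leb.-integrable setT (EFin \o (fun y => u y - v y)).
  by move=> iu iv; have := integrableB measurableT iu iv.
apply: eqC => /=; rewrite !KE.
  rewrite -(RintegralB measurableT (Ki _ _ _ sf2 sg1) (Ki _ _ _ sf1 sg2)).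
  rewrite -(RintegralD measurableT (Ki _ _ _ sf1 sg1) (Ki _ _ _ sf2 sg2)).
  rewrite -RintegralD//; [|by apply: ID; exact: Ki|by apply: IB; exact: Ki].
  apply: eq_Rintegral => y _; rewrite !(ReM, ImM) Re_conj Im_conj /= /K -!sinE addr0 cosN sinN.
  rewrite /f1 /f2 /g1 /g2; ring.
rewrite -(RintegralB measurableT (Ki _ _ _ sf2 sg1) (Ki _ _ _ sf1 sg2)).
rewrite -(RintegralD measurableT (Ki _ _ _ sf1 sg1) (Ki _ _ _ sf2 sg2)).
rewrite -RintegralB//; [|by apply: IB; exact: Ki|by apply: ID; exact: Ki].
apply: eq_Rintegral => y _; rewrite !(ReM, ImM) Re_conj Im_conj /= /K -!sinE addr0 cosN sinN.
rewrite /f1 /f2 /g1 /g2; ring.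
Qed.

Lemma weight_col_mx x xi : weight (col_mx x xi) <= weight x * (1 + \sum_i `|xi i ord0|).
Proof.
have : enorm (col_mx x xi) <= enorm x + enorm xi.
  rewrite -(ler_pXn2r (ltn0Sn 1)) ?nnegrE ?addr_ge0 ?enorm_ge0//.
  rewrite enorm_col_mx sqr_sqrtr ?addr_ge0 ?dot_ge0// -!sqr_enorm sqrrD.
  by rewrite addrAC lerDl mulrn_wge0// mulr_ge0 ?enorm_ge0.
have := ler_enorm_sum xi; rewrite /weight.
have := mulr_ge0 (enorm_ge0 x) (le_trans (enorm_ge0 xi) (ler_enorm_sum xi)).
by lra.
Qed.

Lemma cosint_weight (u v : 'cV[R]_n -> R) k : schwartz_real u -> schwartz_real v ->
  exists2 C : R, 0 <= C & forall x xi t,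
    `|cosint u v x xi t| <= C * weight (col_mx x xi) ^- k.
Proof.
move=> su sv; have [C C0 Ck] := cosint_decay su sv k k; exists C => // x xi t.
have s0 : 0 < 1 + \sum_i `|xi i ord0| by rewrite ltr_wpDr// sumr_ge0.
have := Ck x xi t; rewrite -ler_pdivlMr ?exprn_gt0// => /le_trans; apply.
rewrite -mulrA ler_wpM2l// -invfM -exprMn.
rewrite lef_pV2 ?posrE ?exprn_gt0 ?mulr_gt0 ?weight_gt0//.
rewrite lerXn2r ?nnegrE ?mulr_ge0 ?weight_ge0//; first exact: ltW.
exact: weight_col_mx.
Qed.

Lemma stft_decay f g k : schwartz f -> schwartz g ->
  exists2 C : R, 0 <= C & forall x xi,
    normc (stft f g x xi) <= C * weight (col_mx x xi) ^- k.
Proof.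
move=> sf sg; have [sf1 sf2] := sf; have [sg1 sg2] := sg.
have [C1 C10 H1] := cosint_weight k sf1 sg1; have [C2 C20 H2] := cosint_weight k sf2 sg2.
have [C3 C30 H3] := cosint_weight k sf2 sg1; have [C4 C40 H4] := cosint_weight k sf1 sg2.
(* Each of the four bounds is used once in the real part and once in the imaginary part. *)
exists (2 * (C1 + C2 + C3 + C4)); first by rewrite mulr_ge0// !addr_ge0.
move=> x xi; apply: (le_trans (normc_le _)); rewrite stft_cosint//=.
have nD (a b c e : R) : `|a + b + (c - e)| <= `|a| + `|b| + `|c| + `|e|.
  have := ler_normD (a + b) (c - e); have := ler_normD a b; have := ler_normB c e; lra.
have nB (a b c e : R) : `|a - b - (c + e)| <= `|a| + `|b| + `|c| + `|e|.
  have := ler_normB (a - b) (c + e); have := ler_normB a b; have := ler_normD c e; lra.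
apply: (le_trans (lerD (nD _ _ _ _) (nB _ _ _ _))).
have := H1 x xi 0; have := H2 x xi 0; have := H3 x xi 0; have := H4 x xi 0.
have := H1 x xi (- (pi / 2)); have := H2 x xi (- (pi / 2)).
have := H3 x xi (- (pi / 2)); have := H4 x xi (- (pi / 2)).
rewrite -mulrA !mulrDl; lra.
Qed.

End schwartz_theory.

(** * The phase-space integral in the coordinates of the Euler decomposition *)

Section phase_space_integral.
Context (R : realType) (d : nat).
Local Notation leb := (lebesgue_cV R).
Implicit Types (sigma : 'rV[R]_d) (x y : 'cV[R]_d) (q v z : 'cV[R]_(d + d)).
Local Opaque lebesgue_cV.

(** Provides [invmx (diag_mx sigma)] as a diagonal matrix with explicit entries, for the
    coordinatewise comparisons. *)
Definition inv_row sigma : 'rV[R]_d := \row_i (sigma ord0 i)^-1.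

Lemma mul_diag_inv_row sigma : (forall i, sigma ord0 i != 0) ->
  diag_mx sigma *m diag_mx (inv_row sigma) = 1%:M.
Proof.
move=> s0; apply/matrixP => i j; rewrite mul_diag_mx !mxE.
by case: eqP => _; rewrite ?mulr0n ?mulr0// mulr1n mulfV.
Qed.

Lemma invmx_diag sigma : (forall i, sigma ord0 i != 0) ->
  invmx (diag_mx sigma) = diag_mx (inv_row sigma).
Proof.
move=> /mul_diag_inv_row E; have [u _] := mulmx1_unit E.
by rewrite -[LHS]mulmx1 -E mulKmx.
Qed.

Lemma dot_diag_mx sigma x :
  dot (diag_mx sigma *m x) (diag_mx sigma *m x) = \sum_i sigma ord0 i ^+ 2 * x i ord0 ^+ 2.
Proof. by rewrite dotE; apply: eq_bigr => i _; rewrite mul_diag_mx mxE exprMn. Qed.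

Variables (U V : 'M[R]_(d + d)) (sigma : 'rV[R]_d).
Hypotheses (UU : U^T *m U = 1%:M) (VV : V^T *m V = 1%:M).
Hypothesis sigma_ge1 : forall i, 1 <= sigma ord0 i.
Let Sigma := diag_mx sigma.
Let Sinv := diag_mx (inv_row sigma).
Let S := U^T *m block_mx Sigma 0 0 (invmx Sigma) *m V.
Let Dinv := block_mx Sinv 0 0 Sigma.
Let D' : 'M[R]_(d + d) := block_mx Sinv 0 0 1%:M.

Let sigma_gt0 i : 0 < sigma ord0 i.
Proof. exact: lt_le_trans (sigma_ge1 i). Qed.

Let sigma_neq0 i : sigma ord0 i != 0.
Proof. by rewrite gt_eqF. Qed.

Lemma euler_invmxE : invmx S = V^T *m Dinv *m U.
Proof.
have SX : S *m (V^T *m Dinv *m U) = 1%:M.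
  rewrite /S invmx_diag// -/Sinv.
  rewrite !mulmxA -(mulmxA _ V) (mulmx1C VV) mulmx1 -(mulmxA U^T).
  rewrite mulmx_block !mulmx0 !mul0mx !addr0 !add0r mul_diag_inv_row// (mulmx1C (mul_diag_inv_row _))//.
  by rewrite -scalar_mx_block mulmx1.
have [u _] := mulmx1_unit SX.
by rewrite -[LHS]mulmx1 -SX mulKmx.
Qed.

Lemma enorm_euler_invmx v : enorm (invmx S *m v) = enorm (Dinv *m (U *m v)).
Proof.
rewrite euler_invmxE -!mulmxA [LHS]enorm_orthogonal//.
by rewrite trmxK; exact: mulmx1C.
Qed.

Let blockE (A B : 'M[R]_d) v : block_mx A 0 0 B *m v = col_mx (A *m usubmx v) (B *m dsubmx v).
Proof. by rewrite -[v in LHS]vsubmxK mul_block_col !mul0mx addr0 add0r. Qed.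

Let inv_row_sqr i : inv_row sigma ord0 i ^+ 2 <= 1.
Proof. by rewrite mxE expr_le1// ?invr_ge0 ?invf_le1// ltW. Qed.

Let dotSinv x : dot (Sinv *m x) (Sinv *m x) <= dot x x.
Proof.
rewrite dot_diag_mx dotE ler_sum// => i _.
by rewrite ler_piMl ?sqr_ge0// inv_row_sqr.
Qed.

Let dotSigma x : dot x x <= dot (Sigma *m x) (Sigma *m x).
Proof.
rewrite dot_diag_mx dotE ler_sum// => i _.
by rewrite ler_peMl ?sqr_ge0// expr_ge1// ltW.
Qed.

(** As every [sigma ord0 i] is at least [1], each diagonal entry of [D'] is the smaller of the
    entries of [Dinv] and of the identity, which explains the shape of [D']; [weight_D'] is the
    comparison with the identity. *)
Lemma weight_D'_Dinv v : weight (D' *m v) <= weight (Dinv *m v).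
Proof.
rewrite lerD2l !blockE !enorm_col_mx ler_wsqrtr// lerD2l mul1mx.
exact: dotSigma.
Qed.

Lemma weight_D' v : weight (D' *m v) <= weight v.
Proof.
rewrite lerD2l -[v in leRHS]vsubmxK blockE !enorm_col_mx ler_wsqrtr// mul1mx.
by rewrite lerD2r dotSinv.
Qed.

Lemma weight_Dinv_dsubmx v : weight (Sigma *m dsubmx v) <= weight (Dinv *m v).
Proof. by rewrite lerD2l blockE enorm_col_mx ler_wsqrtr// lerDr dot_ge0. Qed.

Lemma weight_usubmx v : weight (usubmx v) <= weight v.
Proof.
by rewrite lerD2l -[v in leRHS]vsubmxK enorm_col_mx ler_wsqrtr// lerDl dot_ge0.
Qed.

Definition weight_mass : R := \int[leb d]_x weight x ^- (2 * d).

Lemma ge0_integral_weight : (\int[leb d]_x (weight x ^- (2 * d))%:E = weight_mass%:E)%E.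
Proof.
by rewrite fineK//; apply: integrable_fin_num => //; exact: integrable_weightV.
Qed.

(** The part [L] of the exponent is spent on decay: by submultiplicativity the product of the two
    weights dominates [weight (D' *m U *m q)]. The part [2 * d] ensures convergence: after the
    rotation, the weight of [z] is kept in the position variables only, and the other weight in the
    frequency variables only, where it depends on [Sigma *m y] and yields the determinant. *)
Lemma phase_space_integral L q :
  (\int[leb (d + d)]_z (weight (invmx S *m (z - q)) ^- (L + 2 * d) *
     weight z ^- (L + 2 * d))%:E <=
   (weight_mass ^+ 2 * (\det Sigma)^-1 * weight (D' *m U *m q) ^- L)%:E)%E.
Proof.
pose h z := weight (Dinv *m (z - U *m q)) ^- (L + 2 * d) * weight z ^- (L + 2 * d).
have wV0 m k (v : 'cV[R]_m) : 0 <= weight v ^- k by rewrite invr_ge0 exprn_ge0// weight_ge0.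
have h0 z : (0 <= (h z)%:E)%E by rewrite lee_fin mulr_ge0.
have mh : measurable_fun setT (fun z => (h z)%:E).
  apply/measurable_EFinP; apply: measurable_funM; apply: measurable_weightV => //.
  by apply: measurable_mulmx; exact: measurable_cVB.
rewrite [leLHS](_ : _ = \int[leb (d + d)]_z (h (U *m z))%:E)%E; last first.
  apply: eq_integral => z _; rewrite /h -mulmxBr /weight enorm_euler_invmx.
  by rewrite (enorm_orthogonal z UU).
rewrite (ge0_integral_mulmx_orthogonal UU mh h0).
pose c := weight (D' *m U *m q) ^- L.
pose k1 x := weight x ^- (2 * d).
pose k2 y := weight (Sigma *m y - Sigma *m dsubmx (U *m q)) ^- (2 * d).
have hk z : h z <= c * (k1 (usubmx z) * k2 (dsubmx z)).
  have w0 m (v : 'cV[R]_m) := weight_gt0 v.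
  have e1 : weight (D' *m U *m q) <= weight (Dinv *m (z - U *m q)) * weight z.
    have -> : D' *m U *m q = D' *m z - D' *m (z - U *m q).
      by rewrite mulmxBr opprB addrC subrK mulmxA.
    rewrite mulrC (le_trans (weightD _ _))// weightN.
    by rewrite ler_pM ?weight_ge0 ?weight_D'// weight_D'_Dinv.
  rewrite /h !(exprD _ L) !invfM [leLHS](_ : _ = ((weight (Dinv *m (z - U *m q)) * weight z) ^- L) *
    (weight z ^- (2 * d) * weight (Dinv *m (z - U *m q)) ^- (2 * d))); last first.
    by rewrite exprMn invfM; ring.
  apply: ler_pM; rewrite ?mulr_ge0 ?invr_ge0 ?exprn_ge0 ?mulr_ge0 ?weight_ge0//.
    by rewrite lef_pV2 ?posrE ?exprn_gt0 ?mulr_gt0 ?w0// lerXn2r ?nnegrE ?mulr_ge0 ?weight_ge0.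
  apply: ler_pM; rewrite ?invr_ge0 ?exprn_ge0 ?weight_ge0//.
    by rewrite lef_pV2 ?posrE ?exprn_gt0 ?w0// lerXn2r ?nnegrE ?weight_ge0 ?weight_usubmx.
  rewrite lef_pV2 ?posrE ?exprn_gt0 ?w0// lerXn2r ?nnegrE ?weight_ge0//.
  apply: le_trans (weight_Dinv_dsubmx _); rewrite le_eqVlt; apply/orP; left; apply/eqP.
  by congr weight; rewrite -mulmxBr; congr (_ *m _); apply/matrixP => i j; rewrite !mxE.
have mk1 : measurable_fun setT k1 by exact: measurable_weightV.
have mk2 : measurable_fun setT k2.
  by apply: measurable_weightV; apply: measurable_cVB => //; exact: measurable_mulmx.
have k10 x : 0 <= k1 x by exact: wV0.
have k20 y : 0 <= k2 y by exact: wV0.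
have c0 : 0 <= c by exact: wV0.
rewrite (ge0_integral_col_mx mh h0).
have mk20 : measurable_fun setT (fun y => weight (Sigma *m y) ^- (2 * d)).
  by apply: measurable_weightV; exact: measurable_mulmx.
have ik2 : (\int[leb d]_y (k2 y)%:E = ((\det Sigma)^-1 * weight_mass)%:E)%E.
  rewrite det_diag EFinM -ge0_integral_weight.
  have mwE : measurable_fun setT (fun y : 'cV[R]_d => (weight y ^- (2 * d))%:E).
    by apply/measurable_EFinP; exact: measurable_weightV.
  rewrite -(ge0_integral_diag_mx sigma_gt0 mwE); last by move=> y; rewrite lee_fin.
  rewrite -[RHS](ge0_integral_cV_shift (- dsubmx (U *m q))); last 2 first.
  - exact/measurable_EFinP.
  - by move=> y; rewrite lee_fin.
  by apply: eq_integral => y _; rewrite /k2 mulmxBr.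
apply: (@le_trans _ _ (\int[leb d]_x ((c * k1 x)%:E * \int[leb d]_y (k2 y)%:E))%E).
  apply: ge0_le_integral => //.
  - by move=> x _; exact: integral_ge0.
  - apply: ge0_measurable_partial_integral => //.
    by apply: (measurableT_comp mh); apply: measurable_col_mx;
      [exact: measurable_fst|exact: measurable_snd].
  - rewrite ik2; under eq_fun do rewrite -EFinM.
    by apply/measurable_EFinP; do 2 apply: measurable_funM => //.
  move=> x _; rewrite -ge0_integralZl//; last 3 first.
  - exact/measurable_EFinP.
  - by move=> y _; rewrite lee_fin.
  - by rewrite lee_fin mulr_ge0.
  apply: ge0_le_integral => //.
  - by apply: (measurableT_comp mh); exact: measurable_col_mx.
  - by under eq_fun do rewrite -EFinM; apply/measurable_EFinP; apply: measurable_funM.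
  by move=> y _; rewrite -EFinM lee_fin (le_trans (hk _))// col_mxKu col_mxKd mulrA.
rewrite ik2 ge0_integralZr//; last 3 first.
- by apply/measurable_EFinP; apply: measurable_funM.
- by move=> x _; rewrite lee_fin mulr_ge0.
- rewrite lee_fin mulr_ge0 ?invr_ge0//; last by apply: Rintegral_ge0 => x _.
  by rewrite det_diag prodr_ge0// => i _; rewrite ltW.
under eq_integral do rewrite EFinM.
rewrite ge0_integralZl//; last 2 first.
- exact/measurable_EFinP.
- by move=> x _; rewrite lee_fin.
rewrite ge0_integral_weight -!EFinM lee_fin le_eqVlt; apply/orP; left; apply/eqP.
by rewrite /c; ring.
Qed.

End phase_space_integral.

(** * The estimate for a single shift, up to constants *)

(** Real and imaginary parts are bounded separately, whence the factor [2]. The extended real form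
    can be applied to nested integrals before anything is known about their convergence. *)
Lemma ge0_normc_cint dT (T : measurableType dT) (R : realType) (mu : {measure set T -> \bar R})
    (f : T -> R[i]) : cmeasurable f ->
  ((normc (cint mu f))%:E <= 2%:E * \int[mu]_x (normc (f x))%:E)%E.
Proof.
move=> mf; have [m1 m2] := mf.
have H (u : T -> R) : measurable_fun setT u -> (forall x, `|u x| <= normc (f x)) ->
    ((`|\int[mu]_x u x|)%:E <= \int[mu]_x (normc (f x))%:E)%E.
  move=> /measurable_EFinP mu_ uf; apply: (@le_trans _ _ `|\int[mu]_x (u x)%:E|%E).
    by rewrite /Rintegral; case: (\int[mu]_x _)%E => //=; rewrite normr0 leey.
  apply: (le_trans (le_abse_integral _ _ mu_)) => //; apply: ge0_le_integral => //.
  - exact: measurableT_comp.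
  - by apply/measurable_EFinP; exact: measurable_normc.
  - by move=> x _; rewrite lee_fin.
apply: (@le_trans _ _ ((`|\int[mu]_x complex.Re (f x)|)%:E + (`|\int[mu]_x complex.Im (f x)|)%:E)%E).
  by rewrite -EFinD lee_fin; exact: normc_le.
rewrite -[2%:E]/((1 + 1)%:E) EFinD ge0_muleDl// mul1e leeD// H// => x.
  exact: norm_Re_normc.
exact: norm_Im_normc.
Qed.

Section metaplectic_estimate.
Context (R : realType) (d : nat).
Local Notation leb := (lebesgue_cV R d).
Local Notation rho := (@sym_tfshift R d).
Implicit Types (f g h : 'cV[R]_d -> R[i]) (x y xi : 'cV[R]_d) (z p : 'cV[R]_(d + d)).
Local Opaque lebesgue_cV.

Lemma inner_opp f h : L2 f -> L2 h ->
  inner (fun y => f (- y)) (fun y => h (- y)) = inner f h.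
Proof.
move=> fL hL; exact: (cint_opp (cintegrable_measurable (cintegrable_L2M fL hL))).
Qed.

Lemma cintegrable_stft f h : schwartz f -> schwartz h ->
  forall x, cintegrable leb (stft f h x).
Proof.
move=> sf sh x; have [C C0 Ck] := stft_decay (2 * d) sf sh.
have m : cmeasurable (stft f h x).
  apply: cmeasurable_ft; apply: cintegrable_measurable; apply: cintegrable_L2M.
    exact: schwartz_L2.
  by apply: L2_shift; exact: schwartz_L2.
apply: (@cintegrable_le _ _ _ leb _ (fun xi => C * weight xi ^- (2 * d))) => //.
  by have := integrableZl measurableT C (integrable_weightV R (leqnn (2 * d))).
move=> xi; apply: (le_trans (Ck x xi)); rewrite ler_wpM2l//.
rewrite lef_pV2 ?posrE ?exprn_gt0 ?weight_gt0// lerXn2r ?nnegrE ?weight_ge0//.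
by rewrite lerD2l enorm_col_mx ler_wsqrtr// lerDr dot_ge0.
Qed.

Lemma schwartz_moyal f1 g1 f2 g2 : L2 f1 -> L2 g1 -> schwartz f2 -> schwartz g2 ->
  cint leb (fun x => cint leb (fun xi => stft f1 g1 x xi * ((stft f2 g2 x xi)^*)%C)) =
  (ft_const R d)%:C * (inner f1 f2 * ((inner g1 g2)^*)%C).
Proof.
move=> f1L g1L sf sg; have [B1 H1] := schwartz_bounded sf.
have [B2 H2] := schwartz_bounded sg; have [sf1 sf2] := sf; have [sg1 sg2] := sg.
apply: (@moyal _ _ _ _ _ _ (Num.max B1 B2)) => //; try exact: schwartz_L2.
- exact: schwartz_real_continuous sf1.
- exact: schwartz_real_continuous sf2.
- exact: schwartz_real_continuous sg1.
- exact: schwartz_real_continuous sg2.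
- by move=> z; rewrite le_max H1.
- by move=> z; rewrite le_max H2 orbT.
- exact: cintegrable_stft.
Qed.

Lemma stft_inner f h x xi : L2 f -> L2 h ->
  stft f h x xi = expi (- (pi * dot x xi)) * inner f (rho (col_mx x xi) h).
Proof.
by move=> fL hL; rewrite inner_stft// col_mxKu col_mxKd mulrA -expiD addNr expi0 mul1r.
Qed.

Lemma normc_stft f h x xi : L2 f -> L2 h ->
  normc (stft f h x xi) = normc (inner f (rho (col_mx x xi) h)).
Proof.
by move=> fL hL; rewrite stft_inner// ComplexField.Normc.normcM normc_expi mul1r.
Qed.

(* The ambiguity function z |-> <f, rho(z) f> determines f up to a unimodular
   constant. *)
Lemma eq_ambiguity f f' g : L2 f -> L2 f' -> schwartz g ->
  (forall z, inner f (rho z f) = inner f' (rho z f')) ->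
  normc (inner f g) = normc (inner f' g).
Proof.
move=> fL fL' sg ff'.
(* With equal entries in each pair, Moyal's identity expresses the squared modulus of [inner f g],
   while its left-hand side involves [f] only through the ambiguity function. *)
have := schwartz_moyal fL fL sg sg; have := schwartz_moyal fL' fL' sg sg.
have -> : stft f' f' = stft f f.
  by apply/funext => x; apply/funext => xi; rewrite !stft_inner// ff'.
move=> -> /(congr1 (@normc R)); rewrite !ComplexField.Normc.normcM !normc_conj normc_real => E.
have c0 : `|ft_const R d| != 0 by rewrite normr_eq0 gt_eqF// ft_const_gt0.
have := mulfI c0 E; rewrite -!expr2 => /eqP.
by rewrite eqrXn2 ?normc_ge0// => /eqP.
Qed.

Section covariance.
Context (S : 'M[R]_(d + d)) (M : ('cV[R]_d -> R[i]) -> 'cV[R]_d -> R[i]).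
Hypotheses (uS : S \in unitmx) (MS : metaplectic S M).
Context (g gam : 'cV[R]_d -> R[i]).
Hypotheses (sg : schwartz g) (sgam : schwartz gam).
Let P (f : 'cV[R]_d -> R[i]) : 'cV[R]_d -> R[i] := fun y => f (- y).
Let gL : L2 g. Proof. exact: schwartz_L2. Qed.
Let PgL : L2 (P g). Proof. exact: L2_opp. Qed.
Let MgL : L2 (M g). Proof. exact: (metaplectic_L2 MS). Qed.
Let MPgL : L2 (M (P g)). Proof. exact: (metaplectic_L2 MS). Qed.

Let PP f : P (P f) = f.
Proof. by apply/funext => y; rewrite /P opprK. Qed.

Let rhoP z f : rho z (P f) = P (rho (- z) f).
Proof. by apply/funext => y; rewrite /P sym_tfshift_opp opprK. Qed.

(* Replacing M by P M P, where P is the reflection, does not change the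
   ambiguity function; this replaces the identity P M = +- M P. *)
Lemma parity_metaplectic p :
  normc (inner (rho p (M g)) gam) = normc (inner (rho (- p) (M (P g))) (P gam)).
Proof.
have PMPgL : L2 (P (M (P g))) by exact: L2_opp.
rewrite (_ : rho (- p) (M (P g)) = P (rho p (P (M (P g))))); last by rewrite rhoP PP.
rewrite (inner_opp (L2_sym_tfshift p PMPgL) (schwartz_L2 sgam)).
apply: (eq_ambiguity (L2_sym_tfshift p MgL) (L2_sym_tfshift p PMPgL) sgam) => z.
rewrite (inner_autocov z p MgL MgL) (inner_autocov z p PMPgL PMPgL); congr (_ * _).
(* The value at [z] for [P (M (P g))] is the value at [- z] for [M (P g)], hence that at
   [- (invmx S *m z)] for [P g], hence that at [invmx S *m z] for [g]. *)
rewrite rhoP (inner_opp MPgL (L2_sym_tfshift (- z) MPgL)).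
rewrite (inner_metaplectic uS MS z gL gL) (inner_metaplectic uS MS (- z) PgL PgL).
by rewrite mulmxN rhoP opprK (inner_opp gL (L2_sym_tfshift _ gL)).
Qed.

Lemma sqr_inner_le p (C1 C2 : R) k : 0 <= C1 -> 0 <= C2 ->
  (forall x xi, normc (stft g (P g) x xi) <= C1 * weight (col_mx x xi) ^- k) ->
  (forall x xi, normc (stft gam (P gam) x xi) <= C2 * weight (col_mx x xi) ^- k) ->
  ((ft_const R d * normc (inner (rho p (M g)) gam) ^+ 2)%:E <=
   (4 * C1 * C2)%:E * \int[lebesgue_cV R (d + d)]_z
     (weight (invmx S *m (z - (p + p))) ^- k * weight z ^- k)%:E)%E.
Proof.
move=> C10 C20 H1 H2.
pose F := rho p (M g); pose G := rho (- p) (M (P g)).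
have FL : L2 F by exact: L2_sym_tfshift.
have GL : L2 G by exact: L2_sym_tfshift.
have sPgam : schwartz (P gam) by exact: schwartz_opp.
have gamL := schwartz_L2 sgam; have PgamL := schwartz_L2 sPgam.
have V1 x xi : normc (stft F G x xi) <=
    C1 * weight (invmx S *m (col_mx x xi - (p + p))) ^- k.
  rewrite (normc_stft _ _ FL GL) (normc_inner_crosscov _ _ MgL MPgL).
  rewrite (inner_metaplectic uS MS _ gL PgL) opprD addrA.
  by rewrite -[invmx S *m _]vsubmxK -(normc_stft _ _ gL PgL); exact: H1.
have mF := L2_cmeasurable FL; have mG := L2_cmeasurable GL.
have mV : cmeasurable (fun q : 'cV[R]_d * 'cV[R]_d =>
    stft F G q.1 q.2 * ((stft gam (P gam) q.1 q.2)^*)%C).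
  apply: cmeasurableM; first exact: cmeasurable_stft.
  by apply: cmeasurable_conj; apply: cmeasurable_stft; exact: L2_cmeasurable.
have mV2 : measurable_fun setT (fun q : 'cV[R]_d * 'cV[R]_d =>
    (normc (stft F G q.1 q.2 * ((stft gam (P gam) q.1 q.2)^*)%C))%:E).
  by apply/measurable_EFinP; exact: measurable_normc mV.
have -> : ft_const R d * normc (inner F gam) ^+ 2 =
    normc (cint leb (fun x => cint leb (fun xi => stft F G x xi * ((stft gam (P gam) x xi)^*)%C))).
  rewrite schwartz_moyal// !ComplexField.Normc.normcM normc_conj normc_real.
  rewrite (gtr0_norm (ft_const_gt0 R d)) expr2; congr (_ * (_ * _)).
  exact: parity_metaplectic.
have mw : measurable_fun setT (fun z => (weight (invmx S *m (z - (p + p))) ^- k * weight z ^- k)%:E).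
  apply/measurable_EFinP; apply: measurable_funM; apply: measurable_weightV => //.
  by apply: measurable_mulmx; exact: measurable_cVB.
have w0 (n : nat) (v : 'cV[R]_n) : 0 <= weight v ^- k.
  by rewrite invr_ge0 exprn_ge0// weight_ge0.
have ww0 z : (0 <= (weight (invmx S *m (z - (p + p))) ^- k * weight z ^- k)%:E)%E.
  by rewrite lee_fin mulr_ge0.
rewrite (ge0_integral_col_mx mw ww0).
apply: (le_trans (ge0_normc_cint _ _)).
  exact: (@cmeasurable_cint _ _ _ _ _ leb (fun x xi => stft F G x xi * ((stft gam (P gam) x xi)^*)%C)).
have mI (f : 'cV[R]_d * 'cV[R]_d -> \bar R) : measurable_fun setT f ->
    (forall q, (0 <= f q)%E) -> measurable_fun setT (fun x => \int[leb]_xi f (x, xi))%E.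
  by move=> mf f0; exact: measurable_fun_fubini_tonelli_F.
have mww : measurable_fun setT (fun x => \int[leb]_xi (weight (invmx S *m (col_mx x xi - (p + p))) ^- k *
    weight (col_mx x xi) ^- k)%:E)%E.
  apply: ge0_measurable_partial_integral => //; apply: (measurableT_comp mw).
  by apply: measurable_col_mx; [exact: measurable_fst|exact: measurable_snd].
(* One factor [2] for each of the two nested complex integrals. *)
have -> : (4 * C1 * C2)%:E = (2%:E * (2 * C1 * C2)%:E)%E by rewrite -EFinM; congr (_%:E); ring.
rewrite -muleA lee_pmul2l// -ge0_integralZl//; last 2 first.
- by move=> x _; exact: integral_ge0.
- by rewrite lee_fin !mulr_ge0.
apply: ge0_le_integral => //.
- by move=> x _; rewrite lee_fin normc_ge0.
- apply/measurable_EFinP; apply: measurable_normc.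
  exact: (@cmeasurable_cint _ _ _ _ _ leb (fun x xi => stft F G x xi * ((stft gam (P gam) x xi)^*)%C)).
- exact: measurable_funeM.
move=> x _; have mVx : cmeasurable (fun xi => stft F G x xi * ((stft gam (P gam) x xi)^*)%C).
  exact: (cmeasurable_comp (pair1_measurable x) mV).
apply: (le_trans (ge0_normc_cint _ mVx)).
have mwx : measurable_fun setT (fun xi => (weight (invmx S *m (col_mx x xi - (p + p))) ^- k *
    weight (col_mx x xi) ^- k)%:E).
  by apply: (measurableT_comp mw); exact: measurable_col_mx.
rewrite -!ge0_integralZl//; last 3 first.
- by rewrite lee_fin !mulr_ge0.
- by apply/measurable_EFinP; exact: measurable_normc.
- by move=> xi _; rewrite lee_fin normc_ge0.
apply: ge0_le_integral => //.
- by move=> xi _; rewrite mule_ge0// lee_fin normc_ge0.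
- by apply: measurable_funeM; apply/measurable_EFinP; exact: measurable_normc.
- exact: measurable_funeM.
move=> xi _; rewrite -!EFinM lee_fin ComplexField.Normc.normcM normc_conj.
have := ler_pM (normc_ge0 _) (normc_ge0 _) (V1 x xi) (H2 x xi).
lra.
Qed.

End covariance.
End metaplectic_estimate.

(** * Uniform constants and conclusion *)

Lemma metaplectic_shift_bound (R : realType) (d : nat) (g gam : 'cV[R]_d -> R[i]) (m : nat) :
  schwartz g -> schwartz gam -> exists2 C : R, 0 < C &
    forall (S U V : 'M[R]_(d + d)) (sigma : 'rV[R]_d) M,
      S \in unitmx -> metaplectic S M -> euler_decomposition S U V sigma ->
      forall p, normc (inner (sym_tfshift p (M g)) gam) <=
        C * Num.sqrt (\det (diag_mx sigma))^-1 *
        weight (block_mx (invmx (diag_mx sigma)) 0 0 1%:M *m U *m p) ^- m.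
Proof.
(* The estimate is for a square, so [2 * m] powers give decay of order [m]; the other [2 * d] are
   used up by [phase_space_integral]. *)
move=> sg sgam; pose k := (2 * m + 2 * d)%N.
have [C1 C10 H1] := stft_decay k sg (schwartz_opp sg).
have [C2 C20 H2] := stft_decay k sgam (schwartz_opp sgam).
pose K := 4 * C1 * C2 * weight_mass R d ^+ 2 / ft_const R d.
have K0 : 0 <= K by rewrite /K divr_ge0 ?(ltW (ft_const_gt0 R d))// mulr_ge0 ?sqr_ge0// !mulr_ge0.
(* [K] depends only on [g], [gam], [m] and [d], which makes the bound uniform in [S]; adding [1]
   makes the constant positive even when [K = 0]. *)
exists (Num.sqrt K + 1) => [|S U V sigma M uS MS [[_ UU] [_ VV] _ sigma1 SE] p].
  by rewrite ltr_wpDl ?sqrtr_ge0.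
have sigma0 i : sigma ord0 i != 0 by rewrite gt_eqF// (lt_le_trans ltr01).
rewrite (invmx_diag sigma0); set D' := block_mx _ _ _ _.
have det0 : 0 < \det (diag_mx sigma).
  rewrite det_diag; apply: prodr_gt0 => i _; exact: lt_le_trans ltr01 (sigma1 i).
have wp : 0 < weight (D' *m U *m p) by exact: weight_gt0.
(* The integral yields decay in [p + p]; doubling a vector does not decrease its norm, so this
   implies decay in [p]. *)
have wpp : weight (D' *m U *m p) <= weight (D' *m U *m (p + p)).
  rewrite mulmxDr lerD2l; apply: ler_enorm; have := dot_ge0 (D' *m U *m p).
  rewrite dotDl !dotDr; lra.
have := sqr_inner_le uS MS sg sgam p C10 C20 H1 H2.
have := phase_space_integral UU VV sigma1 (2 * m) (p + p).
rewrite -SE -/D' -/k => A B.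
have : ft_const R d * normc (inner (sym_tfshift p (M g)) gam) ^+ 2 <=
    4 * C1 * C2 * (weight_mass R d ^+ 2 / \det (diag_mx sigma) / weight (D' *m U *m (p + p)) ^+ (2 * m)).
  rewrite -lee_fin; apply: (le_trans B); rewrite [in leRHS]EFinM lee_wpmul2l// lee_fin !mulr_ge0//.
rewrite mulrC -ler_pdivlMr ?ft_const_gt0//.
move: (normc_ge0 (inner (sym_tfshift p (M g)) gam)); move: (normc _) => X X0 {}B.
have {}B : X ^+ 2 <=
    (Num.sqrt K * Num.sqrt (\det (diag_mx sigma))^-1 * weight (D' *m U *m p) ^- m) ^+ 2.
  rewrite exprMn exprMn !sqr_sqrtr ?invr_ge0 ?(ltW det0)//.
  rewrite exprVn -exprM.
  apply: (le_trans B); rewrite [leLHS](_ : _ =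
    K * (\det (diag_mx sigma))^-1 * weight (D' *m U *m (p + p)) ^- (2 * m)); last first.
    by rewrite /K; ring.
  rewrite mulnC; apply: ler_wpM2l; first by rewrite mulr_ge0 ?invr_ge0 ?(ltW det0).
  by rewrite lef_pV2 ?posrE ?exprn_gt0 ?weight_gt0// lerXn2r ?nnegrE ?weight_ge0.
have r0 : 0 <= Num.sqrt (\det (diag_mx sigma))^-1 * weight (D' *m U *m p) ^- m.
  by rewrite mulr_ge0 ?sqrtr_ge0// invr_ge0 exprn_ge0// ltW.
apply: (@le_trans _ _ (Num.sqrt K * Num.sqrt (\det (diag_mx sigma))^-1 * weight (D' *m U *m p) ^- m)).
  by rewrite -(@ler_pXn2r _ 2%N)// nnegrE // -mulrA mulr_ge0 ?sqrtr_ge0.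
by rewrite -!mulrA ler_wpM2r// lerDl.
Qed.

Theorem theorem1p1 (R : realType) (d : nat) (g gamma : 'cV[R]_d -> R[i]) (N : R) :
  schwartz g -> schwartz gamma -> 0 < N ->
  exists2 C : R, 0 < C &
    forall (S U V : 'M[R]_(d + d)) (sigma : 'rV[R]_d)
           (muS : ('cV[R]_d -> R[i]) -> 'cV[R]_d -> R[i]),
      symplectic S -> metaplectic S muS -> euler_decomposition S U V sigma ->
      let Sigma := diag_mx sigma in
      let D' := block_mx (invmx Sigma) 0 0 1%:M in
      forall z w : 'cV[R]_(d + d),
        ComplexField.Normc.normc (inner (muS (tfshift z g)) (tfshift w gamma)) <=
        C * (\det Sigma) `^ (- (1 / 2)) *
          (1 + enorm (D' *m U *m (w - S *m z))) `^ (- N).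
Proof.
(* A natural exponent larger than [N]; since the weight is at least [1], the bound with the larger
   exponent implies the one with [N]. *)
move=> sg sgamma N0; have [C C0 HC] := metaplectic_shift_bound (Num.truncn N).+1 sg sgamma.
exists C => // S U V sigma muS [uS _] MS SE Sigma D' z w.
have [_ _ _ sigma1 _] := SE.
have det0 : 0 <= \det Sigma.
  by rewrite det_diag; apply: prodr_ge0 => i _; exact: le_trans ler01 (sigma1 i).
rewrite (normc_inner_metaplectic MS z w (schwartz_L2 sg) (schwartz_L2 sgamma)).
have := HC S U V sigma muS uS MS SE (S *m z - w); rewrite -/Sigma -/D' => /le_trans; apply.
rewrite -(opprB w) mulmxN /weight enormN.
rewrite mul1r !powRN powR12_sqrt// sqrtrV// ler_wpM2l//.
  by rewrite mulr_ge0 ?(ltW C0)// invr_ge0 sqrtr_ge0.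
set e := enorm _; have e1 : 1 <= 1 + e by rewrite lerDl sqrtr_ge0.
have e0 : 0 < 1 + e by exact: lt_le_trans e1.
rewrite lef_pV2 ?posrE ?exprn_gt0 ?powR_gt0// -powR_mulrn ?(ltW e0)//.
by apply: ler_powR => //; exact/ltW/truncnS_gt.
Qed.
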